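(* Let $b>1$ and let $B_\alpha=(I+\alpha A^b)^{-1}$. Assume that $0<\varepsilon<\|f\|$ and that $\tau>1$ is a constant satisfying $0<\tau\varepsilon\le\|f\|$. Then there exists a unique number $\alpha_\varepsilon>0$ such that $$\|B_{\alpha_\varepsilon}f-f\|=\tau\varepsilon.$$ Let $u(t)$ be the solution of the backward problem $$\frac{\partial^\gamma u}{\partial t^\gamma}+Au=0,\quad 0<t<T,\qquad \|u(T)-f\|\le\varepsilon,$$ and let $v_{\alpha_\varepsilon}$ be the solution of the regularized problem $$\frac{\partial^\gamma v_{\alpha_\varepsilon}}{\partial t^\gamma}+A_{\alpha_\varepsilon}v_{\alpha_\varepsilon}=0,\quad 0<t<T,\qquad v_{\alpha_\varepsilon}(T)=f.$$ Then for $\varepsilon$ small enough there exist constants $C_3$ and $C_4$ such that (i) for $p<b-1$, $$\|u(0)-v_{\alpha_\varepsilon}(0)\|\le C_3\,\varepsilon^{\frac{p}{p+1}}\|u(0)\|_p^{\frac{1}{p+1}};$$ (ii) for $p\ge b-1$, $$\|u(0)-v_{\alpha_\varepsilon}(0)\|\le C_4\,\varepsilon^{\frac{p}{p+1}}\|u(0)\|_p^{\frac{1}{p+1}}+\varepsilon^{\frac{b-1}{b}}\|u(0)\|_p^{\frac1b}.$$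
   Context: Fix $\gamma\in(0,1)$ and $T>0$. $\mathbb H$ is a Hilbert space with inner product $\langle\cdot,\cdot\rangle$ and norm $\|\cdot\|$, and $f\in\mathbb H$. $A:D(A)\subset\mathbb H\to\mathbb H$ is a self-adjoint closed operator such that $-A$ generates a compact contraction semigroup on $\mathbb H$, and $A$ admits an orthonormal eigenbasis $\{\phi_n\}_{n\ge1}$ of $\mathbb H$ associated with eigenvalues $\{\lambda_n\}_{n\ge1}$, where $0<\lambda_1<\lambda_2<\cdots$ and $\lambda_n\to+\infty$. For $p>0$, $D(A^p)=\{\psi\in\mathbb H:\sum_{n\ge1}\lambda_n^{2p}\langle\psi,\phi_n\rangle^2<\infty\}$ and $\|\psi\|_p=\left(\sum_{n\ge1}\lambda_n^{2p}\langle\psi,\phi_n\rangle^2\right)^{1/2}$ for $\psi\in D(A^p)$. In the error estimates, $p>0$ and $u(0)\in D(A^p)$, so that $\|u(0)\|_p$ is defined. The Caputo derivative is $\frac{\partial^\gamma u}{\partial t^\gamma}(t)=\frac{1}{\Gamma(1-\gamma)}\int_0^t(t-s)^{-\gamma}\frac{\partial u}{\partial s}(s)\,ds$. $A^bv=\sum_{n\ge1}\lambda_n^b\langle v,\phi_n\rangle\phi_n$ for $v\in D(A^b)$. For $\alpha>0$, $B_\alpha v=(I+\alpha A^b)^{-1}v=\sum_{n\ge1}\frac{1}{1+\alpha\lambda_n^b}\langle v,\phi_n\rangle\phi_n$ and $A_\alpha v=(I+\alpha A^b)^{-1}Av=\sum_{n\ge1}\frac{\lambda_n}{1+\alpha\lambda_n^b}\langle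 v,\phi_n\rangle\phi_n$. A solution of $\partial^\gamma u/\partial t^\gamma+Lu=0$, $0<t<T$ (with $L=A$ or $L=A_\alpha$), is a function $u\in C^1((0,T),\mathbb H)\cap C([0,T],\mathbb H)$ with $u(t)\in D(L)$ for all $t\in(0,T)$ that satisfies the equation; the condition at $t=T$ is required in addition.
   Formalization: Existence and uniqueness of α_ε is stated for τε<‖f‖ instead of τε≤‖f‖, since for τε=‖f‖ no α>0 exists: ‖B_αf−f‖<‖f‖ for every α>0 and f≠0. *)

(* Defs.v *)
From Stdlib Require Import Reals.
From Coquelicot Require Import Coquelicot.
Open Scope R_scope.

(* Real power of a nonnegative base, for a positive exponent: Stdlib's
   [Rpower 0 y] is [1], not [0]. *)
Definition rpow (x y : R) : R :=
  if Req_EM_T x 0 then 0 else Rpower x y.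

(* With completeness from [CompleteNormedModule], a real Hilbert space;
   positive definiteness follows from [inner_norm]. *)
Record is_inner {H : NormedModule R_AbsRing} (inner : H -> H -> R) : Prop := {
  inner_sym : forall x y, inner x y = inner y x;
  inner_plus : forall x y z, inner (plus x y) z = inner x z + inner y z;
  inner_scal : forall (a : R) x y, inner (scal a x) y = a * inner x y;
  inner_norm : forall x, norm x = sqrt (inner x x)
}.

(* A partially defined operator; values of [op] outside [dom] are junk. *)
Record operator (H : NormedModule R_AbsRing) := Operator {
  dom : H -> Prop;
  op :> H -> H
}.
Arguments Operator {H} _ _.
Arguments dom {H} _ _.
Arguments op {H} _ _.

Record linear_operator {H : NormedModule R_AbsRing} (L : operator H) : Prop := {
  lin_dom_zero : dom L zero;
  lin_dom_plus : forall x y, dom L x -> dom L y -> dom L (plus x y);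
  lin_dom_scal : forall (a : R) x, dom L x -> dom L (scal a x);
  lin_plus : forall x y, dom L x -> dom L y -> L (plus x y) = plus (L x) (L y);
  lin_scal : forall (a : R) x, dom L x -> L (scal a x) = scal a (L x)
}.

Definition densely_defined {H : NormedModule R_AbsRing} (L : operator H) : Prop :=
  forall (x : H) (e : R), 0 < e -> exists y, dom L y /\ norm (minus y x) < e.

Definition closed_operator {H : NormedModule R_AbsRing} (L : operator H) : Prop :=
  closed (fun xy : H * H => dom L (fst xy) /\ snd xy = L (fst xy)).

(* The last clause is the equality of the graphs of [L] and of its adjoint. *)
Definition self_adjoint {H : NormedModule R_AbsRing} (inner : H -> H -> R)
    (L : operator H) : Prop :=
  linear_operator L /\ densely_defined L /\
  forall x y : H,
    (dom L x /\ y = L x) <-> (forall z, dom L z -> inner (L z) x = inner z y).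

Record C0_semigroup {H : NormedModule R_AbsRing} (S : R -> H -> H) : Prop := {
  sg_linear : forall t, 0 <= t -> is_linear (S t);
  sg_zero : forall x, S 0 x = x;
  sg_plus : forall s t x, 0 <= s -> 0 <= t -> S (s + t) x = S s (S t x);
  sg_cont : forall x, filterlim (fun t => S t x) (at_right 0) (locally x)
}.

Definition contraction_semigroup {H : NormedModule R_AbsRing} (S : R -> H -> H)
  : Prop :=
  forall t x, 0 <= t -> norm (S t x) <= norm x.

Definition compact_map {H : NormedModule R_AbsRing} (K : H -> H) : Prop :=
  forall x : nat -> H, (exists M : R, forall n, norm (x n) <= M) ->
  exists (k : nat -> nat) (y : H),
    (forall n, (k n < k (S n))%nat) /\
    filterlim (fun n => K (x (k n))) eventually (locally y).

Definition compact_semigroup {H : NormedModule R_AbsRing} (S : R -> H -> H)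
  : Prop :=
  forall t, 0 < t -> compact_map (S t).

(* The infinitesimal generator of [S] is [-L], with equality of domains. *)
Definition generated_by_opp {H : NormedModule R_AbsRing} (L : operator H)
    (S : R -> H -> H) : Prop :=
  forall x y : H,
    (dom L x /\ y = opp (L x)) <->
    filterlim (fun t => scal (/ t) (minus (S t x) x)) (at_right 0) (locally y).

(* Indices are shifted by one: [lam n], [phi n] are the (n+1)-st eigenvalue
   and eigenvector. *)
Record eigenbasis {H : NormedModule R_AbsRing} (inner : H -> H -> R)
    (L : operator H) (lam : nat -> R) (phi : nat -> H) : Prop := {
  eb_unit : forall n, inner (phi n) (phi n) = 1;
  eb_orth : forall n m, n <> m -> inner (phi n) (phi m) = 0;
  eb_basis : forall v, is_series (fun n => scal (inner v (phi n)) (phi n)) v;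
  eb_dom : forall n, dom L (phi n);
  eb_eigen : forall n, L (phi n) = scal (lam n) (phi n);
  eb_pos : 0 < lam 0%nat;
  eb_incr : forall n, lam n < lam (S n);
  eb_infty : is_lim_seq lam p_infty
}.

Definition standing_assumptions {H : NormedModule R_AbsRing}
    (inner : H -> H -> R) (A : operator H) (lam : nat -> R) (phi : nat -> H)
  : Prop :=
  self_adjoint inner A /\ closed_operator A /\
  (exists S : R -> H -> H,
     C0_semigroup S /\ contraction_semigroup S /\ compact_semigroup S /\
     generated_by_opp A S) /\
  eigenbasis inner A lam phi.

Definition in_DAp {H : NormedModule R_AbsRing} (inner : H -> H -> R)
    (lam : nat -> R) (phi : nat -> H) (p : R) (psi : H) : Prop :=
  ex_series (fun n => Rpower (lam n) (2 * p) * (inner psi (phi n)) ^ 2).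

Definition norm_p {H : NormedModule R_AbsRing} (inner : H -> H -> R)
    (lam : nat -> R) (phi : nat -> H) (p : R) (psi : H) : R :=
  sqrt (Series (fun n => Rpower (lam n) (2 * p) * (inner psi (phi n)) ^ 2)).

(* v |-> sum_n m_n <v, phi_n> phi_n, on the vectors for which this series
   converges in H; [iota] selects its sum. *)
Definition diag_op {H : CompleteNormedModule R_AbsRing} (inner : H -> H -> R)
    (phi : nat -> H) (m : nat -> R) : operator H :=
  Operator
    (fun v => ex_series (fun n => scal (m n * inner v (phi n)) (phi n)))
    (fun v => iota (is_series (fun n => scal (m n * inner v (phi n)) (phi n)))).

Definition B_op {H : CompleteNormedModule R_AbsRing} (inner : H -> H -> R)
    (lam : nat -> R) (phi : nat -> H) (b alpha : R) : operator H :=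
  diag_op inner phi (fun n => 1 / (1 + alpha * Rpower (lam n) b)).

Definition A_op {H : CompleteNormedModule R_AbsRing} (inner : H -> H -> R)
    (lam : nat -> R) (phi : nat -> H) (b alpha : R) : operator H :=
  diag_op inner phi (fun n => lam n / (1 + alpha * Rpower (lam n) b)).

Definition Gamma (x : R) : R :=
  RInt_gen (fun t => Rpower t (x - 1) * exp (- t))
    (at_right 0) (Rbar_locally p_infty).

(* Coquelicot's [Derive] is only for real-valued functions. *)
Definition vderive {H : CompleteNormedModule R_AbsRing} (u : R -> H) (t : R) : H :=
  iota (is_derive u t).

(* [w] is the Caputo derivative of order [gamma] of [u] at [t].  The integrand
   may be singular at both ends, so the integral is an improper one. *)
Definition is_caputo {H : CompleteNormedModule R_AbsRing} (gamma : R)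
    (u : R -> H) (t : R) (w : H) : Prop :=
  exists I : H,
    is_RInt_gen (fun s => scal (Rpower (t - s) (- gamma)) (vderive u s))
      (at_right 0) (at_left t) I /\
    w = scal (1 / Gamma (1 - gamma)) I.

(* [u] is total, but only its values on [0, T] matter. *)
Record is_solution {H : CompleteNormedModule R_AbsRing} (gamma T : R)
    (L : operator H) (u : R -> H) : Prop := {
  sol_cont : continuous_on (fun t => 0 <= t <= T) u;
  sol_diff : forall t, 0 < t < T -> ex_derive u t;
  sol_C1 : forall t, 0 < t < T -> continuous (vderive u) t;
  sol_dom : forall t, 0 < t < T -> dom L (u t);
  sol_eq : forall t, 0 < t < T ->
    exists w, is_caputo gamma u t w /\ plus w (L (u t)) = zero
}.

(* Main.v *)
(* On each eigenvector the problem is a scalar relaxation equation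
   [D^gamma y = - k y].  Integrating by parts puts the Caputo derivative in the
   Marchaud form [t^(-g) (y t - y 0) + g int_0^t (t-s)^(-g-1) (y t - y s) ds], which
   is nonnegative at a maximum of [y].  The resulting maximum principle, with linear
   barriers, time shifts and time rescalings, gives without any Mittag-Leffler
   function that [y T / y 0] lies between two multiples of [1/k] and depends on [k]
   in a Lipschitz way.  Hence the coefficients of [u(0) - v(0)] are bounded by
   [m_n |u_n(0)| + (1 + mu_n) |u_n(T) - f_n|], where [m_n] and [mu_n] are the
   eigenvalues of [I - B_alpha] and [A_alpha].  The first term is interpolated between
   the discrepancy and [||u(0)||_p].  The second needs a lower bound on [alpha], which
   the discrepancy principle gives, since [tau > 1].  In case (ii) the coefficient [1]
   of the last term is obtained by letting [eps] be small depending on [f]. *)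
Require Import Defs.
From Stdlib Require Import Reals Lra Lia Psatz Classical.
From Coquelicot Require Import Coquelicot.
Open Scope R_scope.

(** * The fractional derivative in Marchaud form *)

(** Passing from [u(0)] to [u(T)] gains one power of [A], since [Y T / Y 0] is of order [1/k]; so
    [||A^(p+1) u(T)||] is at most a multiple of [M = ||u(0)||_p]. This is why [p + 1] governs the
    rates: cutting the spectrum at the frequency [L] with [L^(p+1) = M / eps] balances [L eps] with
    [L^(-p) M], and [L eps = eps^(p/(p+1)) M^(1/(p+1))]. The threshold [p = b - 1] is a saturation
    effect. The noise is amplified by at most [1 + alpha^(-1/b)]. The damping factor [x / (1 + x)]
    with [x = alpha lam^b] is bounded by [x^th] only for [th <= 1], so the lower bound for [alpha]
    is of order [(eps / M)^(b/(p+1))] while [p + 1 <= b], and of order [eps / M] beyond; the latter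
    produces [eps^((b-1)/b) M^(1/b)]. [C3] and [C4] are chosen before [f], and [eps0] after it, so
    the constants may not depend on the data. Solutions are differentiable only inside [(0, T)];
    every comparison is therefore made for [t < T] and passes to [T] by continuity. *)

Ltac ring_R := lazymatch goal with |- @eq _ ?x ?y => change (@eq R x y) end; ring.

(** This is [Gamma (1 - g)] times the Caputo derivative; the normalising factor is absorbed later
    into the relaxation rate. Cutting the integral at [c < t] keeps every integral proper, so the
    singularity at [s = t] enters only through the limit. *)
Definition marchaud (g : R) (Y : R -> R) (t I : R) : Prop :=
  filterlim
    (fun c => Rpower t (- g) * (Y t - Y 0)
              + g * RInt (fun s => Rpower (t - s) (- g - 1) * (Y t - Y s)) 0 c)
    (at_left t) (locally I).

Lemma ball_R (x y : R) (e : posreal) : ball x e y -> Rabs (y - x) < e.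
Proof. exact (fun h => h). Qed.

Lemma R_ball (x y : R) (e : posreal) : Rabs (y - x) < e -> ball x e y.
Proof. exact (fun h => h). Qed.

Lemma continuous_Rpower_sub (t p s : R) : s < t -> continuous (fun s => Rpower (t - s) p) s.
Proof.
  intros Hs. apply (@ex_derive_continuous R_AbsRing R_NormedModule).
  unfold Rpower. auto_derive. lra.
Qed.

Lemma ex_RInt_kernel (p t d a c : R) (Y : R -> R) :
  (forall x, continuous Y x) -> a <= c < t ->
  ex_RInt (fun s => Rpower (t - s) p * (d - Y s)) a c.
Proof.
  intros HY H. apply (@ex_RInt_continuous R_CompleteNormedModule). intros z Hz.
  rewrite Rmin_left, Rmax_right in Hz by lra.
  apply (continuous_mult (K := R_AbsRing)).
  - apply continuous_Rpower_sub. lra.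
  - apply (continuous_minus (V := R_NormedModule) (fun _ => d) Y).
    apply continuous_const. apply HY.
Qed.

Lemma at_left_between (a t : R) : a < t -> at_left t (fun c => a < c < t).
Proof.
  intros H. assert (He : 0 < t - a) by lra.
  exists (mkposreal _ He). intros y Hy Hyt.
  apply ball_R in Hy; simpl in Hy.
  apply Rabs_def2 in Hy. lra.
Qed.

Lemma at_right_between (a t : R) : a < t -> at_right a (fun c => a < c < t).
Proof.
  intros H. assert (He : 0 < t - a) by lra.
  exists (mkposreal _ He). intros y Hy Hyt.
  apply ball_R in Hy; simpl in Hy.
  apply Rabs_def2 in Hy. lra.
Qed.

Lemma filterlim_le_R {X : Type} {F : (X -> Prop) -> Prop} {FF : ProperFilter F} (f h : X -> R) (lf lh : R) :
  F (fun x => f x <= h x) -> filterlim f F (locally lf) -> filterlim h F (locally lh) -> lf <= lh.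
Proof.
  intros H Hf Hh.
  apply (filterlim_le (F := F) f h lf lh H Hf Hh).
Qed.

Lemma filterlim_lincomb {F : (R -> Prop) -> Prop} {FF : Filter F} (f h : R -> R) (a b lf lh : R) :
  filterlim f F (locally lf) -> filterlim h F (locally lh) ->
  filterlim (fun x => a * f x + b * h x) F (locally (a * lf + b * lh)).
Proof.
  intros Hf Hh.
  apply (filterlim_comp_2 (G := locally (a * lf)) (H := locally (b * lh)) (fun x => a * f x) (fun x => b * h x) Rplus).
  - apply (filterlim_comp _ _ _ f (fun y => a * y) _ _ _ Hf).
    apply (filterlim_scal_r (V := R_NormedModule) a lf).
  - apply (filterlim_comp _ _ _ h (fun y => b * y) _ _ _ Hh).
    apply (filterlim_scal_r (V := R_NormedModule) b lh).
  - apply (filterlim_plus (V := R_NormedModule)).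
Qed.

Lemma RInt_lincomb (f h : R -> R) (x y a b : R) :
  ex_RInt f x y -> ex_RInt h x y ->
  RInt (fun s => a * f s + b * h s) x y = a * RInt f x y + b * RInt h x y.
Proof.
  intros Hf Hh.
  rewrite (RInt_plus (V := R_CompleteNormedModule) (fun s => a * f s) (fun s => b * h s)).
  - rewrite (RInt_scal (V := R_CompleteNormedModule) f), (RInt_scal (V := R_CompleteNormedModule) h); auto.
  - apply (ex_RInt_scal (V := R_NormedModule) f); auto.
  - apply (ex_RInt_scal (V := R_NormedModule) h); auto.
Qed.

Lemma marchaud_lincomb (g : R) (Y Z : R -> R) (a b t I J : R) :
  0 < t -> (forall x, continuous Y x) -> (forall x, continuous Z x) ->
  marchaud g Y t I -> marchaud g Z t J ->
  marchaud g (fun s => a * Y s + b * Z s) t (a * I + b * J).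
Proof.
  intros Ht HY HZ HI HJ. unfold marchaud in *.
  eapply filterlim_ext_loc; [| apply (filterlim_lincomb _ _ a b _ _ HI HJ)].
  generalize (at_left_between 0 t Ht). apply filter_imp. intros c Hc.
  set (f := fun s => Rpower (t - s) (- g - 1) * (Y t - Y s)).
  set (h := fun s => Rpower (t - s) (- g - 1) * (Z t - Z s)).
  replace (RInt (fun s => Rpower (t - s) (- g - 1) * (a * Y t + b * Z t - (a * Y s + b * Z s))) 0 c)
    with (a * RInt f 0 c + b * RInt h 0 c).
  - ring.
  - rewrite <- RInt_lincomb; try (apply ex_RInt_kernel; [assumption | lra]).
    apply RInt_ext. intros s _. unfold f, h. ring_R.
Qed.

(** At a maximum the integrand is nonnegative and only the boundary term survives. It is kept rather
    than weakened to [0]: the maximum principle and the lower bound on [Y T] both rely on it. *)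
Lemma marchaud_at_max (g : R) (Y : R -> R) (t I : R) :
  0 < g -> 0 < t -> (forall x, continuous Y x) ->
  (forall s, 0 <= s <= t -> Y s <= Y t) -> marchaud g Y t I ->
  Rpower t (- g) * (Y t - Y 0) <= I.
Proof.
  intros Hg Ht HY Hm HI.
  eapply (filterlim_le_R (F := at_left t) (fun _ => Rpower t (- g) * (Y t - Y 0)) _ _ I);
    [| apply filterlim_const | exact HI].
  generalize (at_left_between 0 t Ht). apply filter_imp. intros c Hc.
  assert (0 <= RInt (fun s => Rpower (t - s) (- g - 1) * (Y t - Y s)) 0 c).
  { apply RInt_ge_0. lra. apply ex_RInt_kernel; [assumption | lra].
    intros s Hs. apply Rmult_le_pos. left; apply exp_pos.
    specialize (Hm s). lra. }
  assert (0 <= g * RInt (fun s => Rpower (t - s) (- g - 1) * (Y t - Y s)) 0 c).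
  { apply Rmult_le_pos; lra. }
  lra.
Qed.

(** At a negative minimum [m], the preceding bound for [- Z] gives [I m <= m^(-g) (Z m - Z 0)], so
    the sum in the hypothesis would be at most [(kap + m^(-g)) Z m < 0]. The boundary term thus pays
    for the summand [Rpower t (- g) * Z 0], a slack that the time-shift argument uses up. *)
Lemma marchaud_nonneg (g T : R) (Z I : R -> R) (kap : R) :
  0 < g -> 0 <= kap -> (forall x, continuous Z x) -> 0 <= Z 0 ->
  (forall t, 0 < t < T -> marchaud g Z t (I t)) ->
  (forall t, 0 < t < T -> 0 <= I t + kap * Z t + Rpower t (- g) * Z 0) ->
  forall t, 0 <= t < T -> 0 <= Z t.
Proof.
  intros Hg Hk HZ H0 HM HI t Ht.
  destruct (Rle_lt_dec 0 (Z t)) as [H|Hneg]; [exact H | exfalso].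
  destruct (continuity_ab_min Z 0 t) as [m [Hm Hm']]. lra.
  { intros c _. apply continuity_pt_filterlim, HZ. }
  assert (Z m <= Z t) by (apply Hm; lra).
  assert (0 < m). { destruct (Req_dec m 0) as [->|]; lra. }
  (* The summand with coefficient [0] only brings [- Z] into the shape of [marchaud_lincomb]. *)
  assert (Hmax := marchaud_at_max g (fun s => (-1) * Z s + 0 * Z s) m ((-1) * I m + 0 * I m) Hg H1).
  assert (Hle : Rpower m (- g) * (-1 * Z m + 0 * Z m - (-1 * Z 0 + 0 * Z 0)) <= -1 * I m + 0 * I m).
  { apply Hmax.
    - intros x. apply (continuous_plus (V := R_NormedModule) (fun s => -1 * Z s) (fun s => 0 * Z s)).
      + apply (continuous_scal_r (V := R_NormedModule) (-1) Z), HZ.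
      + apply (continuous_scal_r (V := R_NormedModule) 0 Z), HZ.
    - intros s Hs. specialize (Hm s). lra.
    - apply marchaud_lincomb; auto; apply HM; lra. }
  specialize (HI m ltac:(lra)).
  assert (0 < Rpower m (- g)) by apply exp_pos.
  assert (kap * Z m <= 0) by nra.
  assert (Rpower m (-g) * Z m < 0) by nra.
  nra.
Qed.

Lemma is_derive_Rpower_sub (t p s : R) :
  s < t -> is_derive (fun s => Rpower (t - s) p) s (- p * Rpower (t - s) (p - 1)).
Proof.
  intros Hs.
  replace (- p * Rpower (t - s) (p - 1)) with (- p * / (t - s) * Rpower (t - s) p).
  - unfold Rpower. auto_derive. lra. unfold Rminus. field. lra.
  - replace (p - 1) with (p + - (1)) by ring. rewrite Rpower_plus, Rpower_Ropp, Rpower_1 by lra. field. lra.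
Qed.

Lemma is_RInt_Rpower_sub (t p a c : R) :
  p <> 0 -> a <= c < t ->
  is_RInt (fun s => Rpower (t - s) (p - 1)) a c ((Rpower (t - a) p - Rpower (t - c) p) / p).
Proof.
  intros Hp Hac.
  replace ((Rpower (t - a) p - Rpower (t - c) p) / p)
    with (minus (- / p * Rpower (t - c) p) (- / p * Rpower (t - a) p) : R_NormedModule)
    by (unfold minus, plus, opp; simpl; field; exact Hp).
  apply (is_RInt_derive (V := R_CompleteNormedModule) (fun s => - / p * Rpower (t - s) p)).
  - intros x Hx. rewrite Rmin_left, Rmax_right in Hx by lra.
    replace (Rpower (t - x) (p - 1)) with (- / p * (- p * Rpower (t - x) (p - 1))) by (field; exact Hp).
    apply is_derive_scal. apply is_derive_Rpower_sub. lra.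
  - intros x Hx. rewrite Rmin_left, Rmax_right in Hx by lra.
    apply continuous_Rpower_sub. lra.
Qed.

Lemma filterlim_affine_at_left (r h t : R) :
  0 < r -> filterlim (fun c => r * c + h) (at_left t) (at_left (r * t + h)).
Proof.
  intros Hr P [e He].
  assert (Hd : 0 < e / r) by (apply Rdiv_lt_0_compat; [apply cond_pos | exact Hr]).
  exists (mkposreal _ Hd). intros y Hy Hyt. apply He.
  - unfold ball in *; simpl in *; unfold AbsRing_ball, abs, minus, plus, opp in *; simpl in *.
    replace (r * y + h + - (r * t + h)) with (r * (y + - t)) by ring.
    rewrite Rabs_mult, (Rabs_pos_eq r) by lra.
    apply (Rmult_lt_compat_l r) in Hy; [| exact Hr].
    replace (r * (e / r)) with (pos e) in Hy by (field; lra). exact Hy.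
  - apply (Rmult_lt_compat_l r) in Hyt; lra.
Qed.

(** The substitution [s -> r s + h] multiplies the integral by [r^g]. What differs is the past: [Y]
    has a history on [[0, h]] that the new function lacks, so its boundary term and its integral
    over [[0, h]] are taken out, and a boundary term starting from [Y h] is put in. Used with
    [r = 1] as a time shift and with [h = 0] as a rescaling. *)
Lemma marchaud_affine (g r h t I : R) (Y : R -> R) :
  0 < r -> 0 <= h -> 0 < t -> (forall x, continuous Y x) ->
  marchaud g Y (r * t + h) I ->
  marchaud g (fun s => Y (r * s + h)) t
    (Rpower t (- g) * (Y (r * t + h) - Y h)
     + Rpower r g * (I - Rpower (r * t + h) (- g) * (Y (r * t + h) - Y 0)
        - g * RInt (fun s => Rpower (r * t + h - s) (- g - 1) * (Y (r * t + h) - Y s)) 0 h)).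
Proof.
  intros Hr Hh Ht HY HI. unfold marchaud in *.
  set (K := fun s => Rpower (r * t + h - s) (- g - 1) * (Y (r * t + h) - Y s)) in *.
  pose proof (filterlim_comp _ _ _ _ _ _ _ _ (filterlim_affine_at_left r h t Hr) HI) as HL.
  cbv beta in HL.
  pose proof (filterlim_lincomb (F := at_left t) _ (fun _ => 1) (Rpower r g)
    (Rpower t (- g) * (Y (r * t + h) - Y h)
     + Rpower r g * (- Rpower (r * t + h) (- g) * (Y (r * t + h) - Y 0) - g * RInt K 0 h)) _ 1 HL
    (filterlim_const _)) as HL'.
  replace (Rpower t (- g) * (Y (r * t + h) - Y h)
     + Rpower r g * (I - Rpower (r * t + h) (- g) * (Y (r * t + h) - Y 0) - g * RInt K 0 h))
    with (Rpower r g * I + (Rpower t (- g) * (Y (r * t + h) - Y h)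
     + Rpower r g * (- Rpower (r * t + h) (- g) * (Y (r * t + h) - Y 0) - g * RInt K 0 h)) * 1) by ring.
  eapply filterlim_ext_loc; [| exact HL'].
  generalize (at_left_between 0 t Ht). apply filter_imp. intros c Hc. cbv beta.
  assert (Hrc : 0 < r * c) by nra. assert (Hrt : r * c < r * t) by nra.
  assert (E1 : RInt K 0 (r * c + h) = RInt K 0 h + RInt K h (r * c + h)).
  { symmetry. apply (RInt_Chasles (V := R_CompleteNormedModule)); apply ex_RInt_kernel; auto; lra. }
  assert (E2 : RInt (fun s => Rpower (t - s) (- g - 1) * (Y (r * t + h) - Y (r * s + h))) 0 c
               = Rpower r g * RInt K h (r * c + h)).
  { replace (RInt K h (r * c + h)) with (RInt K (r * 0 + h) (r * c + h)) by (f_equal; ring).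
    rewrite <- (RInt_comp_lin (V := R_CompleteNormedModule) K r h 0 c)
      by (apply ex_RInt_kernel; auto; lra).
    rewrite <- (RInt_scal (V := R_CompleteNormedModule) _ _ _ (Rpower r g)).
    - apply RInt_ext. intros s Hs. rewrite Rmin_left, Rmax_right in Hs by lra.
      unfold scal; simpl; unfold mult; simpl. unfold K.
      replace (r * t + h - (r * s + h)) with (r * (t - s)) by ring.
      rewrite <- Rpower_mult_distr by lra.
      replace (Rpower r (- g - 1)) with (/ (Rpower r g * r)).
      + field. split; [lra|]. apply Rgt_not_eq, exp_pos.
      + rewrite <- (Rpower_1 r Hr) at 2. rewrite <- Rpower_plus, <- Rpower_Ropp. f_equal; ring.
    - apply (ex_RInt_comp_lin (V := R_NormedModule) K). apply ex_RInt_kernel; auto; lra. }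
  rewrite E1, E2. replace (r * 0 + h) with h by ring. ring.
Qed.

(** Continuity is asked on the whole line, which is met by freezing time outside [[0, T]]; the
    equation is asked only for [0 < t < T], so every bound at [T] itself is a limit from the
    left. *)
Definition relaxation (g k T : R) (Y : R -> R) : Prop :=
  (forall x, continuous Y x) /\ forall t, 0 < t < T -> marchaud g Y t (- (k * Y t)).

Lemma relaxation_scal (g k T a : R) (Y : R -> R) :
  relaxation g k T Y -> relaxation g k T (fun s => a * Y s).
Proof.
  intros [HY HM]. split.
  - intros x. apply (continuous_scal_r (V := R_NormedModule) a Y), HY.
  - intros t Ht.
    assert (E := marchaud_lincomb g Y Y a 0 t _ _ (proj1 Ht) HY HY (HM t Ht) (HM t Ht)).
    replace (- (k * (a * Y t))) with (a * - (k * Y t) + 0 * - (k * Y t)) by ring.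
    revert E. unfold marchaud. apply filterlim_ext. intros c.
    f_equal. ring. f_equal. apply RInt_ext. intros; ring_R.
Qed.

Lemma continuous_lincomb (Y Z : R -> R) (a b x : R) :
  continuous Y x -> continuous Z x -> continuous (fun s => a * Y s + b * Z s) x.
Proof.
  intros HY HZ. apply (continuous_plus (V := R_NormedModule) (fun s => a * Y s) (fun s => b * Z s)).
  - apply (continuous_scal_r (V := R_NormedModule) a Y), HY.
  - apply (continuous_scal_r (V := R_NormedModule) b Z), HZ.
Qed.

Lemma marchaud_const (g d t : R) : marchaud g (fun _ => d) t 0.
Proof.
  unfold marchaud. eapply filterlim_ext; [| apply filterlim_const].
  intros c. cbv beta. rewrite (RInt_ext _ (fun _ => 0)) by (intros; ring_R).
  rewrite RInt_const. unfold scal; simpl; unfold mult; simpl. ring.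
Qed.

Lemma relaxation_nonneg (g k T : R) (Y : R -> R) :
  0 < g -> 0 <= k -> relaxation g k T Y -> 0 <= Y 0 -> forall t, 0 <= t < T -> 0 <= Y t.
Proof.
  intros Hg Hk [HY HM] H0.
  apply (marchaud_nonneg g T Y (fun t => - (k * Y t)) k); auto.
  intros t Ht. assert (0 < Rpower t (- g)) by apply exp_pos. nra.
Qed.

(** Comparison with the constant [Y 0]: the fractional derivative of [Y 0 - Y] is [k Y], which is
    nonnegative. *)
Lemma relaxation_le_init (g k T : R) (Y : R -> R) :
  0 < g -> 0 <= k -> relaxation g k T Y -> 0 <= Y 0 -> forall t, 0 <= t < T -> Y t <= Y 0.
Proof.
  intros Hg Hk HR H0 t Ht. pose proof (relaxation_nonneg g k T Y Hg Hk HR H0) as Hp.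
  destruct HR as [HY HM].
  enough (0 <= -1 * Y t + 1 * Y 0) by lra. revert t Ht.
  apply (marchaud_nonneg g T (fun t => -1 * Y t + 1 * Y 0) (fun t => -1 * - (k * Y t) + 1 * 0) 0); auto.
  - lra.
  - intros x. apply (continuous_lincomb Y (fun _ => Y 0)); auto. apply continuous_const.
  - lra.
  - intros t Ht. apply (marchaud_lincomb g Y (fun _ => Y 0)); auto. lra.
    intros; apply continuous_const. apply marchaud_const.
  - intros t Ht. specialize (Hp t ltac:(lra)). assert (0 <= k * Y t) by nra. lra.
Qed.

(** [Y] is compared with its shift by [h]. The shifted function carries an extra history on
    [[0, h]], but [Y <= Y 0] there, so this history contributes at least [- (Y 0 - Y (r + h))
    (r^(-g) - (r + h)^(-g))], which the boundary terms compensate exactly. *)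
Lemma relaxation_decreasing (g k T : R) (Y : R -> R) :
  0 < g -> 0 <= k -> relaxation g k T Y -> 0 <= Y 0 ->
  forall s t, 0 <= s <= t -> t < T -> Y t <= Y s.
Proof.
  intros Hg Hk HR H0 s t Hst HtT.
  pose proof (relaxation_le_init g k T Y Hg Hk HR H0) as Hi.
  destruct HR as [HY HM].
  set (h := t - s). assert (Hh : 0 <= h) by (unfold h; lra).
  assert (HYs : forall x, continuous (fun s => Y (1 * s + h)) x).
  { intros x. apply (continuous_comp (fun s => 1 * s + h) Y); [| apply HY].
    apply (@ex_derive_continuous R_AbsRing R_NormedModule). auto_derive. exact I. }
  enough (forall r, 0 <= r < T - h -> 0 <= 1 * Y r + -1 * Y (1 * r + h)) as E.
  { specialize (E s ltac:(unfold h; lra)). replace (1 * s + h) with t in E by (unfold h; ring). lra. }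
  set (J := fun r => Rpower r (- g) * (Y (1 * r + h) - Y h)
     + Rpower 1 g * (- (k * Y (1 * r + h)) - Rpower (1 * r + h) (- g) * (Y (1 * r + h) - Y 0)
        - g * RInt (fun s => Rpower (1 * r + h - s) (- g - 1) * (Y (1 * r + h) - Y s)) 0 h)).
  apply (marchaud_nonneg g (T - h) _ (fun r => 1 * - (k * Y r) + -1 * J r) k); auto.
  - intros x. apply (continuous_lincomb Y (fun s => Y (1 * s + h))); auto.
  - specialize (Hi h ltac:(unfold h; lra)). replace (1 * 0 + h) with h by ring. lra.
  - intros r Hr. apply (marchaud_lincomb g Y (fun s => Y (1 * s + h))); auto. lra.
    apply HM; lra. apply marchaud_affine; auto; try lra. apply HM; lra.
  - intros r Hr. unfold J. rewrite !Rmult_1_l. replace (0 + h) with h by ring.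
    replace (Rpower 1 g) with 1 by (unfold Rpower; rewrite ln_1, Rmult_0_r, exp_0; reflexivity).
    set (K := RInt _ 0 h).
    enough (- (Y 0 - Y (r + h)) * (Rpower r (- g) - Rpower (r + h) (- g)) <= g * K) as E by lra.
    assert (EI := is_RInt_Rpower_sub (r + h) (- g) 0 h ltac:(lra) ltac:(lra)).
    replace (r + h - h) with r in EI by ring. rewrite Rminus_0_r in EI.
    apply (is_RInt_scal (V := R_NormedModule) _ _ _ (Y (r + h) - Y 0)) in EI.
    assert (EK : is_RInt (fun s => Rpower (r + h - s) (- g - 1) * (Y (r + h) - Y s)) 0 h K).
    { apply (RInt_correct (V := R_CompleteNormedModule)). apply ex_RInt_kernel; auto. lra. }
    assert (HK := is_RInt_le _ _ _ _ _ _ Hh EI EK).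
    assert (scal (Y (r + h) - Y 0) ((Rpower (r + h) (- g) - Rpower r (- g)) / - g) <= K) as HK'.
    { apply HK. intros x Hx. unfold scal; simpl; unfold mult; simpl.
      specialize (Hi x ltac:(lra)).
      assert (0 < Rpower (r + h - x) (- g - 1)) by apply exp_pos. nra. }
    unfold scal in HK'; simpl in HK'; unfold mult in HK'; simpl in HK'.
    apply (Rmult_le_compat_l g) in HK'; [| lra].
    eapply Rle_trans; [| exact HK']. right. field. lra.
Qed.

(** * Bounds for scalar relaxation equations *)

Lemma le_at_left (Y : R -> R) (T a : R) :
  0 < T -> (forall x, continuous Y x) -> (forall t, 0 < t < T -> a <= Y t) -> a <= Y T.
Proof.
  intros HT HY H.
  eapply (filterlim_le_R (F := at_left T) (fun _ => a) Y a (Y T)).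
  - generalize (at_left_between 0 T HT). apply filter_imp. exact H.
  - apply filterlim_const.
  - eapply filterlim_filter_le_1; [| apply HY]. apply filter_le_within.
Qed.

Lemma filterlim_Rpower_sub_0 (t q : R) :
  0 < q -> filterlim (fun c => Rpower (t - c) q) (at_left t) (locally 0).
Proof.
  intros Hq P [e He].
  set (d := Rpower e (/ q)). assert (Hd : 0 < d) by apply exp_pos.
  unfold filtermap. generalize (at_left_between (t - d) t ltac:(lra)). apply filter_imp.
  intros c Hc. apply He. apply R_ball.
  rewrite Rminus_0_r, Rabs_pos_eq by (left; apply exp_pos).
  replace (pos e) with (Rpower d q).
  - apply Rlt_Rpower_l; lra.
  - unfold d. rewrite Rpower_mult, Rinv_l, Rpower_1; try lra. apply cond_pos.
Qed.

Lemma marchaud_id (g t : R) :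
  0 < g < 1 -> 0 < t -> marchaud g (fun s => s) t (Rpower t (1 - g) / (1 - g)).
Proof.
  intros Hg Ht. unfold marchaud.
  pose proof (filterlim_lincomb (F := at_left t) _ (fun _ => 1) (- g / (1 - g)) (Rpower t (1 - g) / (1 - g)) _ 1
    (filterlim_Rpower_sub_0 t (1 - g) ltac:(lra)) (filterlim_const _)) as HL.
  rewrite Rmult_0_r, Rplus_0_l, Rmult_1_r in HL.
  eapply filterlim_ext_loc; [| exact HL].
  generalize (at_left_between 0 t Ht). apply filter_imp. intros c Hc. cbv beta.
  replace (RInt (fun s => Rpower (t - s) (- g - 1) * (t - s)) 0 c)
    with ((Rpower (t - 0) (1 - g) - Rpower (t - c) (1 - g)) / (1 - g)).
  - rewrite !Rminus_0_r.
    replace (Rpower t (- g) * t) with (Rpower t (1 - g)).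
    + field. lra.
    + rewrite <- (Rpower_1 t Ht) at 3. rewrite <- Rpower_plus. f_equal; ring.
  - symmetry. apply (is_RInt_unique (V := R_CompleteNormedModule)).
    eapply is_RInt_ext; [| apply is_RInt_Rpower_sub; lra].
    intros s Hs. rewrite Rmin_left, Rmax_right in Hs by lra.
    simpl. rewrite <- (Rpower_1 (t - s)) at 3 by lra. rewrite <- Rpower_plus. f_equal; ring.
Qed.

Lemma relaxation_horizon (g k T T' : R) (Y : R -> R) :
  T' <= T -> relaxation g k T Y -> relaxation g k T' Y.
Proof. intros HT [HY HM]. split; auto. intros t Ht. apply HM; lra. Qed.

Lemma relaxation_ge_end (g k T : R) (Y : R -> R) :
  0 < g -> 0 <= k -> relaxation g k T Y -> 0 <= Y 0 ->
  forall t, 0 < t < T -> Y T <= Y t.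
Proof.
  intros Hg Hk HR H0 t Ht.
  enough (- Y t <= -1 * Y T + 0 * Y T) by lra.
  assert (HH : forall r, t <= r < T -> Y r <= Y t).
  { intros r Hr. apply (relaxation_decreasing g k T); auto; lra. }
  apply (filterlim_le_R (F := at_left T) (fun _ => - Y t) (fun r => -1 * Y r + 0 * Y r)).
  - generalize (at_left_between t T (proj2 Ht)). apply filter_imp. intros r Hr.
    specialize (HH r ltac:(lra)). lra.
  - apply filterlim_const.
  - eapply filterlim_filter_le_1; [apply (filter_le_within) |].
    apply (continuous_lincomb Y Y (-1) 0); apply HR.
Qed.

(** As [Y] decreases, [- Y] has its maximum over [[0, t]] at [t]; the boundary term alone then gives
    [t^(-g) (Y 0 - Y t) <= k Y t], and [t] tends to [T]. *)
Lemma relaxation_lower (g k T : R) (Y : R -> R) :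
  0 < g -> 0 <= k -> 0 < T -> relaxation g k T Y -> 0 <= Y 0 ->
  Y 0 <= (1 + k * Rpower T g) * Y T.
Proof.
  intros Hg Hk HT HR H0.
  apply (le_at_left (fun t => (1 + k * Rpower T g) * Y t) T); auto.
  { intros x. apply (continuous_scal_r (V := R_NormedModule) (1 + k * Rpower T g) Y), HR. }
  intros t Ht.
  pose proof (relaxation_scal g k T (-1) Y HR) as HN.
  assert (E := marchaud_at_max g _ t _ Hg (proj1 Ht) (proj1 HN)
    ltac:(intros s Hs; pose proof (relaxation_decreasing g k T Y Hg Hk HR H0 s t Hs (proj2 Ht)); lra)
    (proj2 HN t Ht)).
  cbv beta in E. pose proof (relaxation_nonneg g k T Y Hg Hk HR H0 t ltac:(lra)) as Hp.
  rewrite Rpower_Ropp in E.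
  assert (P : 0 < Rpower t g) by apply exp_pos.
  apply (Rmult_le_compat_l (Rpower t g)) in E; [| lra].
  rewrite <- Rmult_assoc, Rinv_r, Rmult_1_l in E by lra.
  assert (Rpower t g <= Rpower T g) by (apply Rle_Rpower_l; lra).
  assert (Rpower t g * (k * Y t) <= Rpower T g * (k * Y t)) by (apply Rmult_le_compat_r; nra).
  lra.
Qed.

(** The linear barrier [Y 0 - c t] stays above [Y]: its derivative [- c t^(1-g) / (1 - g)] is at
    least [- k Y T], while that of [Y] is [- k Y t <= - k Y T]. *)
Lemma relaxation_upper (g k T : R) (Y : R -> R) :
  0 < g < 1 -> 0 <= k -> 0 < T -> relaxation g k T Y -> 0 <= Y 0 ->
  (1 + k * (1 - g) * Rpower T g) * Y T <= Y 0.
Proof.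
  intros Hg Hk HT HR H0.
  pose proof (relaxation_ge_end g k T Y (proj1 Hg) Hk HR H0) as He.
  assert (Hp : 0 <= Y T).
  { apply le_at_left; auto. apply HR. intros. apply (relaxation_nonneg g k T); auto; lra. }
  destruct HR as [HY HM].
  (* The largest slope with [c t^(1-g) / (1 - g) <= k Y T] on all of [(0, T]]; equality holds at
     [T]. *)
  set (c := k * (1 - g) * Rpower T (g - 1) * Y T).
  assert (HW : forall x, continuous (fun t => - c * t + Y 0 * 1) x).
  { intros x. apply (continuous_lincomb (fun t => t) (fun _ => 1)).
    apply continuous_id. apply continuous_const. }
  enough (0 <= 1 * (- c * T + Y 0 * 1) + -1 * Y T) as E.
  { assert (c * T = k * (1 - g) * Rpower T g * Y T).
    { unfold c. replace (Rpower T g) with (Rpower T (g - 1) * T). ring.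
      rewrite <- (Rpower_1 T HT) at 2. rewrite <- Rpower_plus. f_equal; ring. }
    lra. }
  apply (le_at_left (fun t => 1 * (- c * t + Y 0 * 1) + -1 * Y t)); auto.
  { intros x. apply (continuous_lincomb (fun t => - c * t + Y 0 * 1) Y); auto. }
  intros t Ht.
  apply (marchaud_nonneg g T (fun t => 1 * (- c * t + Y 0 * 1) + -1 * Y t)
    (fun t => 1 * (- c * (Rpower t (1 - g) / (1 - g)) + Y 0 * 0) + -1 * - (k * Y t)) 0);
    try lra.
  - intros x. apply (continuous_lincomb (fun t => - c * t + Y 0 * 1) Y); auto.
  - intros r Hr. apply (marchaud_lincomb g (fun t => - c * t + Y 0 * 1) Y); auto; try lra.
    apply (marchaud_lincomb g (fun t => t) (fun _ => 1)); try lra.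
    intros; apply continuous_id. intros; apply continuous_const.
    apply marchaud_id; lra. apply marchaud_const.
  - intros r Hr. replace (Y 0 - 0) with (Y 0) by ring.
    assert (c * (Rpower r (1 - g) / (1 - g)) <= k * Y r).
    { apply Rle_trans with (k * Y T).
      - replace (c * (Rpower r (1 - g) / (1 - g)))
          with ((k * Y T) * (Rpower T (g - 1) * Rpower r (1 - g))) by (unfold c; field; lra).
        rewrite <- (Rmult_1_r (k * Y T)) at 2. apply Rmult_le_compat_l. nra.
        replace 1 with (Rpower T (g - 1) * Rpower T (1 - g)) at 3.
        + apply Rmult_le_compat_l. left; apply exp_pos. apply Rle_Rpower_l; lra.
        + rewrite <- Rpower_plus. replace (g - 1 + (1 - g)) with 0 by ring. apply Rpower_O; lra.
      - apply Rmult_le_compat_l; auto. }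
    assert (0 < Rpower r (- g)) by apply exp_pos.
    assert (0 <= Rpower r (- g) * (1 * (- c * 0 + Y 0 * 1) + -1 * Y 0)).
    { apply Rmult_le_pos; lra. }
    lra.
Qed.

Lemma relaxation_lower_abs (g k T : R) (Y : R -> R) :
  0 < g -> 0 <= k -> 0 < T -> relaxation g k T Y ->
  Rabs (Y 0) <= (1 + k * Rpower T g) * Rabs (Y T).
Proof.
  intros Hg Hk HT HR.
  assert (HP : 0 <= 1 + k * Rpower T g).
  { assert (0 < Rpower T g) by apply exp_pos. nra. }
  pose proof (Rle_abs (Y T)) as L1. pose proof (Rle_abs (- Y T)) as L2. rewrite Rabs_Ropp in L2.
  destruct (Rle_lt_dec 0 (Y 0)) as [H|H].
  - rewrite (Rabs_pos_eq (Y 0)) by lra. pose proof (relaxation_lower g k T Y Hg Hk HT HR H). nra.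
  - rewrite (Rabs_left (Y 0)) by lra.
    pose proof (relaxation_lower g k T _ Hg Hk HT (relaxation_scal g k T (-1) Y HR) ltac:(lra)). cbv beta in *. nra.
Qed.

Lemma relaxation_upper_abs (g k T : R) (Y : R -> R) :
  0 < g < 1 -> 0 <= k -> 0 < T -> relaxation g k T Y ->
  (1 + k * (1 - g) * Rpower T g) * Rabs (Y T) <= Rabs (Y 0).
Proof.
  intros Hg Hk HT HR.
  assert (P : 0 < Rpower T g) by apply exp_pos.
  assert (HP : 0 <= k * (1 - g) * Rpower T g).
  { apply Rmult_le_pos; [apply Rmult_le_pos|]; lra. }
  assert (HP' : 0 <= k * Rpower T g) by nra.
  assert (G : forall Z, relaxation g k T Z -> 0 <= Z 0 -> 0 <= Z T).
  { intros Z HZ H. pose proof (relaxation_lower g k T Z (proj1 Hg) Hk HT HZ H). nra. }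
  destruct (Rle_lt_dec 0 (Y 0)) as [H|H].
  - rewrite (Rabs_pos_eq (Y 0)), (Rabs_pos_eq (Y T)) by auto. apply relaxation_upper; auto.
  - pose proof (relaxation_scal g k T (-1) Y HR) as HN.
    pose proof (G _ HN ltac:(lra)) as GT.
    pose proof (relaxation_upper g k T _ Hg Hk HT HN ltac:(lra)) as E. cbv beta in *.
    rewrite (Rabs_left (Y 0)), (Rabs_left1 (Y T)) by lra. nra.
Qed.

(** The slower rate [m] decays less, whence the lower bound. For the upper one, [Z - Y] is dominated
    by a small multiple of [Y (r t)], which solves the equation with rate [k / 4]. At time [T] this
    majorant has itself decayed to order [1/k], which accounts for [(k - m) / k ^ 2] instead of
    [(k - m) / k]. *)
Lemma relaxation_diff (g k m T : R) (Y Z : R -> R) :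
  0 < g < 1 -> 0 < k -> k / 2 <= m <= k -> 0 < T ->
  relaxation g k T Y -> relaxation g m T Z -> Y 0 = 1 -> Z 0 = 1 ->
  0 <= Z T - Y T <= 16 / ((1 - g) * Rpower T g) * ((k - m) / k ^ 2).
Proof.
  intros Hg Hk Hm HT HRY HRZ HY0 HZ0.
  pose proof HRY as [HY HMY]. pose proof HRZ as [HZ HMZ].
  pose proof (relaxation_nonneg g k T Y ltac:(lra) ltac:(lra) HRY ltac:(lra)) as HYp.
  (* [r^g = 1/4] turns the rate [k] into [k / 4], which leaves the reserve [m - k / 4 >= k / 4]
     because [m >= k / 2]. *)
  set (r := Rpower (/ 4) (/ g)).
  assert (Hr : 0 < r) by apply exp_pos.
  assert (Hrg : Rpower r g = / 4).
  { unfold r. rewrite Rpower_mult, Rinv_l by lra. apply Rpower_1. lra. }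
  assert (Hr1 : r < 1).
  { destruct (Rlt_le_dec r 1) as [|Hge]; auto. exfalso.
    pose proof (Rle_Rpower_l 1 r g ltac:(lra) ltac:(lra)) as E.
    rewrite Hrg in E. unfold Rpower in E. rewrite ln_1, Rmult_0_r, exp_0 in E. lra. }
  assert (HX : forall x, continuous (fun s => Y (r * s + 0)) x).
  { intros x. apply (continuous_comp (fun s => r * s + 0) Y); [| apply HY].
    apply (@ex_derive_continuous R_AbsRing R_NormedModule). auto_derive. exact I. }
  assert (HMX : forall t, 0 < t < T -> marchaud g (fun s => Y (r * s + 0)) t (- (k / 4 * Y (r * t + 0)))).
  { intros t Ht.
    assert (r * t + 0 < T) by nra. assert (0 < r * t + 0) by nra.
    assert (E := marchaud_affine g r 0 t (- (k * Y (r * t + 0))) Y Hr (Rle_refl 0) (proj1 Ht) HY (HMY (r * t + 0) ltac:(lra))).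
    rewrite RInt_point in E. unfold zero in E; simpl in E. rewrite Hrg in E.
    replace (Rpower (r * t + 0) (- g)) with (4 * Rpower t (- g)) in E.
    - replace (- (k / 4 * Y (r * t + 0))) with
        (Rpower t (- g) * (Y (r * t + 0) - Y 0) + / 4 * (- (k * Y (r * t + 0)) - 4 * Rpower t (- g) * (Y (r * t + 0) - Y 0) - g * 0)) by field.
      exact E.
    - rewrite Rplus_0_r, <- Rpower_mult_distr by lra. f_equal.
      rewrite (Rpower_Ropp r), Hrg. field. }
  split.
  - enough (0 <= 1 * Z T + -1 * Y T) by lra.
    apply (le_at_left (fun t => 1 * Z t + -1 * Y t)); auto.
    { intros x. apply (continuous_lincomb Z Y); auto. }
    intros t Ht.
    apply (marchaud_nonneg g T (fun t => 1 * Z t + -1 * Y t) (fun t => 1 * - (m * Z t) + -1 * - (k * Y t)) m); try lra.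
    + intros x. apply (continuous_lincomb Z Y); auto.
    + intros s Hs. apply (marchaud_lincomb g Z Y); auto. lra.
    + intros s Hs. rewrite HY0, HZ0. pose proof (HYp s ltac:(lra)).
      assert (0 <= (k - m) * Y s) by (apply Rmult_le_pos; lra). lra.
  (* With this [a] the reserve [a k / 4] equals [k - m], the coefficient of the source term
     [(k - m) Y s], and [Y s <= Y (r s)] by monotonicity. *)
  - set (a := 4 * (k - m) / k).
    assert (Ha : 0 <= a) by (apply Rmult_le_pos; [lra | left; apply Rinv_0_lt_compat; lra]).
    assert (HXT : Z T - Y T <= a * Y (r * T)).
    { replace (r * T) with (r * T + 0) by ring.
      enough (0 <= 1 * (a * Y (r * T + 0) + -1 * Z T) + 1 * Y T) by lra.
      assert (HC : forall x, continuous (fun t => 1 * (a * Y (r * t + 0) + -1 * Z t) + 1 * Y t) x).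
      { intros x. apply (continuous_lincomb (fun t => a * Y (r * t + 0) + -1 * Z t) Y); auto.
        apply (continuous_lincomb (fun t => Y (r * t + 0)) Z); auto. }
      apply (le_at_left (fun t => 1 * (a * Y (r * t + 0) + -1 * Z t) + 1 * Y t)); auto.
      intros t Ht.
      apply (marchaud_nonneg g T (fun t => 1 * (a * Y (r * t + 0) + -1 * Z t) + 1 * Y t)
        (fun t => 1 * (a * - (k / 4 * Y (r * t + 0)) + -1 * - (m * Z t)) + 1 * - (k * Y t)) m); auto; try lra.
      + replace (r * 0 + 0) with 0 by ring. rewrite HY0, HZ0. lra.
      + intros s Hs.
        apply (marchaud_lincomb g (fun t => a * Y (r * t + 0) + -1 * Z t) Y); auto. lra.
        * intros x. apply (continuous_lincomb (fun t => Y (r * t + 0)) Z); auto.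
        * apply (marchaud_lincomb g (fun t => Y (r * t + 0)) Z); auto. lra.
      + intros s Hs. replace (r * 0 + 0) with 0 by ring. rewrite HY0, HZ0.
        assert (0 < Rpower s (- g)) by apply exp_pos.
        assert (0 <= Rpower s (- g) * a) by (apply Rmult_le_pos; lra).
        assert (r * s < s) by nra.
        pose proof (relaxation_decreasing g k T Y ltac:(lra) ltac:(lra) HRY ltac:(lra) (r * s + 0) s ltac:(nra) ltac:(lra)) as HD.
        pose proof (HYp s ltac:(lra)).
        assert (Hak : a * k = 4 * (k - m)) by (unfold a; field; lra).
        set (X := Y (r * s + 0)) in *.
        assert (0 <= a * X * (m - k / 2)) by (apply Rmult_le_pos; [apply Rmult_le_pos|]; lra).
        assert (HD2 : Y s <= X) by exact HD.
        assert (0 <= (k - m) * (X - Y s)) by (apply Rmult_le_pos; lra).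
        assert (a * X * k = 4 * (k - m) * X) by (rewrite <- Hak; ring).
        lra. }
    assert (HU := relaxation_upper g k (r * T) Y Hg ltac:(lra) ltac:(nra)
      (relaxation_horizon g k T (r * T) Y ltac:(nra) HRY) ltac:(lra)).
    rewrite HY0, <- Rpower_mult_distr, Hrg in HU by lra.
    assert (P : 0 < Rpower T g) by apply exp_pos.
    set (W := Rpower T g) in *.
    assert (0 <= Y (r * T)) by (apply HYp; nra).
    assert (HU' : k * (1 - g) * W / 4 * Y (r * T) <= 1) by lra.
    assert (HU2 : Y (r * T) <= 4 / (k * (1 - g) * W)).
    { apply (Rmult_le_reg_l (k * (1 - g) * W / 4)).
      - repeat apply Rmult_lt_0_compat; lra.
      - eapply Rle_trans; [exact HU'|]. right. field. lra. }
    (* The [16] is one factor [4] from [a] times one from [(r T)^g = T^g / 4]. *)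
    apply Rle_trans with (a * (4 / (k * (1 - g) * W))).
    + eapply Rle_trans; [exact HXT|]. apply Rmult_le_compat_l; auto.
    + right. unfold a. field. lra.
Qed.

(** With [y = Y T / Y 0] and [z = Z T / Z 0] one has [Y T - Z T = (Y 0 - Z 0) z - Y 0 (z - y)],
    where [(1 + k T^g) z >= 1] and [z - y] is small by [relaxation_diff]. *)
Lemma relaxation_backward_diff (g k m T : R) (Y Z : R -> R) :
  0 < g < 1 -> 0 < k -> k / 2 <= m <= k -> 0 < T ->
  relaxation g k T Y -> relaxation g m T Z ->
  Rabs (Y 0 - Z 0) <=
    (1 + k * Rpower T g)
    * (Rabs (Y T - Z T) + 16 / ((1 - g) * Rpower T g) * ((k - m) / k ^ 2) * Rabs (Y 0)).
Proof.
  intros Hg Hk Hm HT HY HZ.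
  assert (HW : 0 < Rpower T g) by apply exp_pos.
  pose proof (relaxation_lower_abs g k T Y ltac:(lra) ltac:(lra) HT HY) as LY.
  pose proof (relaxation_lower_abs g m T Z ltac:(lra) ltac:(lra) HT HZ) as LZ.
  pose proof (relaxation_upper_abs g k T Y Hg ltac:(lra) HT HY) as UY.
  pose proof (relaxation_upper_abs g m T Z Hg ltac:(lra) HT HZ) as UZ.
  set (W := Rpower T g) in *.
  set (c := 16 / ((1 - g) * W) * ((k - m) / k ^ 2)).
  assert (Hc : 0 <= c).
  { unfold c. apply Rmult_le_pos; apply Rmult_le_pos; try lra; left; apply Rinv_0_lt_compat.
    apply Rmult_lt_0_compat; lra. apply pow_lt; lra. }
  assert (HP : forall l, 0 <= l -> 0 <= l * (1 - g) * W) by (intros; apply Rmult_le_pos; [apply Rmult_le_pos|]; lra).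
  pose proof (HP k ltac:(lra)). pose proof (HP m ltac:(lra)).
  assert (m * W <= k * W) by (apply Rmult_le_compat_r; lra).
  assert (0 <= m * W) by (apply Rmult_le_pos; lra).
  pose proof (Rabs_pos (Y T)). pose proof (Rabs_pos (Z T)). pose proof (Rabs_pos (Y 0)).
  assert (0 <= c * Rabs (Y 0)) by (apply Rmult_le_pos; lra).
  assert (HD := Rabs_pos (Y T - Z T)).
  (* The quotients need nonzero initial values. A zero initial value forces a zero terminal value,
     and the claim reduces to [relaxation_lower_abs] for the other function. *)
  destruct (Req_dec (Y 0) 0) as [HY0|HY0].
  { rewrite HY0, Rabs_R0 in *. assert (HYT : Rabs (Y T) = 0) by nra.
    apply Rabs_eq_0 in HYT. rewrite HYT in *.
    rewrite !Rminus_0_l, !Rabs_Ropp, Rmult_0_r, Rplus_0_r in *.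
    eapply Rle_trans; [exact LZ|]. apply Rmult_le_compat_r; lra. }
  destruct (Req_dec (Z 0) 0) as [HZ0|HZ0].
  { rewrite HZ0, Rabs_R0 in *. assert (HZT : Rabs (Z T) = 0) by nra.
    apply Rabs_eq_0 in HZT. rewrite HZT in *. rewrite !Rminus_0_r in *.
    eapply Rle_trans; [exact LY|]. apply Rmult_le_compat_l; lra. }
  pose proof (relaxation_scal g k T (/ Y 0) Y HY) as HY'.
  pose proof (relaxation_scal g m T (/ Z 0) Z HZ) as HZ'.
  assert (HZn : / Z 0 * Z 0 = 1) by (apply Rinv_l; auto).
  assert (HYn : / Y 0 * Y 0 = 1) by (apply Rinv_l; auto).
  pose proof (relaxation_diff g k m T _ _ Hg Hk Hm HT HY' HZ' HYn HZn) as HE. cbv beta in HE.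
  fold W in HE. fold c in HE.
  pose proof (relaxation_lower g m T _ ltac:(lra) ltac:(lra) HT HZ' ltac:(lra)) as HL. cbv beta in HL.
  rewrite HZn in HL. fold W in HL.
  set (z := / Z 0 * Z T) in *. set (y := / Y 0 * Y T) in *.
  replace (Y T - Z T) with ((Y 0 - Z 0) * z - Y 0 * (z - y)) by (unfold z, y; field; auto).
  assert (E1 : Rabs (Y 0 - Z 0) * z <= Rabs ((Y 0 - Z 0) * z - Y 0 * (z - y)) + c * Rabs (Y 0)).
  { assert (Hz : 0 <= z) by nra.
    rewrite <- (Rabs_pos_eq z Hz) at 1. rewrite <- Rabs_mult.
    replace ((Y 0 - Z 0) * z) with (((Y 0 - Z 0) * z - Y 0 * (z - y)) + Y 0 * (z - y)) at 1 by ring.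
    eapply Rle_trans; [apply Rabs_triang|]. apply Rplus_le_compat_l.
    rewrite Rabs_mult, (Rabs_pos_eq (z - y)) by lra.
    rewrite Rmult_comm. apply Rmult_le_compat_r; lra. }
  apply (Rmult_le_compat_l (1 + k * W)) in E1; [| lra].
  eapply Rle_trans; [| exact E1].
  assert (1 <= (1 + k * W) * z) by nra.
  pose proof (Rabs_pos (Y 0 - Z 0)). nra.
Qed.

(** [x] stands for [alpha lam^b], so [x / (1 + x)] is the damping factor and [l / (1 + x)] the
    regularised eigenvalue; [C] has to be uniform in both. For [x <= 1] the two rates differ by a
    factor of at most [2] and the Lipschitz bound applies. For [x > 1] the damping factor is at
    least [1/2], so [Y 0] and [Z 0] are estimated separately and all of [|Y 0|] is charged to the
    damping term. *)
Lemma relaxation_backward_stability (g T G l0 : R) :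
  0 < g < 1 -> 0 < T -> 0 < G -> 0 < l0 ->
  exists C, 0 < C /\ forall l x Y Z,
    l0 <= l -> 0 < x -> relaxation g (l * G) T Y -> relaxation g (l / (1 + x) * G) T Z ->
    Rabs (Y 0 - Z 0) <= C * (x / (1 + x) * Rabs (Y 0) + (1 + l / (1 + x)) * Rabs (Y T - Z T)).
Proof.
  intros Hg HT HG Hl0.
  assert (HW : 0 < Rpower T g) by apply exp_pos.
  set (W := Rpower T g) in *.
  set (C1 := 1 + 2 * (G * W)). set (C2 := (1 / (l0 * G) + W) * (16 / ((1 - g) * W))).
  set (C3 := 2 * (1 + 1 / (1 - g))).
  assert (HGW : 0 < G * W) by (apply Rmult_lt_0_compat; lra).
  assert (HlG : 0 < l0 * G) by (apply Rmult_lt_0_compat; lra).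
  assert (Hg1 : 0 < 1 / (1 - g)) by (apply Rdiv_lt_0_compat; lra).
  assert (HC2 : 0 < C2).
  { unfold C2. apply Rmult_lt_0_compat.
    assert (0 < 1 / (l0 * G)) by (apply Rdiv_lt_0_compat; lra). lra.
    apply Rdiv_lt_0_compat. lra. apply Rmult_lt_0_compat; lra. }
  assert (HC1 : 0 < C1) by (unfold C1; lra). assert (HC3 : 0 < C3) by (unfold C3; lra).
  exists (C1 + C2 + C3). split; [lra|].
  intros l x Y Z Hl Hx HY HZ.
  set (mu := l / (1 + x)) in *.
  assert (Hmu : 0 < mu) by (apply Rdiv_lt_0_compat; lra).
  assert (Hmux : mu * (1 + x) = l) by (unfold mu; field; lra).
  assert (Hx1 : 0 < x / (1 + x)) by (apply Rdiv_lt_0_compat; lra).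
  assert (Hml : mu <= l) by nra.
  set (D := Rabs (Y T - Z T)). assert (HD : 0 <= D) by apply Rabs_pos.
  set (a := Rabs (Y 0)). assert (Ha : 0 <= a) by apply Rabs_pos.
  assert (Hxa : 0 <= x / (1 + x) * a) by (apply Rmult_le_pos; lra).
  assert (HmD : 0 <= (1 + mu) * D) by (apply Rmult_le_pos; lra).
  assert (0 < mu * G) by (apply Rmult_lt_0_compat; lra).
  assert (0 < l * G) by (apply Rmult_lt_0_compat; lra).
  assert (Hsplit : C1 * ((1 + mu) * D) + C2 * (x / (1 + x) * a) <= (C1 + C2 + C3) * (x / (1 + x) * a + (1 + mu) * D)
    /\ C1 * ((1 + mu) * D) + C3 * (x / (1 + x) * a) <= (C1 + C2 + C3) * (x / (1 + x) * a + (1 + mu) * D)).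
  { assert (0 <= C1 * ((1 + mu) * D)) by (apply Rmult_le_pos; lra).
    assert (0 <= C2 * ((1 + mu) * D)) by (apply Rmult_le_pos; lra).
    assert (0 <= C3 * ((1 + mu) * D)) by (apply Rmult_le_pos; lra).
    assert (0 <= C1 * (x / (1 + x) * a)) by (apply Rmult_le_pos; lra).
    assert (0 <= C2 * (x / (1 + x) * a)) by (apply Rmult_le_pos; lra).
    assert (0 <= C3 * (x / (1 + x) * a)) by (apply Rmult_le_pos; lra).
    split; lra. }
  destruct (Rle_lt_dec x 1) as [Hle|Hgt].
  - eapply Rle_trans; [| exact (proj1 Hsplit)].
    eapply Rle_trans.
    { apply (relaxation_backward_diff g (l * G) (mu * G) T Y Z); auto; try lra.
      assert (l / 2 <= mu) by nra. split; nra. }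
    fold W a D. rewrite Rmult_plus_distr_l. apply Rplus_le_compat.
    + rewrite <- Rmult_assoc. apply Rmult_le_compat_r; auto. unfold C1.
      assert (l <= 2 * mu) by nra.
      assert (l * (G * W) <= 2 * mu * (G * W)) by (apply Rmult_le_compat_r; lra).
      nra.
    (* Here [(k - m) / k^2 = (x / (1 + x)) / (l G)]: the Lipschitz bound yields the damping factor,
       and its [1 / l] cancels the growth of [1 + l G W]. *)
    + replace ((1 + l * G * W) * (16 / ((1 - g) * W) * ((l * G - mu * G) / (l * G) ^ 2) * a))
        with ((1 / (l * G) + W) * (16 / ((1 - g) * W)) * (x / (1 + x) * a)).
      2: { rewrite <- Hmux. field. repeat split; nra. }
      apply Rmult_le_compat_r; auto. unfold C2. apply Rmult_le_compat_r.
      left; apply Rdiv_lt_0_compat. lra. apply Rmult_lt_0_compat; lra.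
      apply Rplus_le_compat_r. unfold Rdiv. rewrite !Rmult_1_l. apply Rinv_le_contravar. lra. nra.
  - eapply Rle_trans; [| exact (proj2 Hsplit)].
    pose proof (relaxation_lower_abs g (mu * G) T Z ltac:(lra) ltac:(lra) HT HZ) as LZ.
    pose proof (relaxation_upper_abs g (l * G) T Y Hg ltac:(lra) HT HY) as UY.
    fold W in LZ, UY. fold a in UY.
    assert (T1 : Rabs (Y 0 - Z 0) <= a + Rabs (Z 0)).
    { unfold a. rewrite <- (Rabs_Ropp (Z 0)). apply Rabs_triang. }
    assert (T2 : Rabs (Z T) <= D + Rabs (Y T)).
    { pose proof (Rabs_triang (- (Y T - Z T)) (Y T)) as E. rewrite Rabs_Ropp in E. fold D in E.
      replace (- (Y T - Z T) + Y T) with (Z T) in E by ring. exact E. }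
    pose proof (Rabs_pos (Y T)) as HYT.
    assert (HmW : 0 <= mu * G * W) by (apply Rmult_le_pos; lra).
    assert (HlW : mu * G * W <= l * G * W) by (apply Rmult_le_compat_r; [lra|]; apply Rmult_le_compat_r; lra).
    assert (T3 : (1 + mu * G * W) * Rabs (Y T) <= 1 / (1 - g) * a).
    { apply Rmult_le_reg_l with (1 - g); [lra|].
      replace ((1 - g) * (1 / (1 - g) * a)) with a by (field; lra).
      eapply Rle_trans; [| exact UY]. rewrite <- Rmult_assoc. apply Rmult_le_compat_r; auto. nra. }
    assert (T4 : (1 + mu * G * W) * D <= C1 * ((1 + mu) * D)).
    { rewrite <- Rmult_assoc. apply Rmult_le_compat_r; auto. unfold C1. nra. }
    assert (T5 : (1 + mu * G * W) * Rabs (Z T) <= (1 + mu * G * W) * (D + Rabs (Y T))) by (apply Rmult_le_compat_l; lra).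
    assert (T6 : 1 / 2 <= x / (1 + x)).
    { apply Rmult_le_reg_l with (2 * (1 + x)); [lra|]. replace (2 * (1 + x) * (x / (1 + x))) with (2 * x) by (field; lra). lra. }
    assert (T7 : (1 + 1 / (1 - g)) * a <= C3 * (x / (1 + x) * a)).
    { unfold C3. assert (a <= 2 * (x / (1 + x) * a)) by nra. nra. }
    lra.
Qed.

(** * From the Caputo to the Marchaud form *)

(** For a nonnegative integrand the integrals over compact subintervals grow with the interval, so
    their supremum is the improper integral, at both ends at once. *)
Lemma is_RInt_gen_of_bounded (f : R -> R) (M : R) :
  (forall x, 0 < x -> continuous f x) -> (forall x, 0 < x -> 0 <= f x) ->
  (forall a b, 0 < a <= b -> RInt f a b <= M) ->
  exists l, is_RInt_gen f (at_right 0) (Rbar_locally p_infty) l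
    /\ forall a b, 0 < a <= b -> RInt f a b <= l.
Proof.
  intros Hc Hp HM.
  set (E := fun y => exists a b, 0 < a <= b /\ y = RInt f a b).
  destruct (completeness E) as [l [Hub Hlub]].
  { exists M. intros y (a & b & Hab & ->). auto. }
  { exists (RInt f 1 1), 1, 1. split; [lra | reflexivity]. }
  assert (Hex : forall a b, 0 < a <= b -> ex_RInt f a b).
  { intros a b Hab. apply (ex_RInt_continuous (V := R_CompleteNormedModule)).
    intros z Hz. rewrite Rmin_left, Rmax_right in Hz by lra. apply Hc; lra. }
  assert (Hle : forall a b, 0 < a <= b -> RInt f a b <= l).
  { intros a b Hab. apply Hub. exists a, b. auto. }
  exists l. split; [| exact Hle].
  intros P [e He].
  assert (HE : exists a b, 0 < a <= b /\ l - e < RInt f a b).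
  { apply NNPP. intros HN. pose proof (cond_pos e).
    assert (l <= l - e); [| lra]. apply Hlub. intros y (a & b & Hab & ->).
    apply Rnot_lt_le. intros HL. apply HN. exists a, b. auto. }
  destruct HE as (a0 & b0 & Hab0 & HE).
  apply (Filter_prod _ _ _ (fun a => 0 < a < a0) (fun b => b0 < b)).
  - apply at_right_between; lra.
  - exists b0. auto.
  - intros a b Ha Hb. simpl. exists (RInt f a b).
    split; [apply (RInt_correct (V := R_CompleteNormedModule)), Hex; lra|].
    apply He. apply R_ball.
    assert (E1 : RInt f a b = RInt f a a0 + (RInt f a0 b0 + RInt f b0 b)).
    { pose proof (RInt_Chasles (V := R_CompleteNormedModule) f a0 b0 b ltac:(apply Hex; lra) ltac:(apply Hex; lra)) as E1.
      pose proof (RInt_Chasles (V := R_CompleteNormedModule) f a a0 b ltac:(apply Hex; lra) ltac:(apply Hex; lra)) as E2.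
      unfold plus in E1, E2; simpl in E1, E2. rewrite E1. symmetry. exact E2. }
    assert (0 <= RInt f a a0) by (apply RInt_ge_0; [lra | apply Hex; lra | intros; apply Hp; lra]).
    assert (0 <= RInt f b0 b) by (apply RInt_ge_0; [lra | apply Hex; lra | intros; apply Hp; lra]).
    specialize (Hle a b ltac:(lra)). pose proof (cond_pos e).
    apply Rabs_def1; lra.
Qed.

Lemma exp_neg_le (t : R) : 0 <= t -> exp (- t) <= 4 / (1 + t) ^ 2.
Proof.
  intros Ht.
  assert (H : 1 + t / 2 <= exp (t / 2)) by apply exp_ineq1_le.
  assert (E : exp t = exp (t / 2) * exp (t / 2)) by (rewrite <- exp_plus; f_equal; lra).
  assert (H2 : (1 + t / 2) * (1 + t / 2) <= exp t) by (rewrite E; apply Rmult_le_compat; lra).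
  rewrite exp_Ropp. replace (4 / (1 + t) ^ 2) with (/ ((1 + t) ^ 2 / 4)) by (field; lra).
  apply Rinv_le_contravar; nra.
Qed.

(** [Gamma] is an [RInt_gen], so convergence has to be proved before its sign can be read off. Since
    [x <= 1], the power [t^(x-1)] does not decrease when [t] is replaced by the smaller
    [t / (1 + t)]; this gives one majorant, good at [0] and at infinity. *)
Lemma Gamma_pos (x : R) : 0 < x <= 1 -> 0 < Gamma x.
Proof.
  intros Hx.
  set (f := fun t => Rpower t (x - 1) * exp (- t)).
  assert (Hc : forall t, 0 < t -> continuous f t).
  { intros t Ht. apply (@ex_derive_continuous R_AbsRing R_NormedModule).
    unfold f, Rpower. auto_derive. lra. }
  assert (Hp : forall t, 0 < f t) by (intros; apply Rmult_lt_0_compat; apply exp_pos).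
  assert (Hex : forall a b, 0 < a <= b -> ex_RInt f a b).
  { intros a b Hab. apply (ex_RInt_continuous (V := R_CompleteNormedModule)).
    intros z Hz. rewrite Rmin_left, Rmax_right in Hz by lra. apply Hc; lra. }
  destruct (is_RInt_gen_of_bounded f (4 / x)) as (l & Hl & Hle); auto.
  { intros; left; auto. }
  { intros a b Hab.
    (* [t^(x-1) e^(-t)] is dominated by the derivative of [4/x (t/(1+t))^x]. *)
    set (d := fun t => 4 * (Rpower (t / (1 + t)) (x - 1) / (1 + t) ^ 2)).
    set (p := fun t => 4 / x * Rpower (t / (1 + t)) x).
    assert (Hd : is_RInt d a b (minus (p b : R_NormedModule) (p a))).
    { apply (is_RInt_derive (V := R_CompleteNormedModule)).
      - intros t Ht. rewrite Rmin_left, Rmax_right in Ht by lra.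
        assert (0 < t / (1 + t)) by (apply Rdiv_lt_0_compat; lra).
        replace (d t) with (4 / x * (x * (/ (1 + t) ^ 2) * / (t / (1 + t)) * Rpower (t / (1 + t)) x)).
        + unfold p, Rpower. auto_derive. split; [lra|]. split; [|exact I]. lra. set (E0 := exp _). field. lra.
        + unfold d. replace (x - 1) with (x + - (1)) by ring.
          rewrite Rpower_plus, Rpower_Ropp, Rpower_1 by lra. field. lra.
      - intros t Ht. rewrite Rmin_left, Rmax_right in Ht by lra.
        assert (0 < t / (1 + t)) by (apply Rdiv_lt_0_compat; lra).
        apply (@ex_derive_continuous R_AbsRing R_NormedModule).
        unfold d, Rpower. auto_derive. repeat split; try lra.  nra. }
    apply Rle_trans with (p b - p a).
    - refine (is_RInt_le f d a b _ _ (proj2 Hab) (RInt_correct (V := R_CompleteNormedModule) f a b (Hex a b Hab)) Hd _).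
      intros t Ht. unfold f, d.
      assert (0 < t / (1 + t) <= t).
      { split. apply Rdiv_lt_0_compat; lra. apply Rmult_le_reg_r with (1 + t); [lra|].
        unfold Rdiv. rewrite Rmult_assoc, Rinv_l by lra. nra. }
      assert (Rpower t (x - 1) <= Rpower (t / (1 + t)) (x - 1)).
      { replace (x - 1) with (- (1 - x)) by ring. rewrite !Rpower_Ropp.
        apply Rinv_le_contravar. apply exp_pos. apply Rle_Rpower_l; lra. }
      pose proof (exp_neg_le t ltac:(lra)).
      replace (4 * (Rpower (t / (1 + t)) (x - 1) / (1 + t) ^ 2))
        with (Rpower (t / (1 + t)) (x - 1) * (4 / (1 + t) ^ 2)) by (field; lra).
      apply Rmult_le_compat; auto; left; apply exp_pos.
    - assert (0 < 4 / x) by (apply Rdiv_lt_0_compat; lra).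
      assert (0 < p a) by (apply Rmult_lt_0_compat; [lra | apply exp_pos]).
      assert (p b <= 4 / x).
      { unfold p. rewrite <- (Rmult_1_r (4 / x)) at 2. apply Rmult_le_compat_l; [lra|].
        replace 1 with (Rpower 1 x) at 2 by (unfold Rpower; rewrite ln_1, Rmult_0_r, exp_0; reflexivity).
        apply Rle_Rpower_l; [lra|]. split. apply Rdiv_lt_0_compat; lra.
        apply Rmult_le_reg_r with (1 + b); [lra|]. unfold Rdiv. rewrite Rmult_assoc, Rinv_l by lra. lra. }
      lra. }
  unfold Gamma. fold f.
  rewrite (is_RInt_gen_unique (V := R_CompleteNormedModule) f l Hl).
  eapply Rlt_le_trans; [| apply (Hle 1 2); lra].
  apply RInt_gt_0; [lra | auto | intros; apply Hc; lra].
Qed.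

(** Differentiability at [t] gives [|Y c - Y t| <= M (t - c)] near [t], and [(t - c)^(1-g)] tends to
    [0]. *)
Lemma filterlim_boundary_term (g t l : R) (Y : R -> R) :
  0 < g < 1 -> is_derive Y t l ->
  filterlim (fun c => Rpower (t - c) (- g) * (Y c - Y t)) (at_left t) (locally 0).
Proof.
  intros Hg HY. apply is_derive_Reals in HY.
  destruct (HY 1 Rlt_0_1) as [d Hd].
  set (M := Rabs l + 1). assert (HM : 0 < M) by (unfold M; pose proof (Rabs_pos l); lra).
  assert (Hb : at_left t (fun c => Rabs (Rpower (t - c) (- g) * (Y c - Y t)) <= M * Rpower (t - c) (1 - g))).
  { generalize (at_left_between (t - d) t ltac:(pose proof (cond_pos d); lra)).
    apply filter_imp. intros c Hc.
    specialize (Hd (c - t) ltac:(lra) ltac:(rewrite Rabs_left; lra)).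
    replace (t + (c - t)) with c in Hd by ring.
    assert (E : Rabs ((Y c - Y t) / (c - t)) <= M).
    { replace ((Y c - Y t) / (c - t)) with (((Y c - Y t) / (c - t) - l) + l) by ring.
      eapply Rle_trans; [apply Rabs_triang|]. unfold M. lra. }
    rewrite Rabs_mult, (Rabs_pos_eq (Rpower _ _)) by (left; apply exp_pos).
    replace (Y c - Y t) with ((Y c - Y t) / (c - t) * (c - t)) by (field; lra).
    rewrite Rabs_mult, (Rabs_left (c - t)) by lra.
    replace (1 - g) with (- g + 1) by ring. rewrite Rpower_plus, Rpower_1 by lra.
    assert (0 < Rpower (t - c) (- g)) by apply exp_pos.
    replace (- (c - t)) with (t - c) by ring.
    replace (M * (Rpower (t - c) (- g) * (t - c))) with (Rpower (t - c) (- g) * (M * (t - c))) by ring.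
    apply Rmult_le_compat_l; [lra|]. apply Rmult_le_compat_r; lra. }
  assert (HL := filterlim_lincomb (F := at_left t) _ (fun _ => 0) M 0 _ 0
    (filterlim_Rpower_sub_0 t (1 - g) ltac:(lra)) (filterlim_const _)).
  intros P [e He]. unfold filtermap.
  assert (HB : locally (M * 0 + 0 * 0) (fun y => y < e)).
  { exists e. intros y Hy. apply ball_R in Hy; simpl in Hy.
    apply Rabs_def2 in Hy. lra. }
  specialize (HL _ HB). unfold filtermap in HL.
  generalize (filter_and _ _ Hb HL). apply filter_imp. intros c [H1 H2].
  apply He. apply R_ball.
  rewrite Rminus_0_r. lra.
Qed.

(** Integration by parts with the antiderivative [Y s - Y t] of [dY]: this choice makes the boundary
    term at the singular end [t] vanish in the limit, and the one at [0] becomes that of the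
    Marchaud form. As [dY] is controlled only inside [(0, T)], parts are taken on [[a, c]] with
    [0 < a], and [a] tends to [0] before [c] tends to [t]. *)
Lemma caputo_marchaud (g T t I : R) (Y dY : R -> R) :
  0 < g < 1 -> 0 < t < T -> (forall x, continuous Y x) ->
  (forall s, 0 < s < T -> is_derive Y s (dY s)) ->
  (forall s, 0 < s < T -> continuous dY s) ->
  is_RInt_gen (fun s => Rpower (t - s) (- g) * dY s) (at_right 0) (at_left t) I ->
  marchaud g Y t I.
Proof.
  intros Hg Ht HY HD HC HI.
  set (K := fun s => Rpower (t - s) (- g - 1) * (Y t - Y s)).
  assert (HKex : forall a c, a <= c < t -> ex_RInt K a c) by (intros; apply ex_RInt_kernel; auto).
  assert (HP : forall a c, 0 < a <= c -> c < t ->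
    is_RInt (fun s => Rpower (t - s) (- g) * dY s) a c
      (Rpower (t - c) (- g) * (Y c - Y t) - Rpower (t - a) (- g) * (Y a - Y t) + g * RInt K a c)).
  { intros a c Hac Hct.
    set (q := fun s => Rpower (t - s) (- g) * (Y s - Y t)).
    set (dq := fun s => g * Rpower (t - s) (- g - 1) * (Y s - Y t) + Rpower (t - s) (- g) * dY s).
    assert (E : is_RInt dq a c (minus (q c : R_NormedModule) (q a))).
    { apply (is_RInt_derive (V := R_CompleteNormedModule)).
      - intros s Hs. rewrite Rmin_left, Rmax_right in Hs by lra.
        unfold q, dq. apply (is_derive_mult (fun s => Rpower (t - s) (- g)) (fun s => Y s - Y t)).
        + replace (g * Rpower (t - s) (- g - 1)) with (- - g * Rpower (t - s) (- g - 1)) by ring.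
          apply is_derive_Rpower_sub; lra.
        + replace (dY s) with (minus (dY s : R_NormedModule) zero) by (unfold minus, plus, opp, zero; simpl; ring).
          apply (is_derive_minus (V := R_NormedModule) Y (fun _ => Y t)).
          apply HD; lra. apply (is_derive_const (V := R_NormedModule)).
        + intros; apply Rmult_comm.
      - intros s Hs. rewrite Rmin_left, Rmax_right in Hs by lra.
        apply (continuous_plus (V := R_NormedModule) (fun s => g * Rpower (t - s) (- g - 1) * (Y s - Y t)) (fun s => Rpower (t - s) (- g) * dY s)).
        + apply (continuous_mult (K := R_AbsRing) (fun s => g * Rpower (t - s) (- g - 1)) (fun s => Y s - Y t)).
          * apply (continuous_scal_r (V := R_NormedModule) g (fun s => Rpower (t - s) (- g - 1))).
            apply continuous_Rpower_sub; lra.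
          * apply (continuous_minus (V := R_NormedModule) Y (fun _ => Y t)). apply HY. apply continuous_const.
        + apply (continuous_mult (K := R_AbsRing) (fun s => Rpower (t - s) (- g)) dY).
          apply continuous_Rpower_sub; lra. apply HC; lra. }
    assert (EK : is_RInt K a c (RInt K a c)) by (apply (RInt_correct (V := R_CompleteNormedModule)), HKex; lra).
    apply (is_RInt_scal (V := R_NormedModule) _ _ _ g) in EK.
    pose proof (is_RInt_plus (V := R_NormedModule) _ _ _ _ _ _ E EK) as ES.
    replace (Rpower (t - c) (- g) * (Y c - Y t) - Rpower (t - a) (- g) * (Y a - Y t) + g * RInt K a c)
      with (plus (minus (q c : R_NormedModule) (q a)) (scal g (RInt K a c)))
      by (change (q c - q a + g * RInt K a c = Rpower (t - c) (- g) * (Y c - Y t) - Rpower (t - a) (- g) * (Y a - Y t) + g * RInt K a c); unfold q; ring).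
    eapply is_RInt_ext; [| exact ES]. intros s _.
    unfold plus, scal, dq, K; simpl; unfold mult; simpl. ring_R. }
  assert (HB := filterlim_boundary_term g t (dY t) Y Hg (HD t Ht)).
  intros P [e He]. unfold filtermap.
  assert (He3 : 0 < e / 3) by (pose proof (cond_pos e); lra).
  (* The hypothesis is a limit in both ends jointly; its product neighbourhood allows [c] to be
     fixed near [t] while [a] tends to [0]. *)
  destruct (HI (fun y => Rabs (y - I) < e / 3)) as [Q Q' HQ HQ' HQR].
  { exists (mkposreal _ He3). intros y Hy. exact Hy. }
  assert (HB' : locally 0 (fun y => Rabs y < e / 3)).
  { exists (mkposreal _ He3). intros y Hy. apply ball_R in Hy; simpl in Hy.
    rewrite Rminus_0_r in Hy. exact Hy. }
  specialize (HB _ HB'). unfold filtermap in HB.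
  generalize (filter_and _ _ (filter_and _ _ HQ' HB) (at_left_between 0 t (proj1 Ht))).
  apply filter_imp. intros c [[Hc1 Hc2] Hc3]. apply He.
  set (S := Rpower (t - c) (- g) * (Y c - Y t)) in *.
  set (F := Rpower t (- g) * (Y t - Y 0) + g * RInt K 0 c).
  assert (HG : filterlim (fun a => S - Rpower (t - a) (- g) * (Y a - Y t) + g * (RInt K 0 c - RInt K 0 a))
     (at_right 0) (locally (S + F))).
  { assert (Hcont : continuous (fun a => S - Rpower (t - a) (- g) * (Y a - Y t) + g * (RInt K 0 c - RInt K 0 a)) 0).
    { apply (continuous_plus (V := R_NormedModule) (fun a => S - Rpower (t - a) (- g) * (Y a - Y t)) (fun a => g * (RInt K 0 c - RInt K 0 a))).
      - apply (continuous_minus (V := R_NormedModule) (fun _ => S)). apply continuous_const.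
        apply (continuous_mult (K := R_AbsRing) (fun s => Rpower (t - s) (- g)) (fun a => Y a - Y t)).
        apply continuous_Rpower_sub; lra.
        apply (continuous_minus (V := R_NormedModule) Y (fun _ => Y t)). apply HY. apply continuous_const.
      - apply (continuous_scal_r (V := R_NormedModule) g (fun a => RInt K 0 c - RInt K 0 a)).
        apply (continuous_minus (V := R_NormedModule) (fun _ => RInt K 0 c)). apply continuous_const.
        apply (continuous_RInt_0 (V := R_CompleteNormedModule) K 0 (fun a => RInt K 0 a)).
        assert (Hd : 0 < t) by lra. exists (mkposreal _ Hd). intros y Hy.
        apply ball_R in Hy; simpl in Hy.
        apply Rabs_def2 in Hy. apply (RInt_correct (V := R_CompleteNormedModule)).
        destruct (Rle_lt_dec 0 y). apply HKex; lra. apply ex_RInt_swap, HKex; lra. }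
    unfold continuous in Hcont.
    rewrite RInt_point, (Rminus_0_r t) in Hcont.
    replace (S + F) with (S - Rpower t (- g) * (Y 0 - Y t) + g * (RInt K 0 c - 0)) by (unfold F; ring).
    eapply filterlim_filter_le_1; [| exact Hcont]. apply filter_le_within. }
  assert (HN : at_right 0 (fun a => Rabs (S - Rpower (t - a) (- g) * (Y a - Y t) + g * (RInt K 0 c - RInt K 0 a) - I) < e / 3)).
  { generalize (filter_and _ _ HQ (at_right_between 0 c (proj1 Hc3))). apply filter_imp. intros a [Ha1 Ha2].
    destruct (HQR a c Ha1 Hc1) as (J & HJ & HJI). simpl in HJ.
    pose proof (is_RInt_unique (V := R_CompleteNormedModule) _ _ _ _ HJ) as U1.
    pose proof (is_RInt_unique (V := R_CompleteNormedModule) _ _ _ _ (HP a c ltac:(lra) ltac:(lra))) as U2.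
    rewrite <- U1, U2 in HJI. fold S in HJI.
    assert (E : RInt K 0 c = RInt K 0 a + RInt K a c).
    { symmetry; apply (RInt_Chasles (V := R_CompleteNormedModule)); apply HKex; lra. }
    assert (EE : forall u v : R, u + v - u = v) by (intros; ring).
    rewrite E, (EE (RInt K 0 a) (RInt K a c)). exact HJI. }
  assert (L1 : S + F <= I + e / 3).
  { eapply (filterlim_le_R (F := at_right 0) _ (fun _ => I + e / 3)); [| exact HG | apply filterlim_const].
    generalize HN. apply filter_imp. intros a Ha. apply Rabs_def2 in Ha. lra. }
  assert (L2 : I - e / 3 <= S + F).
  { eapply (filterlim_le_R (F := at_right 0) (fun _ => I - e / 3)); [| apply filterlim_const | exact HG].
    generalize HN. apply filter_imp. intros a Ha. apply Rabs_def2 in Ha. lra. }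
  change (Rabs (F - I) < e). apply Rabs_def2 in Hc2. apply Rabs_def1; lra.
Qed.

(** * Coordinates in an eigenbasis *)

(** A continuous linear form commutes with Riemann sums and with their limit; this reduces the
    vector-valued integrals to scalar ones. *)
Lemma is_RInt_linear {V : NormedModule R_AbsRing} (L : V -> R_NormedModule) (f : R -> V) (a b : R) (I : V) :
  is_linear L -> is_RInt f a b I -> is_RInt (fun s => L (f s)) a b (L I).
Proof.
  intros HL HI. unfold is_RInt in *.
  pose proof (filterlim_comp _ _ _ _ _ _ _ _ HI (linear_cont L I HL)) as HC.
  eapply filterlim_ext; [| exact HC]. intros ptd. cbv beta.
  rewrite (linear_scal L HL). f_equal.
  pattern ptd. apply SF_cons_ind; clear ptd.
  - intros x. apply (linear_zero L HL).
  - intros h ptd IH. rewrite !Riemann_sum_cons. rewrite (linear_plus L HL), IH. f_equal.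
    apply (linear_scal L HL).
Qed.

Lemma is_RInt_gen_linear {V : NormedModule R_AbsRing} (L : V -> R_NormedModule) (f : R -> V)
    (Fa Fb : (R -> Prop) -> Prop) (I : V) :
  Filter Fa -> Filter Fb ->
  is_linear L -> is_RInt_gen f Fa Fb I -> is_RInt_gen (fun s => L (f s)) Fa Fb (L I).
Proof.
  intros FFa FFb HL HI P HP. specialize (HI _ (linear_cont L I HL P HP)).
  unfold filtermapi in *. revert HI. apply filter_imp. intros ab (y & Hy & HPy).
  exists (L y). split; [| exact HPy]. apply is_RInt_linear; auto.
Qed.

Lemma is_derive_linear {V : NormedModule R_AbsRing} (L : V -> R_NormedModule) (u : R -> V) (t : R) (l : V) :
  is_linear L -> is_derive u t l -> is_derive (fun s => L (u s)) t (L l).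
Proof.
  intros HL Hu. unfold is_derive in *.
  eapply filterdiff_ext_lin.
  - apply (filterdiff_comp' u L t (fun y => scal y l) L Hu). apply filterdiff_linear, HL.
  - intros y. cbv beta. apply (linear_scal L HL).
Qed.

Lemma is_series_linear {V : NormedModule R_AbsRing} (L : V -> R_NormedModule) (a : nat -> V) (l : V) :
  is_linear L -> is_series a l -> is_series (fun n => L (a n)) (L l).
Proof.
  intros HL Ha. unfold is_series in *.
  pose proof (filterlim_comp _ _ _ _ _ _ _ _ Ha (linear_cont L l HL)) as HC.
  eapply filterlim_ext; [| exact HC]. intros n. cbv beta.
  induction n as [|n IH].
  - rewrite !sum_O. reflexivity.
  - rewrite !sum_Sn, <- IH. apply (linear_plus L HL).
Qed.

Lemma inner_plus_r {H : NormedModule R_AbsRing} (inner : H -> H -> R) (x y z : H) :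
  is_inner inner -> inner x (plus y z) = inner x y + inner x z.
Proof.
  intros HI. rewrite (inner_sym _ HI), (inner_plus _ HI), !(inner_sym _ HI _ x). reflexivity.
Qed.

Lemma inner_scal_r {H : NormedModule R_AbsRing} (inner : H -> H -> R) (a : R) (x y : H) :
  is_inner inner -> inner x (scal a y) = a * inner x y.
Proof. intros HI. rewrite (inner_sym _ HI), (inner_scal _ HI), (inner_sym _ HI). reflexivity. Qed.

Lemma inner_zero_l {H : NormedModule R_AbsRing} (inner : H -> H -> R) (y : H) :
  is_inner inner -> inner zero y = 0.
Proof.
  intros HI. pose proof (inner_plus _ HI zero zero y) as E. rewrite plus_zero_l in E. lra.
Qed.

Lemma inner_minus_l {H : NormedModule R_AbsRing} (inner : H -> H -> R) (x y z : H) :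
  is_inner inner -> inner (minus x y) z = inner x z - inner y z.
Proof.
  intros HI. unfold minus. rewrite (inner_plus _ HI).
  pose proof (inner_plus _ HI y (opp y) z) as E. 
  replace (inner (plus y (opp y)) z) with 0 in E. lra.
  replace (plus y (opp y)) with (zero : H) by (symmetry; exact (plus_opp_r y)).
  symmetry; apply inner_zero_l; auto.
Qed.

(** Positivity is hidden in [norm x = sqrt (inner x x)]: a negative [inner x x] would have square
    root [0], hence [x = zero] and [inner x x = 0]. *)
Lemma inner_nonneg {H : NormedModule R_AbsRing} (inner : H -> H -> R) (x : H) :
  is_inner inner -> 0 <= inner x x.
Proof.
  intros HI. destruct (Rle_lt_dec 0 (inner x x)) as [|Hn]; auto. exfalso.
  assert (Hx : x = zero).
  { apply norm_eq_zero. rewrite (inner_norm _ HI). apply sqrt_neg_0. lra. }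
  rewrite Hx, inner_zero_l in Hn; auto. lra.
Qed.

Lemma norm_sq {H : NormedModule R_AbsRing} (inner : H -> H -> R) (x : H) :
  is_inner inner -> norm x ^ 2 = inner x x.
Proof. intros HI. rewrite (inner_norm _ HI). apply pow2_sqrt, inner_nonneg, HI. Qed.

Lemma cauchy_schwarz {H : NormedModule R_AbsRing} (inner : H -> H -> R) (x y : H) :
  is_inner inner -> Rabs (inner x y) <= norm x * norm y.
Proof.
  intros HI.
  assert (Q : forall a b : R, 0 <= a ^ 2 * inner x x + 2 * a * b * inner x y + b ^ 2 * inner y y).
  { intros a b. pose proof (inner_nonneg inner (plus (scal a x) (scal b y)) HI) as E.
    rewrite (inner_plus _ HI), !(inner_plus_r _ _ _ _ HI), !(inner_scal _ HI), !(inner_scal_r _ _ _ _ HI) in E.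
    rewrite (inner_sym _ HI y x) in E. nra. }
  rewrite <- (sqrt_Rsqr_abs (inner x y)), !(inner_norm _ HI), <- sqrt_mult by (apply inner_nonneg; auto).
  apply sqrt_le_1_alt. unfold Rsqr.
  pose proof (inner_nonneg inner x HI). pose proof (inner_nonneg inner y HI).
  set (p := inner x x) in *. set (q := inner y y) in *. set (r := inner x y) in *.
  destruct (Req_dec q 0) as [Hq|Hq].
  - rewrite Hq in *. destruct (Req_dec r 0) as [->|Hr]; [lra|].
    (* For [q = 0] the form is affine in [b]; this [b] gives it the negative value
       [p - 2 (p + 1)]. *)
    pose proof (Q 1 (- (p + 1) / r)) as E.
    replace (2 * 1 * (- (p + 1) / r) * r) with (- (2 * (p + 1))) in E by (field; auto). lra.
  - pose proof (Q q (- r)) as E. assert (0 < q) by lra.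
    apply Rmult_le_reg_l with q; auto. nra.
Qed.

Lemma is_linear_inner {H : NormedModule R_AbsRing} (inner : H -> H -> R) (y : H) :
  is_inner inner -> is_linear (fun x => inner x y : R_NormedModule).
Proof.
  intros HI. split.
  - intros. apply (inner_plus _ HI).
  - intros. apply (inner_scal _ HI).
  - exists (norm y + 1). split.
    + pose proof (norm_ge_0 y). lra.
    + intros x. apply Rle_trans with (norm x * norm y). apply (cauchy_schwarz inner x y HI).
      pose proof (norm_ge_0 x). nra.
Qed.

Lemma inner_ext {H : NormedModule R_AbsRing} (inner : H -> H -> R) (x y : H) :
  is_inner inner -> (forall z, inner x z = inner y z) -> x = y.
Proof.
  intros HI E. assert (Hm : minus x y = zero).
  { apply norm_eq_zero. rewrite (inner_norm _ HI), inner_minus_l, E, Rminus_diag by auto. apply sqrt_0. }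
  apply (plus_reg_r (G := NormedModule.AbelianGroup _ H) (opp y)).
  etransitivity; [exact Hm | symmetry; exact (plus_opp_r y)].
Qed.

(** [iota] selects the derivative only once uniqueness is known; two candidates agree because they
    agree when tested with every [z]. *)
Lemma vderive_correct {H : CompleteNormedModule R_AbsRing} (inner : H -> H -> R) (u : R -> H) (t : R) :
  is_inner inner -> ex_derive u t -> is_derive u t (vderive u t).
Proof.
  intros HI [l Hl]. unfold vderive. apply (iota_correct (is_derive u t)).
  exists l. split; auto. intros l' Hl'. apply (inner_ext inner); auto. intros z.
  pose proof (is_derive_linear _ _ _ _ (is_linear_inner inner z HI) Hl) as D1.
  pose proof (is_derive_linear _ _ _ _ (is_linear_inner inner z HI) Hl') as D2.
  apply is_derive_unique in D1. apply is_derive_unique in D2. congruence.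
Qed.

(** A solution is controlled only on [[0, T]]. Composing it with this projection freezes it outside,
    which makes it continuous on the whole line. *)
Definition clamp (T t : R) : R := Rmax 0 (Rmin t T).

Lemma clamp_id (T t : R) : 0 <= t <= T -> clamp T t = t.
Proof. intros Ht. unfold clamp. rewrite Rmin_left, Rmax_right; lra. Qed.

Lemma continuous_clamp {V : UniformSpace} (T : R) (u : R -> V) :
  0 < T -> continuous_on (fun t => 0 <= t <= T) u -> forall x, continuous (fun t => u (clamp T t)) x.
Proof.
  intros HT Hu x.
  assert (Hc : forall t, 0 <= clamp T t <= T).
  { intros t. unfold clamp. split. apply Rmax_l. apply Rmax_lub. lra. apply Rmin_r. }
  assert (HL : forall s t, Rabs (clamp T s - clamp T t) <= Rabs (s - t)).
  { assert (Hcl : forall s, s <= 0 /\ clamp T s = 0 \/ 0 <= s <= T /\ clamp T s = s \/ T <= s /\ clamp T s = T).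
    { intros s. unfold clamp. destruct (Rle_lt_dec s 0); [left; rewrite Rmin_left, Rmax_left; lra|].
      destruct (Rle_lt_dec s T); right; [left; rewrite Rmin_left, Rmax_right; lra|].
      right; rewrite Rmin_right, Rmax_right; lra. }
    intros s t. destruct (Hcl s) as [[? ->]|[[? ->]|[? ->]]], (Hcl t) as [[? ->]|[[? ->]|[? ->]]];
    unfold Rabs; repeat match goal with |- context [Rcase_abs ?a] => destruct (Rcase_abs a) end; lra. }
  specialize (Hu (clamp T x) (Hc x)).
  apply (filterlim_comp _ _ _ (clamp T) u _ (within (fun t => 0 <= t <= T) (locally (clamp T x))) _); [| exact Hu].
  intros P [e He]. exists e. intros y Hy. apply He; [| apply Hc].
  eapply Rle_lt_trans; [apply HL | exact Hy].
Qed.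

(** Pairing with [e] turns [L] into multiplication by [l]; this will serve [A] and [A_alpha] alike.
    Clearing the prefactor [1 / Gamma (1 - gamma)] of the Caputo derivative puts [Gamma (1 - gamma)]
    into the rate. *)
Lemma solution_coordinate {H : CompleteNormedModule R_AbsRing} (inner : H -> H -> R)
    (gamma T : R) (L : operator H) (u : R -> H) (e : H) (l : R) :
  is_inner inner -> 0 < gamma < 1 -> 0 < T -> is_solution gamma T L u ->
  (forall x, dom L x -> inner (L x) e = l * inner x e) ->
  relaxation gamma (l * Gamma (1 - gamma)) T (fun t => inner (u (clamp T t)) e).
Proof.
  intros HI Hg HT Hu HL.
  pose proof (is_linear_inner inner e HI) as Hlin.
  assert (HC : forall x, continuous (fun t => inner (u (clamp T t)) e) x).
  { intros x. apply (continuous_comp (fun t => u (clamp T t)) (fun v => inner v e : R_NormedModule)).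
    apply continuous_clamp; auto. apply (sol_cont _ _ _ _ Hu). apply (linear_cont _ _ Hlin). }
  split; [exact HC|]. intros t Ht.
  pose proof (Gamma_pos (1 - gamma) ltac:(lra)) as HG.
  destruct (sol_eq _ _ _ _ Hu t Ht) as (w & (I & HInt & Hw) & Hz).
  assert (EI : inner I e = - (l * Gamma (1 - gamma) * inner (u t) e)).
  { assert (E : inner w e + inner (L (u t)) e = 0).
    { transitivity (inner (plus w (L (u t))) e).
      - symmetry. exact (inner_plus _ HI w (L (u t)) e).
      - rewrite Hz. exact (inner_zero_l inner e HI). }
    assert (E' : inner w e = 1 / Gamma (1 - gamma) * inner I e).
    { rewrite Hw. exact (inner_scal _ HI _ I e). }
    rewrite E', HL in E by apply (sol_dom _ _ _ _ Hu t Ht).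
    apply Rmult_eq_reg_l with (1 / Gamma (1 - gamma)).
    - replace (1 / Gamma (1 - gamma) * - (l * Gamma (1 - gamma) * inner (u t) e))
        with (- (l * inner (u t) e)) by (field; lra). lra.
    - apply Rgt_not_eq, Rdiv_lt_0_compat; lra. }
  rewrite (clamp_id T t) by lra. rewrite <- EI.
  apply (caputo_marchaud gamma T t _ _ (fun s => inner (vderive u s) e)); auto.
  - intros s Hs.
    apply (is_derive_ext_loc (fun r => inner (u r) e)).
    + assert (Hd : 0 < Rmin s (T - s)) by (apply Rmin_glb_lt; lra).
      exists (mkposreal _ Hd). intros y Hy.
      apply ball_R in Hy; simpl in Hy.
      pose proof (Rmin_l s (T - s)). pose proof (Rmin_r s (T - s)).
      apply Rabs_def2 in Hy. rewrite clamp_id by lra. reflexivity.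
    + apply (is_derive_linear (fun v => inner v e : R_NormedModule)); auto.
      apply (vderive_correct inner); auto. apply (sol_diff _ _ _ _ Hu s Hs).
  - intros s Hs. apply (continuous_comp (vderive u) (fun v => inner v e : R_NormedModule)).
    apply (sol_C1 _ _ _ _ Hu s Hs). apply (linear_cont _ _ Hlin).
  - pose proof (is_RInt_gen_linear _ _ _ _ _ _ _ Hlin HInt) as HF. cbv beta in HF.
    eapply is_RInt_gen_ext; [| exact HF].
    apply filter_forall. intros ab s _. exact (inner_scal _ HI _ (vderive u s) e).
Qed.

(** * Expansions in the eigenbasis and diagonal operators *)

Lemma series_single (k : nat) (a : R) (c : nat -> R) :
  c k = a -> (forall n, n <> k -> c n = 0) -> is_series c (a : R_NormedModule).
Proof.
  intros Hk Hn. unfold is_series.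
  apply (filterlim_ext_loc (fun _ => a)); [| apply filterlim_const].
  exists k. intros n Hkn.
  assert (E0 : forall m, (m < k)%nat -> sum_n c m = (0 : R_NormedModule)).
  { induction m as [|m IH]; intros Hm. rewrite sum_O; apply Hn; lia.
    rewrite sum_Sn, IH, Hn by lia. apply Rplus_0_r. }
  induction Hkn as [|n Hkn IH].
  - destruct k as [|k]. rewrite sum_O; auto. rewrite sum_Sn, E0, Hk by lia. symmetry; apply Rplus_0_l.
  - rewrite sum_Sn, <- IH, Hn by lia. symmetry; apply Rplus_0_r.
Qed.

Lemma parseval {H : NormedModule R_AbsRing} (inner : H -> H -> R) (A : operator H)
    (lam : nat -> R) (phi : nat -> H) (v : H) :
  is_inner inner -> eigenbasis inner A lam phi ->
  is_series (fun n => inner v (phi n) ^ 2) (norm v ^ 2).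
Proof.
  intros HI HE.
  pose proof (is_series_linear _ _ _ (is_linear_inner inner v HI) (eb_basis _ _ _ _ HE v)) as HS.
  rewrite (norm_sq inner v HI). eapply is_series_ext; [| exact HS].
  intros n. cbv beta. rewrite (inner_scal _ HI), (inner_sym _ HI (phi n)). simpl. ring.
Qed.

Lemma norm_sq_sum_orthonormal {H : NormedModule R_AbsRing} (inner : H -> H -> R)
    (phi : nat -> H) (c : nat -> R) (n m : nat) :
  is_inner inner -> (forall k, inner (phi k) (phi k) = 1) ->
  (forall j k, j <> k -> inner (phi j) (phi k) = 0) ->
  norm (sum_n_m (fun k => scal (c k) (phi k)) n m) ^ 2
  = sum_n_m (fun k => c k ^ 2 : R_NormedModule) n m.
Proof.
  intros HI H1 H0. rewrite (norm_sq inner _ HI).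
  set (a := fun k => scal (c k) (phi k)).
  assert (Ho : forall m j, (m < j)%nat -> inner (sum_n_m a n m) (phi j) = 0).
  { intros m'. induction m' as [|m' IH]; intros j Hj.
    - destruct n as [|n].
      + rewrite sum_n_n. unfold a. rewrite (inner_scal _ HI), H0 by lia. ring.
      + rewrite sum_n_m_zero by lia. apply inner_zero_l; auto.
    - destruct (Nat.le_gt_cases n (S m')) as [Hn|Hn].
      + rewrite sum_n_Sm by lia. rewrite (inner_plus _ HI), IH by lia.
        unfold a. rewrite (inner_scal _ HI), H0 by lia. ring.
      + rewrite sum_n_m_zero by lia. apply inner_zero_l; auto. }
  induction m as [|m IH].
  - destruct n as [|n].
    + rewrite !sum_n_n. unfold a. rewrite (inner_scal _ HI), (inner_scal_r _ _ _ _ HI), H1. ring.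
    + rewrite !sum_n_m_zero by lia. apply inner_zero_l; auto.
  - destruct (Nat.le_gt_cases n (S m)) as [Hn|Hn].
    + rewrite !sum_n_Sm by lia. rewrite <- IH.
      rewrite (inner_plus _ HI), !(inner_plus_r _ _ _ _ HI).
      rewrite (inner_sym _ HI (a (S m)) (sum_n_m a n m)).
      replace (inner (sum_n_m a n m) (a (S m))) with 0.
      2: { unfold a at 2. rewrite (inner_scal_r _ _ _ _ HI), Ho by lia. ring. }
      unfold a at 3 4. rewrite (inner_scal _ HI), (inner_scal_r _ _ _ _ HI), H1.
      unfold plus; simpl. ring.
    + rewrite !sum_n_m_zero by lia. apply inner_zero_l; auto.
Qed.

(** By Pythagoras the blocks of this series are bounded by those of the Parseval series of [v]; the
    Cauchy criterion and completeness of [H] give convergence. *)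
Lemma diag_op_dom {H : CompleteNormedModule R_AbsRing} (inner : H -> H -> R) (A : operator H)
    (lam : nat -> R) (phi : nat -> H) (m : nat -> R) (v : H) :
  is_inner inner -> eigenbasis inner A lam phi -> (forall n, Rabs (m n) <= 1) ->
  dom (diag_op inner phi m) v.
Proof.
  intros HI HE Hm. simpl. apply ex_series_Cauchy. intros e.
  assert (He : 0 < e ^ 2) by (apply pow_lt, cond_pos).
  destruct (Cauchy_ex_series _ (ex_intro _ _ (parseval inner A lam phi v HI HE)) (mkposreal _ He)) as [N HN].
  exists N. intros n k Hn Hk. specialize (HN n k Hn Hk). simpl in HN.
  set (a := fun n0 => scal (m n0 * inner v (phi n0)) (phi n0)).
  assert (E : norm (sum_n_m a n k) ^ 2 < e ^ 2).
  { eapply Rle_lt_trans; [| eapply Rle_lt_trans; [apply Rle_abs | exact HN]].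
    unfold a. eapply Rle_trans.
    - right. exact (norm_sq_sum_orthonormal inner phi (fun n0 => m n0 * inner v (phi n0)) n k HI (eb_unit _ _ _ _ HE) (eb_orth _ _ _ _ HE)).
    - apply sum_n_m_le. intros j. cbv beta. rewrite Rpow_mult_distr.
      assert (m j ^ 2 <= 1). { specialize (Hm j). apply Rabs_le_between in Hm. nra. }
      pose proof (pow2_ge_0 (inner v (phi j))). nra. }
  pose proof (norm_ge_0 (sum_n_m a n k)). pose proof (cond_pos e).
  apply Rnot_le_lt. intros Hc. apply (Rlt_irrefl (e ^ 2)).
  refine (Rle_lt_trans _ _ _ (pow_incr _ _ 2 (conj (Rlt_le _ _ H1) _)) E). exact Hc.
Qed.

Lemma diag_op_coord {H : CompleteNormedModule R_AbsRing} (inner : H -> H -> R) (A : operator H)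
    (lam : nat -> R) (phi : nat -> H) (m : nat -> R) (v : H) (k : nat) :
  is_inner inner -> eigenbasis inner A lam phi -> dom (diag_op inner phi m) v ->
  inner (diag_op inner phi m v) (phi k) = m k * inner v (phi k).
Proof.
  intros HI HE [l Hl]. simpl in Hl.
  assert (HL : forall y, is_series (fun n => scal (m n * inner v (phi n)) (phi n)) y ->
     is_series (fun n => inner (scal (m n * inner v (phi n)) (phi n)) (phi k) : R_NormedModule) (inner y (phi k))).
  { intros y Hy. exact (is_series_linear _ _ _ (is_linear_inner inner (phi k) HI) Hy). }
  assert (Hop : is_series (fun n => scal (m n * inner v (phi n)) (phi n)) (diag_op inner phi m v)).
  { simpl. apply (iota_correct (is_series (fun n => scal (m n * inner v (phi n)) (phi n)))).
    exists l. split; auto. intros l' Hl'. exact (filterlim_locally_unique _ l l' Hl Hl'). }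
  apply HL in Hop.
  assert (Hs : is_series (fun n => inner (scal (m n * inner v (phi n)) (phi n)) (phi k) : R_NormedModule) (m k * inner v (phi k))).
  { apply (series_single k).
    - etransitivity; [exact (inner_scal _ HI _ (phi k) (phi k))|]. rewrite (eb_unit _ _ _ _ HE). apply Rmult_1_r.
    - intros n Hn. etransitivity; [exact (inner_scal _ HI _ (phi n) (phi k))|]. rewrite (eb_orth _ _ _ _ HE) by auto. apply Rmult_0_r. }
  exact (filterlim_locally_unique _ _ _ Hop Hs).
Qed.

(** The pair [(phi k, lam k phi k)] lies in the graph of [A], hence in that of its adjoint, which
    moves [A] to the other side of the inner product. *)
Lemma eigen_coord {H : NormedModule R_AbsRing} (inner : H -> H -> R) (A : operator H)
    (lam : nat -> R) (phi : nat -> H) (v : H) (k : nat) :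
  is_inner inner -> self_adjoint inner A -> eigenbasis inner A lam phi -> dom A v ->
  inner (A v) (phi k) = lam k * inner v (phi k).
Proof.
  intros HI (_ & _ & Hadj) HE Hv.
  rewrite (proj1 (Hadj (phi k) (scal (lam k) (phi k)))); auto.
  - apply inner_scal_r; auto.
  - split. apply (eb_dom _ _ _ _ HE). symmetry. apply (eb_eigen _ _ _ _ HE).
Qed.

Lemma eigenvalue_ge {H : NormedModule R_AbsRing} (inner : H -> H -> R) (A : operator H)
    (lam : nat -> R) (phi : nat -> H) (n : nat) :
  eigenbasis inner A lam phi -> lam 0%nat <= lam n.
Proof.
  intros HE. induction n as [|n IH]. lra. pose proof (eb_incr _ _ _ _ HE n). lra.
Qed.

(* [m_n = alpha lam_n^b / (1 + alpha lam_n^b)], the eigenvalues of [I - B_alpha]. *)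
Definition damp (b alpha l : R) : R := alpha * Rpower l b / (1 + alpha * Rpower l b).

Lemma damp_bounds (b alpha l : R) : 0 < alpha -> 0 < damp b alpha l < 1.
Proof.
  intros Ha. unfold damp. assert (0 < alpha * Rpower l b) by (apply Rmult_lt_0_compat; [auto | apply exp_pos]).
  split. apply Rdiv_lt_0_compat; lra.
  apply Rmult_lt_reg_r with (1 + alpha * Rpower l b). lra.
  unfold Rdiv. rewrite Rmult_assoc, Rinv_l by lra. lra.
Qed.

Lemma B_residual {H : CompleteNormedModule R_AbsRing} (inner : H -> H -> R) (A : operator H)
    (lam : nat -> R) (phi : nat -> H) (b alpha : R) (f : H) :
  is_inner inner -> eigenbasis inner A lam phi -> 0 < alpha ->
  is_series (fun n => (damp b alpha (lam n) * inner f (phi n)) ^ 2)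
    (norm (minus (B_op inner lam phi b alpha f) f) ^ 2).
Proof.
  intros HI HE Ha.
  eapply is_series_ext; [| exact (parseval inner A lam phi _ HI HE)].
  intros n. cbv beta.
  set (X := alpha * Rpower (lam n) b). assert (HX : 0 < X) by (apply Rmult_lt_0_compat; [auto | apply exp_pos]).
  assert (E : inner (minus (B_op inner lam phi b alpha f) f) (phi n) = - (damp b alpha (lam n) * inner f (phi n))).
  { etransitivity; [exact (inner_minus_l inner (B_op inner lam phi b alpha f) f (phi n) HI)|].
    unfold B_op. rewrite (diag_op_coord inner A lam); auto.
    - fold X. unfold damp. fold X. field. lra.
    - apply (diag_op_dom inner A lam); auto. intros k.
      assert (0 < alpha * Rpower (lam k) b) by (apply Rmult_lt_0_compat; [auto | apply exp_pos]).
      unfold Rdiv. rewrite Rmult_1_l, Rabs_inv, Rabs_pos_eq by lra.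
      rewrite <- Rinv_1 at 2. apply Rinv_le_contravar; lra. }
  rewrite E. ring_R.
Qed.

(** * The discrepancy equation *)

Lemma sum_n_le (x y : nat -> R) (N : nat) :
  (forall n, (n <= N)%nat -> x n <= y n) -> sum_n x N <= sum_n y N.
Proof.
  induction N as [|N IH]; intros H.
  - rewrite !sum_O. apply H; lia.
  - rewrite !sum_Sn. apply Rplus_le_compat; [apply IH; intros |]; apply H; lia.
Qed.

Lemma sum_n_lincomb (x y : nat -> R) (a b : R) (N : nat) :
  sum_n (fun n => a * x n + b * y n) N = a * sum_n x N + b * sum_n y N.
Proof.
  induction N as [|N IH].
  - rewrite !sum_O. reflexivity.
  - rewrite !sum_Sn, IH. unfold plus; simpl. ring.
Qed.

Lemma sum_n_le_series (x : nat -> R) (l : R) (N : nat) :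
  (forall n, 0 <= x n) -> is_series x l -> sum_n x N <= l.
Proof.
  intros Hx HS.
  apply (filterlim_le_R (F := eventually) (fun _ => sum_n x N) (sum_n x)); [| apply filterlim_const | exact HS].
  exists N. intros n Hn. induction Hn as [|n Hn IH]; [lra|].
  rewrite sum_Sn. unfold plus; simpl. specialize (Hx (S n)). lra.
Qed.

Lemma damp_sq_le (b alpha l f : R) : 0 < alpha -> (damp b alpha l * f) ^ 2 <= f ^ 2.
Proof.
  intros Ha. rewrite Rpow_mult_distr.
  pose proof (damp_bounds b alpha l Ha) as Hd.
  assert (Hd2 : damp b alpha l ^ 2 <= 1) by nra.
  apply (Rmult_le_compat_r _ _ _ (pow2_ge_0 f)) in Hd2. lra.
Qed.

Lemma damped_ex_series (b alpha : R) (lam f : nat -> R) :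
  0 < alpha -> ex_series (fun n => f n ^ 2) ->
  ex_series (fun n => (damp b alpha (lam n) * f n) ^ 2).
Proof.
  intros Ha Hf. apply (ex_series_le (V := R_CompleteNormedModule) _ (fun n => f n ^ 2)); auto.
  intros n. change (Rabs ((damp b alpha (lam n) * f n) ^ 2) <= f n ^ 2).
  rewrite Rabs_pos_eq by apply pow2_ge_0. apply damp_sq_le; auto.
Qed.

Lemma damp_incr (b alpha beta l : R) :
  0 < alpha < beta -> damp b alpha l < damp b beta l.
Proof.
  intros H. unfold damp. assert (Hq : 0 < Rpower l b) by apply exp_pos.
  set (q := Rpower l b) in *.
  assert (0 < alpha * q) by (apply Rmult_lt_0_compat; lra).
  assert (alpha * q < beta * q) by (apply Rmult_lt_compat_r; lra).
  enough (0 < beta * q / (1 + beta * q) - alpha * q / (1 + alpha * q)) by lra.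
  replace (beta * q / (1 + beta * q) - alpha * q / (1 + alpha * q))
    with ((beta * q - alpha * q) / ((1 + beta * q) * (1 + alpha * q))) by (field; lra).
  apply Rdiv_lt_0_compat. lra. apply Rmult_lt_0_compat; lra.
Qed.

(** No term decreases, and the one at [k] increases strictly; the series of differences is compared
    with the series having that single term. *)
Lemma damped_series_incr (b alpha beta : R) (lam f : nat -> R) (k : nat) :
  0 < alpha < beta -> ex_series (fun n => f n ^ 2) -> f k <> 0 ->
  Series (fun n => (damp b alpha (lam n) * f n) ^ 2) < Series (fun n => (damp b beta (lam n) * f n) ^ 2).
Proof.
  intros H Hf Hk.
  pose proof (damped_ex_series b alpha lam f ltac:(lra) Hf) as E1.
  pose proof (damped_ex_series b beta lam f ltac:(lra) Hf) as E2.
  set (d := fun n => (damp b beta (lam n) * f n) ^ 2 - (damp b alpha (lam n) * f n) ^ 2).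
  assert (Hdn : forall n, exists c, 0 < c /\ d n = c * f n ^ 2).
  { intros n. pose proof (damp_bounds b alpha (lam n) ltac:(lra)). pose proof (damp_incr b alpha beta (lam n) H).
    exists (damp b beta (lam n) ^ 2 - damp b alpha (lam n) ^ 2). split; [nra | unfold d; ring]. }
  assert (Hd : forall n, 0 <= d n).
  { intros n. destruct (Hdn n) as (c & Hc & ->). pose proof (pow2_ge_0 (f n)). apply Rmult_le_pos; lra. }
  assert (Hdk : 0 < d k).
  { destruct (Hdn k) as (c & Hc & ->). apply Rmult_lt_0_compat; auto. apply pow2_gt_0; auto. }
  enough (0 < Series d) by (unfold d in *; rewrite Series_minus in H0; auto; lra).
  apply Rlt_le_trans with (d k); auto.
  assert (Hs : is_series (fun n => if Nat.eqb n k then d k else 0) (d k)).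
  { apply (series_single k). rewrite Nat.eqb_refl; auto.
    intros n Hn. apply Nat.eqb_neq in Hn. rewrite Hn; auto. }
  rewrite <- (is_series_unique _ _ Hs). apply Series_le.
  - intros n. destruct (Nat.eqb_spec n k) as [->|]; split; auto; lra.
  - unfold d. apply (ex_series_minus (V := R_NormedModule)); auto.
Qed.

(** The parametrisation by [exp s] lets the intermediate value theorem run on the whole line. It
    also makes continuity uniform in [n]: whatever the eigenvalue, the damping factor changes by at
    most [|exp (x - s) - 1|]. *)
Lemma damped_series_continuity (b : R) (lam f : nat -> R) :
  ex_series (fun n => f n ^ 2) ->
  continuity (fun s => Series (fun n => (damp b (exp s) (lam n) * f n) ^ 2)).
Proof.
  intros Hf s e He.
  assert (HF : 0 <= Series (fun n => f n ^ 2)).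
  { apply Rle_trans with (sum_n (fun n => f n ^ 2) 0).
    rewrite sum_O. apply pow2_ge_0.
    apply sum_n_le_series; [intros; apply pow2_ge_0 | apply Series_correct, Hf]. }
  set (F := Series (fun n => f n ^ 2)) in *.
  (* In [2 * F + 1] the [2] bounds the sum of two damping factors, and the [1] keeps the divisor
     positive when [F = 0]. *)
  destruct (derivable_continuous_pt exp 0 (derivable_pt_exp 0) (e / (2 * F + 1))) as (d & Hd & Hd').
  { apply Rdiv_lt_0_compat; lra. }
  simpl in Hd'. unfold Rdist in Hd'.
  exists d. split; auto.
  enough (HH : forall x : R, Rabs (x - s) < d ->
    Rabs (Series (fun n => (damp b (exp x) (lam n) * f n) ^ 2) - Series (fun n => (damp b (exp s) (lam n) * f n) ^ 2)) < e)
    by (intros x [_ Hx]; exact (HH x Hx)).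
  intros x Hx.
  set (c := Rabs (exp (x - s) - 1)).
  assert (Hc : c < e / (2 * F + 1)).
  { destruct (Req_dec x s) as [->|Hne].
    - unfold c. rewrite Rminus_diag, exp_0, Rminus_diag, Rabs_R0. apply Rdiv_lt_0_compat; lra.
    - replace c with (Rabs (exp (x - s) - exp 0)) by (rewrite exp_0; reflexivity). apply Hd'. split.
      + split; [exact I|]. intros E. apply Hne. lra.
      + rewrite Rminus_0_r. exact Hx. }
  assert (Hb : forall n, Rabs ((damp b (exp x) (lam n) * f n) ^ 2 - (damp b (exp s) (lam n) * f n) ^ 2) <= 2 * c * f n ^ 2).
  { intros n. pose proof (damp_bounds b _ (lam n) (exp_pos x)) as B1. pose proof (damp_bounds b _ (lam n) (exp_pos s)) as B2.
    assert (B3 : Rabs (damp b (exp x) (lam n) - damp b (exp s) (lam n)) <= c).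
    { unfold damp. set (q := Rpower (lam n) b). assert (Hq : 0 < q) by apply exp_pos.
      assert (Ex : exp x = exp (x - s) * exp s) by (rewrite <- exp_plus; f_equal; ring).
      assert (0 < exp s * q) by (apply Rmult_lt_0_compat; auto; apply exp_pos).
      assert (0 < exp x * q) by (apply Rmult_lt_0_compat; auto; apply exp_pos).
      replace (exp x * q / (1 + exp x * q) - exp s * q / (1 + exp s * q))
        with ((exp x - exp s) * q / ((1 + exp x * q) * (1 + exp s * q))) by (field; lra).
      replace ((exp x - exp s) * q) with ((exp (x - s) - 1) * (exp s * q)) by (rewrite Ex; ring).
      unfold Rdiv. rewrite !Rabs_mult. fold c. rewrite Rmult_assoc. rewrite <- (Rmult_1_r c) at 2.
      apply Rmult_le_compat_l; [apply Rabs_pos|].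
      rewrite Rabs_inv, !Rabs_pos_eq by nra.
      apply Rmult_le_reg_r with ((1 + exp x * q) * (1 + exp s * q)); [nra|].
      rewrite Rmult_assoc, Rinv_l by nra. nra. }
    replace ((damp b (exp x) (lam n) * f n) ^ 2 - (damp b (exp s) (lam n) * f n) ^ 2)
      with ((damp b (exp x) (lam n) - damp b (exp s) (lam n)) * ((damp b (exp x) (lam n) + damp b (exp s) (lam n)) * f n ^ 2)) by ring.
    rewrite Rabs_mult. pose proof (pow2_ge_0 (f n)) as Hf2.
    rewrite (Rabs_pos_eq (_ * f n ^ 2)) by (apply Rmult_le_pos; lra).
    replace (2 * c * f n ^ 2) with (c * (2 * f n ^ 2)) by ring.
    apply Rmult_le_compat; auto. apply Rabs_pos. apply Rmult_le_pos; lra.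
    apply Rmult_le_compat_r; lra. }
  rewrite <- Series_minus by (apply damped_ex_series; auto; apply exp_pos).
  assert (Hsc : ex_series (fun n => 2 * c * f n ^ 2)) by (apply (ex_series_scal_l (K := R_AbsRing) (2 * c) (fun n => f n ^ 2)); auto).
  assert (Hab : ex_series (fun n => Rabs ((damp b (exp x) (lam n) * f n) ^ 2 - (damp b (exp s) (lam n) * f n) ^ 2))).
  { apply (ex_series_le (V := R_CompleteNormedModule) _ (fun n => 2 * c * f n ^ 2)); auto.
    intros n. change (Rabs (Rabs ((damp b (exp x) (lam n) * f n) ^ 2 - (damp b (exp s) (lam n) * f n) ^ 2)) <= 2 * c * f n ^ 2).
    rewrite Rabs_Rabsolu. apply Hb. }
  eapply Rle_lt_trans; [apply Series_Rabs; exact Hab|].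
  eapply Rle_lt_trans; [apply (Series_le _ (fun n => 2 * c * f n ^ 2)); auto; intros n; split; [apply Rabs_pos | apply Hb]|].
  rewrite Series_scal_l. fold F.
  assert (0 <= c) by apply Rabs_pos.
  apply (Rmult_lt_compat_r (2 * F + 1)) in Hc; [| lra].
  replace (e / (2 * F + 1) * (2 * F + 1)) with e in Hc by (field; lra). nra.
Qed.

Lemma damp_incr_r (b alpha l l' : R) :
  0 < alpha -> 0 <= b -> 0 < l <= l' -> damp b alpha l <= damp b alpha l'.
Proof.
  intros Ha Hb Hl. unfold damp.
  assert (Hq : 0 < Rpower l b) by apply exp_pos. assert (Hqq : Rpower l b <= Rpower l' b) by (apply Rle_Rpower_l; lra).
  set (q := Rpower l b) in *. set (q' := Rpower l' b) in *.
  assert (0 < alpha * q) by (apply Rmult_lt_0_compat; lra).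
  assert (alpha * q <= alpha * q') by (apply Rmult_le_compat_l; lra).
  enough (0 <= alpha * q' / (1 + alpha * q') - alpha * q / (1 + alpha * q)) by lra.
  replace (alpha * q' / (1 + alpha * q') - alpha * q / (1 + alpha * q))
    with ((alpha * q' - alpha * q) / ((1 + alpha * q') * (1 + alpha * q))) by (field; lra).
  apply Rmult_le_pos. lra. left. apply Rinv_0_lt_compat, Rmult_lt_0_compat; lra.
Qed.

Lemma damp_le (b alpha l : R) : 0 < alpha -> damp b alpha l <= alpha * Rpower l b.
Proof.
  intros Ha. unfold damp. assert (Hq : 0 < Rpower l b) by apply exp_pos.
  assert (H : 0 < alpha * Rpower l b) by (apply Rmult_lt_0_compat; lra).
  unfold Rdiv. rewrite <- (Rmult_1_r (alpha * Rpower l b)) at 3. apply Rmult_le_compat_l; [lra|].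
  rewrite <- Rinv_1. apply Rinv_le_contravar; lra.
Qed.

(** Every damping factor is at least that of the lowest frequency, [t]. The chosen [alpha] gives
    [1 - t <= (F - E) / (2 F)], hence [t^2 >= 1 - 2 (1 - t) >= E / F]. *)
Lemma damped_series_large (b F E : R) (lam f : nat -> R) :
  0 <= b -> 0 < lam 0%nat -> (forall n, lam 0%nat <= lam n) ->
  is_series (fun n => f n ^ 2) F -> 0 < E < F ->
  exists alpha, 0 < alpha /\ E <= Series (fun n => (damp b alpha (lam n) * f n) ^ 2).
Proof.
  intros Hb H0 Hlam Hf HE.
  set (q := Rpower (lam 0%nat) b). assert (Hq : 0 < q) by apply exp_pos.
  set (alpha := 2 * F / ((F - E) * q)).
  assert (Ha : 0 < alpha) by (apply Rdiv_lt_0_compat; [lra | apply Rmult_lt_0_compat; lra]).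
  exists alpha. split; auto.
  set (t := damp b alpha (lam 0%nat)).
  pose proof (damp_bounds b alpha (lam 0%nat) Ha) as Ht. fold t in Ht.
  assert (HtE : E <= t ^ 2 * F).
  { assert (Haq : alpha * q * (F - E) = 2 * F) by (unfold alpha; field; lra).
    assert (H1 : (1 - t) * (1 + alpha * q) = 1).
    { unfold t, damp. fold q. assert (0 < alpha * q) by (apply Rmult_lt_0_compat; lra). field. lra. }
    assert (Haq0 : 0 < alpha * q) by (apply Rmult_lt_0_compat; lra).
    assert (H2 : (1 - t) * (alpha * q) <= 1) by nra.
    assert (H3 : (1 - t) * (alpha * q * (F - E)) <= 1 * (F - E)).
    { rewrite <- Rmult_assoc. apply Rmult_le_compat_r; lra. }
    rewrite Haq in H3. nra. }
  eapply Rle_trans; [exact HtE|].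
  rewrite <- (is_series_unique _ _ Hf), <- Series_scal_l.
  apply Series_le; [| apply damped_ex_series; auto; exists F; auto].
  intros n. pose proof (pow2_ge_0 (f n)). rewrite Rpow_mult_distr.
  pose proof (damp_incr_r b alpha (lam 0%nat) (lam n) Ha Hb (conj H0 (Hlam n))) as HI. fold t in HI.
  split. apply Rmult_le_pos; [apply pow2_ge_0 | auto].
  apply Rmult_le_compat_r; auto. apply pow_incr; lra.
Qed.

Lemma damped_series_small (b F E : R) (lam f : nat -> R) :
  0 <= b -> 0 < lam 0%nat -> (forall n, lam n < lam (S n)) ->
  is_series (fun n => f n ^ 2) F -> 0 < E < F ->
  exists alpha, 0 < alpha /\ Series (fun n => (damp b alpha (lam n) * f n) ^ 2) <= E.
Proof.
  intros Hb H0 Hlam Hf HE.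
  assert (Hex : ex_series (fun n => f n ^ 2)) by (exists F; auto).
  assert (Hmon : forall n m, (n <= m)%nat -> lam n <= lam m).
  { intros n m Hnm. induction Hnm. lra. specialize (Hlam m). lra. }
  assert (HE2 : 0 < E / 2) by lra.
  (* Beyond [N] even the undamped tail is at most [E / 2]. Up to [N] the damping factor is at most
     [alpha q = E / (E + 2 F)], which again leaves at most [E / 2]. *)
  destruct (Hf (fun y => F - E / 2 < y)) as [N HN].
  { exists (mkposreal _ HE2). intros y Hy.
    apply ball_R in Hy; simpl in Hy.
    apply Rabs_def2 in Hy. lra. }
  specialize (HN N (Nat.le_refl N)).
  set (q := Rpower (lam N) b). assert (Hq : 0 < q) by apply exp_pos.
  set (alpha := E / (E + 2 * F) / q).
  assert (Ht : 0 < E / (E + 2 * F)) by (apply Rdiv_lt_0_compat; lra).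
  assert (Ha : 0 < alpha) by (apply Rdiv_lt_0_compat; auto).
  assert (Haq : alpha * q * (E + 2 * F) = E) by (unfold alpha; field; lra).
  exists alpha. split; auto.
  pose proof (damped_ex_series b alpha lam f Ha Hex) as HD.
  rewrite (Series_incr_n _ (S N)) by (auto; lia). change (pred (S N)) with N.
  assert (ET := Series_incr_n _ (S N) (Nat.lt_0_succ N) Hex). change (pred (S N)) with N in ET.
  rewrite (is_series_unique _ _ Hf) in ET. rewrite <- sum_n_Reals in ET.
  assert (Htail : Series (fun k => f (S N + k)%nat ^ 2) <= E / 2).
  { change (F - E / 2 < @sum_n R_AbelianMonoid (fun n => f n ^ 2) N) in HN.
    change (F = @sum_n R_AbelianMonoid (fun n => f n ^ 2) N + Series (fun k => f (S N + k)%nat ^ 2)) in ET.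
    lra. }
  assert (T1 : Series (fun k => (damp b alpha (lam (S N + k)%nat) * f (S N + k)%nat) ^ 2) <= E / 2).
  { apply Rle_trans with (Series (fun k => f (S N + k)%nat ^ 2)); [| exact Htail].
    apply Series_le; [| apply (ex_series_incr_n (V := R_NormedModule) (fun n => f n ^ 2) (S N)); auto].
    intros k. split; [apply pow2_ge_0 | apply damp_sq_le; auto]. }
  assert (T2 : sum_n (fun n => (damp b alpha (lam n) * f n) ^ 2) N <= alpha * q * F).
  { apply Rle_trans with (sum_n (fun n => alpha * q * f n ^ 2 + 0 * 0) N).
    - apply sum_n_le. intros n Hn. rewrite Rpow_mult_distr.
      pose proof (damp_bounds b alpha (lam n) Ha). pose proof (pow2_ge_0 (f n)).
      assert (HdN : damp b alpha (lam n) <= alpha * q).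
      { eapply Rle_trans; [apply damp_le; auto|]. apply Rmult_le_compat_l; [lra|].
        apply Rle_Rpower_l; auto. split; [| apply Hmon; auto].
        pose proof (Hmon 0%nat n ltac:(lia)). lra. }
      rewrite Rmult_0_r, Rplus_0_r. apply Rmult_le_compat_r; [assumption|].
      assert (damp b alpha (lam n) ^ 2 <= damp b alpha (lam n)) by nra. lra.
    - rewrite sum_n_lincomb, Rmult_0_l, Rplus_0_r. apply Rmult_le_compat_l.
      left; apply Rmult_lt_0_compat; auto.
      apply sum_n_le_series; auto. intros; apply pow2_ge_0. }
  assert (alpha * q * F <= E / 2).
  { assert (0 < alpha * q * E) by (apply Rmult_lt_0_compat; [apply Rmult_lt_0_compat; auto | lra]).
    lra. }
  rewrite <- sum_n_Reals. lra.
Qed.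

Lemma discrepancy_exists (b F E : R) (lam f : nat -> R) :
  0 <= b -> 0 < lam 0%nat -> (forall n, lam n < lam (S n)) ->
  is_series (fun n => f n ^ 2) F -> 0 < E < F ->
  exists alpha, 0 < alpha /\ Series (fun n => (damp b alpha (lam n) * f n) ^ 2) = E.
Proof.
  intros Hb H0 Hlam Hf HE.
  destruct (damped_series_small b F E lam f Hb H0 Hlam Hf HE) as (a0 & Ha0 & HE0).
  destruct (damped_series_large b F E lam f Hb H0) as (a1 & Ha1 & HE1); auto.
  { intros n. induction n as [|n IH]. lra. specialize (Hlam n). lra. }
  set (G := fun s => Series (fun n => (damp b (exp s) (lam n) * f n) ^ 2)).
  destruct (IVT_gen G (ln a0) (ln a1) E) as (s & _ & Hs).
  - apply damped_series_continuity. exists F; auto.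
  - unfold G. rewrite !exp_ln by auto. split.
    + eapply Rle_trans; [apply Rmin_l | exact HE0].
    + eapply Rle_trans; [exact HE1 | apply Rmax_r].
  - exists (exp s). split; [apply exp_pos | exact Hs].
Qed.

(** * Estimates on the coefficients *)

(** Bounding partial sums expresses an estimate of the squared norm without a convergence proof for
    each intermediate sequence; [series_le_l2] returns to actual sums at the end. *)
Definition l2_le (x : nat -> R) (c : R) : Prop := forall N, sum_n (fun n => x n ^ 2) N <= c.

Lemma l2_le_weaken (x : nat -> R) (c c' : R) : c <= c' -> l2_le x c -> l2_le x c'.
Proof. intros Hc Hx N. specialize (Hx N). lra. Qed.

Lemma l2_le_comb (x y z : nat -> R) (A B cy cz : R) :
  0 <= A -> 0 <= B -> (forall n, x n ^ 2 <= A * y n ^ 2 + B * z n ^ 2) ->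
  l2_le y cy -> l2_le z cz -> l2_le x (A * cy + B * cz).
Proof.
  intros HA HB H Hy Hz N.
  apply Rle_trans with (sum_n (fun n => A * y n ^ 2 + B * z n ^ 2) N).
  - apply sum_n_le. auto.
  - rewrite sum_n_lincomb. apply Rplus_le_compat; apply Rmult_le_compat_l; auto.
Qed.

Lemma l2_le_dom (x y : nat -> R) (A c : R) :
  0 <= A -> (forall n, x n ^ 2 <= A * y n ^ 2) -> l2_le y c -> l2_le x (A * c).
Proof.
  intros HA H Hy. replace (A * c) with (A * c + 0 * c) by ring.
  apply (l2_le_comb x y y); auto; try lra. intros n. specialize (H n). lra.
Qed.

Lemma l2_le_of_series (x : nat -> R) (c : R) : is_series (fun n => x n ^ 2) c -> l2_le x c.
Proof. intros H N. apply sum_n_le_series; auto. intros; apply pow2_ge_0. Qed.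

Lemma series_le_l2 (x : nat -> R) (s c : R) : is_series (fun n => x n ^ 2) s -> l2_le x c -> s <= c.
Proof.
  intros Hs Hc.
  apply (filterlim_le_R (F := eventually) (sum_n (fun n => x n ^ 2)) (fun _ => c)); [| exact Hs | apply filterlim_const].
  exists 0%nat. intros n _. apply Hc.
Qed.

(** * Scalar inequalities for the multipliers *)

Lemma sq_le_of_abs (x y : R) : Rabs x <= y -> x ^ 2 <= y ^ 2.
Proof. intros H. apply Rabs_le_between in H. nra. Qed.

Lemma sq_add_le (x y : R) : (x + y) ^ 2 <= 2 * x ^ 2 + 2 * y ^ 2.
Proof. pose proof (pow2_ge_0 (x - y)). nra. Qed.

Lemma sq_le_reg (x y : R) : 0 <= y -> x ^ 2 <= y ^ 2 -> x <= y.
Proof. intros Hy H. apply Rnot_lt_le. intros Hc. nra. Qed.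

Lemma Rpower_1_base (x : R) : Rpower 1 x = 1.
Proof. unfold Rpower. rewrite ln_1, Rmult_0_r. apply exp_0. Qed.

Lemma Rpower_inv_base (x y : R) : 0 < x -> Rpower (/ x) y = Rpower x (- y).
Proof. intros Hx. unfold Rpower. rewrite ln_Rinv by auto. f_equal. ring. Qed.

(** The first summand suffices for [l <= L] and the second for [l > L]. Summed over the spectrum,
    this is the interpolation inequality with cut-off frequency [L]. *)
Lemma interpolation_split (p L l y : R) :
  0 < p -> 0 < L -> 0 < l -> y ^ 2 <= L ^ 2 * (y / l) ^ 2 + Rpower L (- p) ^ 2 * (Rpower l p * y) ^ 2.
Proof.
  intros Hp HL Hl.
  destruct (Rle_lt_dec l L) as [H|H].
  - assert (E : y ^ 2 <= L ^ 2 * (y / l) ^ 2).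
    { replace (y ^ 2) with (l ^ 2 * (y / l) ^ 2) by (field; lra).
      apply Rmult_le_compat_r; [apply pow2_ge_0 |]. apply pow_incr; lra. }
    assert (0 <= Rpower L (- p) ^ 2 * (Rpower l p * y) ^ 2) by (apply Rmult_le_pos; apply pow2_ge_0).
    lra.
  - assert (E : y ^ 2 <= Rpower L (- p) ^ 2 * (Rpower l p * y) ^ 2).
    { replace (Rpower L (- p) ^ 2 * (Rpower l p * y) ^ 2) with ((Rpower L (- p) * Rpower l p) ^ 2 * y ^ 2) by ring.
      rewrite <- (Rmult_1_l (y ^ 2)) at 1. apply Rmult_le_compat_r; [apply pow2_ge_0 |].
      assert (1 <= Rpower L (- p) * Rpower l p).
      { rewrite Rpower_Ropp. assert (0 < Rpower L p) by apply exp_pos.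
        assert (Rpower L p <= Rpower l p) by (apply Rle_Rpower_l; lra).
        apply Rmult_le_reg_l with (Rpower L p); auto.
        rewrite <- Rmult_assoc, Rinv_r by lra. lra. }
      rewrite <- (pow1 2). apply pow_incr. lra. }
    assert (0 <= L ^ 2 * (y / l) ^ 2) by (apply Rmult_le_pos; apply pow2_ge_0).
    lra.
Qed.

(* [lam_n / (1 + alpha lam_n^b)], the eigenvalues of [A_alpha]. *)
Definition reg_eig (b alpha l : R) : R := l / (1 + alpha * Rpower l b).

Lemma reg_eig_pos (b alpha l : R) : 0 < alpha -> 0 < l -> 0 < reg_eig b alpha l <= l.
Proof.
  intros Ha Hl. unfold reg_eig. assert (0 < alpha * Rpower l b) by (apply Rmult_lt_0_compat; [auto | apply exp_pos]).
  split. apply Rdiv_lt_0_compat; lra.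
  apply Rmult_le_reg_r with (1 + alpha * Rpower l b); [lra|].
  unfold Rdiv. rewrite Rmult_assoc, Rinv_l by lra. nra.
Qed.

(** With [t = alpha^(1/b) l] the claim becomes [t <= 1 + t^b]. *)
Lemma reg_eig_le (b alpha l : R) :
  1 < b -> 0 < alpha -> 0 < l -> reg_eig b alpha l <= Rpower alpha (- (1 / b)).
Proof.
  intros Hb Ha Hl. unfold reg_eig.
  set (s := Rpower alpha (1 / b)). assert (Hs : 0 < s) by apply exp_pos.
  assert (Hst : alpha * Rpower l b = Rpower (s * l) b).
  { rewrite <- Rpower_mult_distr by auto. f_equal. unfold s. rewrite Rpower_mult.
    replace (1 / b * b) with 1 by (field; lra). symmetry; apply Rpower_1; auto. }
  rewrite Hst, Rpower_Ropp. fold s.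
  assert (Ht : 0 < s * l) by (apply Rmult_lt_0_compat; auto).
  assert (Hp : 0 < Rpower (s * l) b) by apply exp_pos.
  assert (H1 : s * l <= 1 + Rpower (s * l) b).
  { destruct (Rle_lt_dec (s * l) 1); [lra|].
    assert (Rpower (s * l) 1 <= Rpower (s * l) b) by (apply Rle_Rpower; lra).
    rewrite Rpower_1 in H by auto. lra. }
  apply Rmult_le_reg_l with (s * (1 + Rpower (s * l) b)).
  - apply Rmult_lt_0_compat; lra.
  - field_simplify; lra.
Qed.

(** With [x = alpha l^b] the claim is [x / (1 + x) <= x^th]. It fails for small [x] once [th > 1],
    which is the saturation separating the two cases of the theorem. *)
Lemma damp_le_Rpower (b alpha l th : R) :
  0 < alpha -> 0 < l -> 0 < th <= 1 -> damp b alpha l <= Rpower alpha th * Rpower l (th * b).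
Proof.
  intros Ha Hl Hth.
  rewrite (Rmult_comm th b), <- Rpower_mult, Rpower_mult_distr by (auto; apply exp_pos).
  unfold damp. set (x := alpha * Rpower l b).
  assert (Hx : 0 < x) by (apply Rmult_lt_0_compat; [auto | apply exp_pos]).
  assert (Hp : 0 < Rpower x th) by apply exp_pos.
  apply Rmult_le_reg_r with (1 + x); [lra|].
  unfold Rdiv. rewrite Rmult_assoc, Rinv_l, Rmult_1_r by lra.
  destruct (Rle_lt_dec x 1).
  - assert (x <= Rpower x th).
    { replace th with (1 + - (1 - th)) by ring. rewrite Rpower_plus, Rpower_1, Rpower_Ropp by auto.
      assert (Rpower x (1 - th) <= 1).
      { destruct (Req_dec th 1) as [->|]. rewrite Rminus_diag, Rpower_O; lra.
        apply Rle_trans with (Rpower 1 (1 - th)); [apply Rle_Rpower_l; lra | rewrite Rpower_1_base; lra]. }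
      rewrite <- (Rmult_1_r x) at 1. apply Rmult_le_compat_l; [lra|].
      apply Rle_trans with (/ 1); [lra |]. apply Rinv_le_contravar; auto. apply exp_pos. }
    nra.
  - assert (1 <= Rpower x th).
    { rewrite <- (Rpower_1_base th). apply Rle_Rpower_l; lra. }
    nra.
Qed.

(* Coefficients with respect to [phi_n]: [a] of [u(0)], [w] of [u(T)], [f] of the
   data, [e] of [u(0) - v(0)]; [M] bounds [||u(0)||_p]. *)
Record backward_data (lam f a w e : nat -> R) (b p tau K eps alpha M : R) : Prop := {
  bd_lam0 : 0 < lam 0%nat;
  bd_lam : forall n, lam 0%nat <= lam n;
  bd_b : 1 < b;
  bd_p : 0 < p;
  bd_tau : 1 < tau;
  bd_K : 0 < K;
  bd_eps : 0 < eps;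
  bd_alpha : 0 < alpha;
  bd_M : 0 <= M;
  bd_upper : forall n, lam n * Rabs (w n) <= K * Rabs (a n);
  bd_lower : forall n, Rabs (a n) <= K * (lam n * Rabs (w n));
  bd_err : forall n, Rabs (e n) <=
    K * (damp b alpha (lam n) * Rabs (a n) + (1 + reg_eig b alpha (lam n)) * Rabs (w n - f n));
  bd_noise : l2_le (fun n => w n - f n) (eps ^ 2);
  bd_disc : is_series (fun n => (damp b alpha (lam n) * f n) ^ 2) ((tau * eps) ^ 2);
  bd_smooth : l2_le (fun n => Rpower (lam n) p * a n) (M ^ 2)
}.

Arguments bd_lam0 {lam f a w e b p tau K eps alpha M} _.
Arguments bd_lam {lam f a w e b p tau K eps alpha M} _.
Arguments bd_b {lam f a w e b p tau K eps alpha M} _.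
Arguments bd_p {lam f a w e b p tau K eps alpha M} _.
Arguments bd_tau {lam f a w e b p tau K eps alpha M} _.
Arguments bd_K {lam f a w e b p tau K eps alpha M} _.
Arguments bd_eps {lam f a w e b p tau K eps alpha M} _.
Arguments bd_alpha {lam f a w e b p tau K eps alpha M} _.
Arguments bd_M {lam f a w e b p tau K eps alpha M} _.
Arguments bd_upper {lam f a w e b p tau K eps alpha M} _.
Arguments bd_lower {lam f a w e b p tau K eps alpha M} _.
Arguments bd_err {lam f a w e b p tau K eps alpha M} _.
Arguments bd_noise {lam f a w e b p tau K eps alpha M} _.
Arguments bd_disc {lam f a w e b p tau K eps alpha M} _.
Arguments bd_smooth {lam f a w e b p tau K eps alpha M} _.

Section BackwardData.
Context (lam f a w e : nat -> R) (b p tau K eps alpha M : R)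
  (D : backward_data lam f a w e b p tau K eps alpha M).

Lemma bd_lam_pos n : 0 < lam n.
Proof. pose proof (bd_lam D n). pose proof (bd_lam0 D). lra. Qed.

Lemma bd_terminal_smooth : l2_le (fun n => Rpower (lam n) (p + 1) * w n) (K ^ 2 * M ^ 2).
Proof.
  apply (l2_le_dom _ (fun n => Rpower (lam n) p * a n)); [apply pow2_ge_0 | | apply D].
  intros n. pose proof (bd_lam_pos n) as Hl.
  rewrite <- Rpow_mult_distr, <- (pow2_abs (K * _)). apply sq_le_of_abs.
  pose proof (bd_K D) as HK. pose proof (bd_upper D n) as HU.
  assert (HR : 0 < Rpower (lam n) p) by apply exp_pos.
  rewrite Rpower_plus, Rpower_1, !Rabs_mult, (Rabs_pos_eq K), (Rabs_pos_eq (Rpower _ _)), (Rabs_pos_eq (lam n)) by lra.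
  apply (Rmult_le_compat_l (Rpower (lam n) p)) in HU; lra.
Qed.

Lemma bd_damped_upper :
  l2_le (fun n => damp b alpha (lam n) * w n) ((2 * tau ^ 2 + 2) * eps ^ 2).
Proof.
  replace ((2 * tau ^ 2 + 2) * eps ^ 2) with (2 * (tau * eps) ^ 2 + 2 * eps ^ 2) by ring.
  apply (l2_le_comb _ (fun n => damp b alpha (lam n) * f n) (fun n => w n - f n)); try lra.
  - intros n.
    replace (damp b alpha (lam n) * w n) with (damp b alpha (lam n) * f n + damp b alpha (lam n) * (w n - f n)) by ring.
    eapply Rle_trans; [apply sq_add_le|]. apply Rplus_le_compat_l, Rmult_le_compat_l; [lra|].
    apply damp_sq_le. apply D.
  - apply l2_le_of_series, D.
  - apply D.
Qed.

(** The discrepancy [tau eps] exceeds the noise level [eps], so the damped exact [u(T)] retains norm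
    at least [(tau - 1) eps]. The form with an arbitrary upper bound [c] is meant for a [c]
    containing [alpha], which then yields a lower bound for [alpha]. *)
Lemma bd_damped_lower (c : R) :
  l2_le (fun n => damp b alpha (lam n) * w n) c -> (tau - 1) ^ 2 * eps ^ 2 <= c.
Proof.
  intros Hc.
  pose proof (bd_tau D) as Ht.
  assert (Hr : 0 < tau / (tau - 1)) by (apply Rdiv_lt_0_compat; lra).
  assert (HL : l2_le (fun n => damp b alpha (lam n) * f n) (tau * eps ^ 2 + tau / (tau - 1) * c)).
  { apply (l2_le_comb _ (fun n => w n - f n) (fun n => damp b alpha (lam n) * w n)); auto; try lra; [| apply D].
    intros n. set (m := damp b alpha (lam n)).
    assert (Hm : (m * (w n - f n)) ^ 2 <= (w n - f n) ^ 2) by (apply damp_sq_le, D).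
    apply Rle_trans with (tau * (m * (w n - f n)) ^ 2 + tau / (tau - 1) * (m * w n) ^ 2).
    2: { apply Rplus_le_compat_r, Rmult_le_compat_l; lra. }
    replace (m * f n) with (m * w n - m * (w n - f n)) by ring.
    set (x := m * w n). set (y := m * (w n - f n)).
    (* [(x - y)^2 <= tau y^2 + tau/(tau-1) x^2], the difference being a square over [tau - 1]. *)
    enough (0 <= tau * y ^ 2 + tau / (tau - 1) * x ^ 2 - (x - y) ^ 2) by lra.
    replace (tau * y ^ 2 + tau / (tau - 1) * x ^ 2 - (x - y) ^ 2) with ((x + (tau - 1) * y) ^ 2 / (tau - 1)) by (field; lra).
    apply Rmult_le_pos; [apply pow2_ge_0 | left; apply Rinv_0_lt_compat; lra]. }
  pose proof (series_le_l2 _ _ _ (bd_disc D) HL) as E.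
  apply Rmult_le_reg_l with (tau / (tau - 1)); auto.
  replace (tau / (tau - 1) * ((tau - 1) ^ 2 * eps ^ 2)) with ((tau * eps) ^ 2 - tau * eps ^ 2) by (field; lra).
  lra.
Qed.

(** In [bd_damped_lower] the damping is estimated by [1] and [u(T)] by [A^(p+1) u(T)]. This forces
    [M > 0], and later absorbs the unamplified noise into the rate. *)
Lemma bd_eps_le : eps <= K / ((tau - 1) * Rpower (lam 0%nat) (p + 1)) * M.
Proof.
  pose proof (bd_tau D) as Ht. pose proof (bd_K D) as HK.
  pose proof (bd_M D) as HM. pose proof (bd_p D) as Hp.
  set (r := Rpower (lam 0%nat) (p + 1)). assert (Hr : 0 < r) by apply exp_pos.
  assert (HL := bd_damped_lower ((/ r) ^ 2 * (K ^ 2 * M ^ 2))).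
  assert (E : (tau - 1) ^ 2 * eps ^ 2 <= (/ r) ^ 2 * (K ^ 2 * M ^ 2)).
  { apply HL. apply (l2_le_dom _ (fun n => Rpower (lam n) (p + 1) * w n)); [apply pow2_ge_0 | | apply bd_terminal_smooth].
    intros n. eapply Rle_trans; [apply damp_sq_le, D|].
    replace ((/ r) ^ 2 * (Rpower (lam n) (p + 1) * w n) ^ 2) with ((/ r * Rpower (lam n) (p + 1)) ^ 2 * w n ^ 2) by ring.
    rewrite <- (Rmult_1_l (w n ^ 2)) at 1. apply Rmult_le_compat_r; [apply pow2_ge_0 |].
    rewrite <- (pow1 2) at 1. apply pow_incr. split; [lra|].
    apply Rmult_le_reg_l with r; auto. rewrite <- Rmult_assoc, Rinv_r, Rmult_1_r, Rmult_1_l by lra.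
    apply Rle_Rpower_l; [lra|]. split; apply D. }
  apply Rmult_le_reg_l with (tau - 1); [lra|].
  apply sq_le_reg.
  - apply Rmult_le_pos; [lra|]. apply Rmult_le_pos; auto. left; apply Rdiv_lt_0_compat; auto.
    apply Rmult_lt_0_compat; lra.
  - replace ((tau - 1) * (K / ((tau - 1) * r) * M)) with (/ r * (K * M)) by (field; lra).
    rewrite !Rpow_mult_distr. exact E.
Qed.

Lemma bd_M_pos : 0 < M.
Proof.
  pose proof bd_eps_le as E. pose proof (bd_eps D).
  destruct (bd_M D) as [|<-]; auto. lra.
Qed.

Lemma bd_err_split (c c' : R) :
  l2_le (fun n => damp b alpha (lam n) * a n) c ->
  l2_le (fun n => (1 + reg_eig b alpha (lam n)) * (w n - f n)) c' ->
  l2_le e (2 * K ^ 2 * c + 2 * K ^ 2 * c').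
Proof.
  intros Hc Hc'. pose proof (pow2_ge_0 K).
  refine (l2_le_comb e _ _ (2 * K ^ 2) (2 * K ^ 2) _ _ _ _ _ Hc Hc'); try lra.
  intros n.
  pose proof (bd_err D n) as HE. apply sq_le_of_abs in HE.
  pose proof (damp_bounds b alpha (lam n) (bd_alpha D)) as Hd.
  pose proof (reg_eig_pos b alpha (lam n) (bd_alpha D) (bd_lam_pos n)) as Hr.
  rewrite Rpow_mult_distr in HE.
  eapply Rle_trans; [exact HE|].
  rewrite !Rpow_mult_distr, <- !(pow2_abs (a n)), <- !(pow2_abs (w n - f n)), <- !Rpow_mult_distr.
  pose proof (sq_add_le (damp b alpha (lam n) * Rabs (a n)) ((1 + reg_eig b alpha (lam n)) * Rabs (w n - f n))) as HS.
  apply (Rmult_le_compat_l (K ^ 2)) in HS; auto. lra.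
Qed.

Lemma bd_noise_bound (nu : R) :
  (forall n, reg_eig b alpha (lam n) <= nu) ->
  l2_le (fun n => (1 + reg_eig b alpha (lam n)) * (w n - f n)) ((2 + 2 * nu ^ 2) * eps ^ 2).
Proof.
  intros Hnu. pose proof (pow2_ge_0 nu).
  apply (l2_le_dom _ (fun n => w n - f n)); [lra | | apply D].
  intros n. rewrite Rpow_mult_distr. apply Rmult_le_compat_r; [apply pow2_ge_0 |].
  pose proof (reg_eig_pos b alpha (lam n) (bd_alpha D) (bd_lam_pos n)) as Hr.
  specialize (Hnu n). pose proof (sq_add_le 1 nu).
  apply Rle_trans with ((1 + nu) ^ 2); [apply pow_incr |]; lra.
Qed.

(** Below [L], [|a n| <= K lam n |w n|] costs one factor [L] on the damped [u(T)], which is of size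
    [eps]; above [L] the smoothness [M] takes over. The condition on [L] balances the two parts. *)
Lemma bd_damped_initial (L : R) :
  0 < L -> Rpower L (- p) * M = L * eps ->
  l2_le (fun n => damp b alpha (lam n) * a n) ((K ^ 2 * (2 * tau ^ 2 + 2) + 1) * (L * eps) ^ 2).
Proof.
  intros HL HLM.
  replace ((K ^ 2 * (2 * tau ^ 2 + 2) + 1) * (L * eps) ^ 2)
    with (L ^ 2 * K ^ 2 * ((2 * tau ^ 2 + 2) * eps ^ 2) + Rpower L (- p) ^ 2 * M ^ 2)
    by (rewrite <- (Rpow_mult_distr (Rpower L (- p))), HLM; ring).
  apply (l2_le_comb _ (fun n => damp b alpha (lam n) * w n) (fun n => Rpower (lam n) p * a n)).
  - apply Rmult_le_pos; apply pow2_ge_0.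
  - apply pow2_ge_0.
  - intros n. pose proof (bd_lam_pos n) as Hl.
    eapply Rle_trans; [apply (interpolation_split p L (lam n)); auto; apply D|].
    apply Rplus_le_compat.
    + rewrite Rmult_assoc. apply Rmult_le_compat_l; [apply pow2_ge_0 |].
      replace (damp b alpha (lam n) * a n / lam n) with (damp b alpha (lam n) * (a n / lam n)) by (field; lra).
      replace (K ^ 2 * (damp b alpha (lam n) * w n) ^ 2) with (damp b alpha (lam n) ^ 2 * (K * w n) ^ 2) by ring.
      rewrite Rpow_mult_distr. apply Rmult_le_compat_l; [apply pow2_ge_0 |].
      rewrite <- (pow2_abs (K * w n)). apply sq_le_of_abs.
      unfold Rdiv. rewrite !Rabs_mult, Rabs_inv, (Rabs_pos_eq (lam n)), (Rabs_pos_eq K) by (try apply Rlt_le, D; lra).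
      apply Rmult_le_reg_r with (lam n); auto. rewrite Rmult_assoc, Rinv_l, Rmult_1_r by lra.
      pose proof (bd_lower D n). lra.
    + apply Rmult_le_compat_l; [apply pow2_ge_0 |].
      replace (Rpower (lam n) p * (damp b alpha (lam n) * a n)) with (damp b alpha (lam n) * (Rpower (lam n) p * a n)) by ring.
      apply damp_sq_le, D.
  - apply bd_damped_upper.
  - apply D.
Qed.

(** As [(p + 1) / b <= 1], the damping factor is at most [alpha^((p+1)/b) lam^(p+1)], and
    [||A^(p+1) u(T)||] is at most [K M]. *)
Lemma bd_alpha_lower_rough :
  p + 1 <= b -> (tau - 1) * eps <= Rpower alpha ((p + 1) / b) * (K * M).
Proof.
  intros Hpb. pose proof (bd_p D) as Hp. pose proof (bd_tau D) as Ht. pose proof (bd_K D) as HK.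
  pose proof (bd_M D) as HM. pose proof (bd_b D) as Hb.
  set (th := (p + 1) / b).
  assert (Hth : 0 < th <= 1).
  { unfold th. split. apply Rdiv_lt_0_compat; lra.
    apply Rmult_le_reg_r with b; [lra|]. unfold Rdiv. rewrite Rmult_assoc, Rinv_l by lra. lra. }
  assert (Hr : 0 < Rpower alpha th) by apply exp_pos.
  apply sq_le_reg.
  - apply Rmult_le_pos; [lra|]. apply Rmult_le_pos; lra.
  - rewrite !Rpow_mult_distr. apply bd_damped_lower.
    apply (l2_le_dom _ (fun n => Rpower (lam n) (p + 1) * w n)); [apply pow2_ge_0 | | apply bd_terminal_smooth].
    intros n. rewrite !Rpow_mult_distr, <- Rmult_assoc. apply Rmult_le_compat_r; [apply pow2_ge_0 |].
    rewrite <- Rpow_mult_distr. apply pow_incr.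
    pose proof (damp_bounds b alpha (lam n) (bd_alpha D)). split; [lra|].
    replace (p + 1) with (th * b) by (unfold th; field; lra).
    apply damp_le_Rpower; auto. apply D. apply bd_lam_pos.
Qed.

(* Splitting the frequencies at [Q], the low ones only see the fixed size of the data. *)
Lemma bd_alpha_lower_smooth (Q F : R) :
  b <= p + 1 -> 0 < Q -> l2_le w F -> Rpower Q b ^ 2 * F <= (Rpower Q (b - (p + 1)) * (K * M)) ^ 2 ->
  (tau - 1) * eps <= 2 * alpha * (Rpower Q (b - (p + 1)) * (K * M)).
Proof.
  intros Hpb HQ Hw HF. pose proof (bd_p D) as Hp. pose proof (bd_tau D) as Ht. pose proof (bd_K D) as HK.
  pose proof (bd_M D) as HM. pose proof (bd_b D) as Hb. pose proof (bd_alpha D) as Ha.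
  set (r := Rpower Q (b - (p + 1))) in *. assert (Hr : 0 < r) by apply exp_pos.
  assert (HKM : 0 <= K * M) by (apply Rmult_le_pos; lra).
  apply sq_le_reg.
  - apply Rmult_le_pos; [lra|]. apply Rmult_le_pos; lra.
  - apply Rle_trans with (alpha ^ 2 * Rpower Q b ^ 2 * F + alpha ^ 2 * r ^ 2 * (K ^ 2 * M ^ 2)).
    + rewrite Rpow_mult_distr. apply bd_damped_lower.
      apply (l2_le_comb _ w (fun n => Rpower (lam n) (p + 1) * w n)); auto;
        try (apply Rmult_le_pos; apply pow2_ge_0); [| apply bd_terminal_smooth].
      intros n. pose proof (bd_lam_pos n) as Hl.
      pose proof (damp_le b alpha (lam n) Ha) as Hd. pose proof (damp_bounds b alpha (lam n) Ha) as Hd'.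
      assert (E : (damp b alpha (lam n) * w n) ^ 2 <= alpha ^ 2 * (Rpower (lam n) b * w n) ^ 2).
      { rewrite !Rpow_mult_distr, <- Rmult_assoc. apply Rmult_le_compat_r; [apply pow2_ge_0 |].
        rewrite <- Rpow_mult_distr. apply pow_incr; lra. }
      eapply Rle_trans; [exact E|]. rewrite !Rmult_assoc, <- Rmult_plus_distr_l.
      apply Rmult_le_compat_l; [apply pow2_ge_0 |].
      rewrite <- !Rpow_mult_distr.
      destruct (Rle_lt_dec (lam n) Q) as [HlQ|HlQ].
      * assert ((Rpower (lam n) b * w n) ^ 2 <= (Rpower Q b * w n) ^ 2).
        { rewrite !Rpow_mult_distr. apply Rmult_le_compat_r; [apply pow2_ge_0 |].
          apply pow_incr. split; [left; apply exp_pos | apply Rle_Rpower_l; lra]. }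
        pose proof (pow2_ge_0 (r * (Rpower (lam n) (p + 1) * w n))). lra.
      (* Above [Q], [lam^b <= Q^(b-(p+1)) lam^(p+1)] because the exponent [b - (p + 1)] is
         nonpositive. *)
      * assert ((Rpower (lam n) b * w n) ^ 2 <= (r * (Rpower (lam n) (p + 1) * w n)) ^ 2).
        { rewrite <- Rmult_assoc, !(Rpow_mult_distr _ (w n)). apply Rmult_le_compat_r; [apply pow2_ge_0 |].
          apply pow_incr. split; [left; apply exp_pos|].
          replace b with (- (p + 1 - b) + (p + 1)) at 1 by ring. rewrite Rpower_plus.
          apply Rmult_le_compat_r; [left; apply exp_pos|].
          unfold r. replace (b - (p + 1)) with (- (p + 1 - b)) by ring. rewrite !Rpower_Ropp.
          apply Rinv_le_contravar; [apply exp_pos|]. apply Rle_Rpower_l; lra. }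
        pose proof (pow2_ge_0 (Rpower Q b * w n)). lra.
    + assert (0 <= alpha ^ 2) by apply pow2_ge_0.
      apply (Rmult_le_compat_l (alpha ^ 2)) in HF; auto.
      replace ((2 * alpha * (r * (K * M))) ^ 2) with (4 * (alpha ^ 2 * (r * (K * M)) ^ 2)) by ring.
      assert (0 <= alpha ^ 2 * (r * (K * M)) ^ 2) by (apply Rmult_le_pos; [lra | apply pow2_ge_0]).
      replace (alpha ^ 2 * r ^ 2 * (K ^ 2 * M ^ 2)) with (alpha ^ 2 * (r * (K * M)) ^ 2) by ring. lra.
Qed.

(** If [f] is as smooth as [u(T)], so is the noise, and [A (w - f)] is interpolated between [eps]
    and [M] at [L]. The multiplier is estimated by [1 + lam n], so the bound is independent of
    [alpha]. *)
Lemma bd_noise_smooth (L c : R) :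
  0 < L -> Rpower L (- p) * M = L * eps -> 0 <= c ->
  l2_le (fun n => Rpower (lam n) (p + 1) * f n) (c * M ^ 2) ->
  l2_le (fun n => (1 + reg_eig b alpha (lam n)) * (w n - f n))
    ((1 / lam 0%nat + 1) ^ 2 * (1 + 2 * K ^ 2 + 2 * c) * (L * eps) ^ 2).
Proof.
  intros HL HLM Hc Hf. pose proof (bd_lam0 D) as H0.
  assert (Hs : l2_le (fun n => Rpower (lam n) (p + 1) * (w n - f n)) (2 * (K ^ 2 * M ^ 2) + 2 * (c * M ^ 2))).
  { refine (l2_le_comb _ _ _ 2 2 _ _ _ _ _ bd_terminal_smooth Hf); try lra.
    intros n. cbv beta. set (r := Rpower (lam n) (p + 1)).
    replace (r * (w n - f n)) with (r * w n + - (r * f n)) by ring.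
    eapply Rle_trans; [apply sq_add_le|]. right; ring. }
  replace ((1 / lam 0%nat + 1) ^ 2 * (1 + 2 * K ^ 2 + 2 * c) * (L * eps) ^ 2)
    with ((1 / lam 0%nat + 1) ^ 2 * (L ^ 2 * eps ^ 2 + Rpower L (- p) ^ 2 * (2 * (K ^ 2 * M ^ 2) + 2 * (c * M ^ 2)))).
  2: { replace (L ^ 2 * eps ^ 2 + Rpower L (- p) ^ 2 * (2 * (K ^ 2 * M ^ 2) + 2 * (c * M ^ 2)))
        with ((L * eps) ^ 2 + (2 * K ^ 2 + 2 * c) * (Rpower L (- p) * M) ^ 2) by ring.
       rewrite HLM. ring. }
  apply (l2_le_dom _ (fun n => lam n * (w n - f n))); [apply pow2_ge_0 | |].
  - intros n. rewrite <- Rpow_mult_distr, <- Rmult_assoc, !(Rpow_mult_distr _ (w n - f n)).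
    apply Rmult_le_compat_r; [apply pow2_ge_0 |]. apply pow_incr.
    pose proof (reg_eig_pos b alpha (lam n) (bd_alpha D) (bd_lam_pos n)) as Hr. pose proof (bd_lam D n) as Hl.
    split; [lra|]. assert (1 <= 1 / lam 0%nat * lam n).
    { apply Rmult_le_reg_l with (lam 0%nat); auto.
      replace (lam 0%nat * (1 / lam 0%nat * lam n)) with (lam n) by (field; lra). lra. }
    lra.
  - apply (l2_le_comb _ (fun n => w n - f n) (fun n => Rpower (lam n) (p + 1) * (w n - f n))); auto; try apply pow2_ge_0; [| apply D].
    intros n. pose proof (bd_lam_pos n) as Hl.
    eapply Rle_trans; [apply (interpolation_split p L (lam n)); auto; apply D|].
    replace (lam n * (w n - f n) / lam n) with (w n - f n) by (field; lra).
    rewrite Rpower_plus, Rpower_1 by auto. right; ring.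
Qed.
End BackwardData.

(** [L] is the frequency at which noise and smoothness balance, and [L eps] is the rate of the
    theorem. With [b - 1] in place of [p], the second identity describes the last term of (ii). *)
Lemma Rpower_interpolation_scale (p eps M : R) :
  0 < p -> 0 < eps -> 0 < M ->
  let L := Rpower (M / eps) (1 / (p + 1)) in
  Rpower L (- p) * M = L * eps /\ L * eps = Rpower eps (p / (p + 1)) * Rpower M (1 / (p + 1)).
Proof.
  intros Hp He HM L.
  assert (HMe : 0 < M / eps) by (apply Rdiv_lt_0_compat; auto).
  assert (HL : 0 < L) by apply exp_pos.
  split.
  - assert (E : Rpower L (p + 1) = M / eps).
    { unfold L. rewrite Rpower_mult. replace (1 / (p + 1) * (p + 1)) with 1 by (field; lra). apply Rpower_1; auto. }
    replace M with (Rpower L (p + 1) * eps) at 1 by (rewrite E; field; lra).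
    rewrite <- Rmult_assoc, <- Rpower_plus. replace (- p + (p + 1)) with 1 by ring. rewrite Rpower_1; auto.
  - unfold L, Rdiv. rewrite <- Rpower_mult_distr, Rpower_inv_base by (auto; apply Rinv_0_lt_compat; auto).
    rewrite <- (Rpower_1 eps He) at 2. rewrite Rmult_assoc, <- Rpower_plus.
    rewrite Rmult_comm. f_equal. f_equal. field; lra.
Qed.

(** [f] is fixed while [w], [eps] and [M] vary. Any level [S] that finitely many terms of the sum of
    [(lam^q f)^2] reach is, for small [eps], attributable to [w], since on finitely many frequencies
    the noise is amplified by a bounded factor; hence [S <= 4 K^2 M^2]. If the series converges,
    half of its sum serves as the level; if it diverges, the level can exceed any prescribed [B]. *)
Lemma data_smoothness_dichotomy (lam f : nat -> R) (K q B : R) :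
  0 < lam 0%nat -> (forall n, lam n < lam (S n)) -> 0 <= q ->
  exists eps0, 0 < eps0 /\ forall eps M w,
    0 < eps < eps0 -> l2_le (fun n => w n - f n) (eps ^ 2) ->
    l2_le (fun n => Rpower (lam n) q * w n) (K ^ 2 * M ^ 2) ->
    l2_le (fun n => Rpower (lam n) q * f n) (8 * K ^ 2 * M ^ 2) \/ B <= 4 * K ^ 2 * M ^ 2.
Proof.
  intros H0 Hlam Hq.
  assert (Hmon : forall n m, (n <= m)%nat -> lam n <= lam m).
  { intros n m Hnm. induction Hnm. lra. specialize (Hlam m). lra. }
  set (g := fun n => Rpower (lam n) q * f n).
  assert (HS : forall S N, 0 < S -> S <= sum_n (fun n => g n ^ 2) N ->
    exists eps0, 0 < eps0 /\ forall eps M w,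
    0 < eps < eps0 -> l2_le (fun n => w n - f n) (eps ^ 2) ->
    l2_le (fun n => Rpower (lam n) q * w n) (K ^ 2 * M ^ 2) -> S <= 4 * K ^ 2 * M ^ 2).
  { intros S N HS HN. set (c := Rpower (lam N) q). assert (Hc : 0 < c) by apply exp_pos.
    assert (Hc2 : 0 < 4 * c ^ 2) by (pose proof (pow_lt c 2 Hc); lra).
    assert (HSc : 0 < S / (4 * c ^ 2)) by (apply Rdiv_lt_0_compat; auto).
    (* [eps < 1] gives [eps^2 <= eps], and the second bound then makes the noise part [2 c^2 eps^2]
       at most [S / 2]. *)
    exists (Rmin 1 (S / (4 * c ^ 2))). split; [apply Rmin_glb_lt; lra|].
    intros eps M w He Hd Hw.
    pose proof (Rmin_l 1 (S / (4 * c ^ 2))). pose proof (Rmin_r 1 (S / (4 * c ^ 2))).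
    assert (E1 : 4 * c ^ 2 * eps ^ 2 <= S).
    { apply Rle_trans with (4 * c ^ 2 * (S / (4 * c ^ 2))); [| right; field; lra].
      apply Rmult_le_compat_l; nra. }
    assert (E2 : sum_n (fun n => g n ^ 2) N <= 2 * (K ^ 2 * M ^ 2) + 2 * c ^ 2 * eps ^ 2).
    { apply Rle_trans with (sum_n (fun n => 2 * (Rpower (lam n) q * w n) ^ 2 + 2 * c ^ 2 * (w n - f n) ^ 2) N).
      - apply sum_n_le. intros n Hn. unfold g.
        replace (Rpower (lam n) q * f n) with (Rpower (lam n) q * w n + Rpower (lam n) q * - (w n - f n)) by ring.
        eapply Rle_trans; [apply sq_add_le|]. apply Rplus_le_compat_l. rewrite Rmult_assoc.
        apply Rmult_le_compat_l; [lra|]. replace (c ^ 2 * (w n - f n) ^ 2) with (c ^ 2 * (- (w n - f n)) ^ 2) by ring.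
        rewrite Rpow_mult_distr. apply Rmult_le_compat_r; [apply pow2_ge_0 |].
        apply pow_incr. split; [left; apply exp_pos|]. apply Rle_Rpower_l; auto.
        split; [| auto]. pose proof (Hmon 0%nat n ltac:(lia)). lra.
      - rewrite sum_n_lincomb. specialize (Hd N). specialize (Hw N).
        assert (0 <= 2 * c ^ 2) by lra.
        apply Rplus_le_compat; apply Rmult_le_compat_l; auto; lra. }
    change (S <= @sum_n R_AbelianMonoid (fun n => g n ^ 2) N) in HN.
    change (@sum_n R_AbelianMonoid (fun n => g n ^ 2) N <= 2 * (K ^ 2 * M ^ 2) + 2 * c ^ 2 * eps ^ 2) in E2.
    lra. }
  set (E := fun y => exists N, y = sum_n (fun n => g n ^ 2) N).
  destruct (classic (bound E)) as [Hb|Hb].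
  - destruct (completeness E Hb) as [S [Hub Hlub]].
    { exists (sum_n (fun n => g n ^ 2) 0), 0%nat. reflexivity. }
    assert (HgS : l2_le g S) by (intros N; apply Hub; exists N; reflexivity).
    destruct (Rle_lt_dec S 0) as [HS0|HS0].
    + exists 1. split; [lra|]. intros eps M w _ _ _. left.
      apply (l2_le_weaken g S); auto.
      assert (0 <= 8 * K ^ 2 * M ^ 2) by (apply Rmult_le_pos; [| apply pow2_ge_0]; pose proof (pow2_ge_0 K); lra).
      lra.
    + assert (HN : exists N, S / 2 <= sum_n (fun n => g n ^ 2) N).
      { apply NNPP. intros HN. assert (S <= S / 2); [| lra]. apply Hlub. intros y [N ->].
        left. apply Rnot_le_lt. intros Hc. apply HN. exists N. exact Hc. }
      destruct HN as [N HN].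
      destruct (HS (S / 2) N ltac:(lra) HN) as (eps0 & He0 & HE).
      exists eps0. split; auto. intros eps M w He Hd Hw. left.
      apply (l2_le_weaken g S); auto. specialize (HE eps M w He Hd Hw). lra.
  - assert (HN : exists N, Rmax B 1 <= sum_n (fun n => g n ^ 2) N).
    { apply NNPP. intros HN. apply Hb. exists (Rmax B 1). intros y [N ->].
      left. apply Rnot_le_lt. intros Hc. apply HN. exists N. exact Hc. }
    destruct HN as [N HN].
    pose proof (Rmax_l B 1). pose proof (Rmax_r B 1).
    destruct (HS (Rmax B 1) N ltac:(lra) HN) as (eps0 & He0 & HE).
    exists eps0. split; auto. intros eps M w He Hd Hw. right.
    specialize (HE eps M w He Hd Hw). lra.
Qed.

(** * Error rates in [eps] and [M] *)

Lemma Rpower_ge_1 (x s : R) : 1 <= x -> 0 <= s -> 1 <= Rpower x s.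
Proof. intros Hx Hs. rewrite <- (Rpower_1_base s). apply Rle_Rpower_l; lra. Qed.

(** A lower bound for [alpha] is raised to the power [s]; in the applications [y] is [M / eps] and
    [th * s] is [1 / b], so that the left side is the amplification of the noise. *)
Lemma alpha_root_bound (alpha th s c y : R) :
  0 < alpha -> 0 < c -> 0 < y -> 0 <= s -> 1 <= Rpower alpha th * (c * y) ->
  Rpower alpha (- (th * s)) <= Rpower c s * Rpower y s.
Proof.
  intros Ha Hc Hy Hs H. apply (Rpower_ge_1 _ s) in H; auto.
  rewrite <- !Rpower_mult_distr, Rpower_mult in H by (auto; try apply exp_pos; apply Rmult_lt_0_compat; auto).
  rewrite Rpower_Ropp. assert (Hp : 0 < Rpower alpha (th * s)) by apply exp_pos.
  apply Rmult_le_reg_l with (Rpower alpha (th * s)); auto. rewrite Rinv_r by lra. exact H.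
Qed.

Lemma eps_scale_bound (eps c M s : R) :
  0 < eps -> 0 < c -> 0 < M -> 0 <= s -> eps <= c * M ->
  eps <= Rpower c s * (Rpower (M / eps) s * eps).
Proof.
  intros He Hc HM Hs H.
  assert (HMe : 0 < M / eps) by (apply Rdiv_lt_0_compat; auto).
  rewrite <- Rmult_assoc, Rpower_mult_distr by auto.
  rewrite <- (Rmult_1_l eps) at 1. apply Rmult_le_compat_r; [lra|].
  apply Rpower_ge_1; auto. apply Rmult_le_reg_r with eps; auto.
  replace (c * (M / eps) * eps) with (c * M) by (field; lra). lra.
Qed.

(** This form leaves the coefficient of [Z] equal to [1], as (ii) demands. *)
Lemma norm_le_of_sq (N A X Z : R) :
  0 <= A -> 0 <= X -> 0 <= Z -> N ^ 2 <= A * X ^ 2 + Z ^ 2 -> N <= sqrt A * X + Z.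
Proof.
  intros HA HX HZ H. pose proof (sqrt_pos A) as Hs.
  assert (0 <= sqrt A * X) by (apply Rmult_le_pos; auto).
  apply sq_le_reg; [lra|].
  assert (E : (sqrt A * X) ^ 2 = A * X ^ 2) by (rewrite Rpow_mult_distr, pow2_sqrt; auto).
  assert (0 <= sqrt A * X * Z) by (apply Rmult_le_pos; auto).
  nra.
Qed.

(** The amplified noise [alpha^(-1/b) eps] already has the main rate, by the lower bound of order
    [(eps / M)^(b/(p+1))] for [alpha]; [KA] accounts for it and [K5] for the plain noise. The
    borderline [p + 1 = b] is included, so (ii) at [p = b - 1] is also obtained here. *)
Lemma backward_estimate_rough (b p tau K l0 : R) :
  0 < K -> 1 < tau -> p + 1 <= b ->
  exists C, 0 <= C /\ forall lam f a w e eps alpha M N,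
    lam 0%nat = l0 -> backward_data lam f a w e b p tau K eps alpha M ->
    is_series (fun n => e n ^ 2) (N ^ 2) ->
    N <= C * (Rpower eps (p / (p + 1)) * Rpower M (1 / (p + 1))).
Proof.
  intros HK Htau Hpb.
  set (KA := Rpower (K / (tau - 1)) (1 / (p + 1))).
  set (K5 := Rpower (K / ((tau - 1) * Rpower l0 (p + 1))) (1 / (p + 1))).
  set (A := 2 * K ^ 2 * (K ^ 2 * (2 * tau ^ 2 + 2) + 1) + 2 * K ^ 2 * (2 * K5 ^ 2 + 2 * KA ^ 2)).
  exists (sqrt A). split; [apply sqrt_pos|].
  intros lam f a w e eps alpha M N Hl0 D HN.
  pose proof (bd_M_pos _ _ _ _ _ _ _ _ _ _ _ _ D) as HM.
  pose proof (bd_eps_le _ _ _ _ _ _ _ _ _ _ _ _ D) as HeM.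
  pose proof (bd_eps D) as He. pose proof (bd_p D) as Hp. pose proof (bd_alpha D) as Ha. pose proof (bd_b D) as Hb.
  destruct (Rpower_interpolation_scale p eps M Hp He HM) as [HL1 HL2].
  set (L := Rpower (M / eps) (1 / (p + 1))) in *. assert (HL : 0 < L) by apply exp_pos.
  rewrite <- HL2. set (X := L * eps) in *. assert (HX : 0 < X) by (apply Rmult_lt_0_compat; auto).
  assert (Hs : 0 < 1 / (p + 1)) by (apply Rdiv_lt_0_compat; lra).
  assert (HMe : 0 < M / eps) by (apply Rdiv_lt_0_compat; auto).
  assert (H5 : eps <= K5 * X).
  { apply eps_scale_bound; auto; try lra.
    - apply Rdiv_lt_0_compat; auto. apply Rmult_lt_0_compat; [lra | apply exp_pos].
    - rewrite <- Hl0. exact HeM. }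
  set (nu := Rpower alpha (- (1 / b))). assert (Hnu0 : 0 < nu) by apply exp_pos.
  assert (Hnu : nu * eps <= KA * X).
  { unfold X. rewrite <- Rmult_assoc. apply Rmult_le_compat_r; [lra|].
    unfold nu. replace (1 / b) with ((p + 1) / b * (1 / (p + 1))) by (field; lra).
    apply alpha_root_bound; auto; try lra. apply Rdiv_lt_0_compat; lra.
    pose proof (bd_alpha_lower_rough _ _ _ _ _ _ _ _ _ _ _ _ D Hpb) as HA.
    apply Rmult_le_reg_l with ((tau - 1) * eps). apply Rmult_lt_0_compat; lra.
    rewrite Rmult_1_r. eapply Rle_trans; [exact HA|]. right. field. lra. }
  assert (HE := bd_err_split _ _ _ _ _ _ _ _ _ _ _ _ D _ _
    (bd_damped_initial _ _ _ _ _ _ _ _ _ _ _ _ D L HL HL1)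
    (bd_noise_bound _ _ _ _ _ _ _ _ _ _ _ _ D nu
      (fun n => reg_eig_le b alpha (lam n) Hb Ha (bd_lam_pos _ _ _ _ _ _ _ _ _ _ _ _ D n)))).
  apply (series_le_l2 _ _ _ HN) in HE. fold X in HE.
  replace (sqrt A * X) with (sqrt A * X + 0) by ring.
  pose proof (pow2_ge_0 K) as HK2. pose proof (pow2_ge_0 tau).
  assert (HK5 : eps ^ 2 <= (K5 * X) ^ 2) by (apply pow_incr; lra).
  assert (HKA : (nu * eps) ^ 2 <= (KA * X) ^ 2).
  { apply pow_incr. split; auto. left; apply Rmult_lt_0_compat; auto. }
  apply norm_le_of_sq; try lra.
  - unfold A. apply Rplus_le_le_0_compat; apply Rmult_le_pos; try lra.
    + apply Rplus_le_le_0_compat; [apply Rmult_le_pos; lra | lra].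
    + pose proof (pow2_ge_0 K5). pose proof (pow2_ge_0 KA). lra.
  - eapply Rle_trans; [exact HE|].
    replace ((2 + 2 * nu ^ 2) * eps ^ 2) with (2 * eps ^ 2 + 2 * (nu * eps) ^ 2) by ring.
    assert (HF : 2 * eps ^ 2 + 2 * (nu * eps) ^ 2 <= (2 * K5 ^ 2 + 2 * KA ^ 2) * X ^ 2) by (rewrite Rpow_mult_distr in HK5, HKA; lra).
    apply (Rmult_le_compat_l (2 * K ^ 2)) in HF; [| lra]. unfold A. lra.
Qed.

(* If the data [f] lies in [D(A^(p+1))], then [||A^(p+1) f||] is controlled by [M]
   for small [eps] and the noise can be interpolated between [eps] and [M];
   otherwise [M] is large for small [eps], and then [alpha] is large compared with [eps / M]. *)
Lemma backward_estimate_smooth (b p tau K l0 : R) :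
  0 < K -> 1 < tau -> 1 < b -> 0 < l0 -> b < p + 1 ->
  exists C, 0 <= C /\ forall lam f F,
    lam 0%nat = l0 -> (forall n, lam n < lam (S n)) -> is_series (fun n => f n ^ 2) F ->
    exists eps0, 0 < eps0 /\ forall a w e eps alpha M N,
      eps < eps0 -> eps ^ 2 <= F -> backward_data lam f a w e b p tau K eps alpha M ->
      is_series (fun n => e n ^ 2) (N ^ 2) ->
      N <= C * (Rpower eps (p / (p + 1)) * Rpower M (1 / (p + 1)))
           + Rpower eps ((b - 1) / b) * Rpower M (1 / b).
Proof.
  intros HK Htau Hb Hl0 Hpb.
  set (K5 := Rpower (K / ((tau - 1) * Rpower l0 (p + 1))) (1 / (p + 1))).
  set (A := 2 * K ^ 2 * (K ^ 2 * (2 * tau ^ 2 + 2) + 1)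
     + 2 * K ^ 2 * (2 * K5 ^ 2 + (1 / l0 + 1) ^ 2 * (1 + 2 * K ^ 2 + 2 * (8 * K ^ 2)))).
  exists (sqrt A). split; [apply sqrt_pos|].
  intros lam f F Hlam0 Hlam HfF.
  (* [r] is chosen so that the coefficient [2 K (2 r K / (tau - 1))^(1/b)] of the last term is [1]. *)
  set (r := (tau - 1) / (2 * K * Rpower (2 * K) b)).
  assert (HKb : 0 < Rpower (2 * K) b) by apply exp_pos.
  assert (Hr : 0 < r) by (apply Rdiv_lt_0_compat; [lra | apply Rmult_lt_0_compat; lra]).
  set (Q := Rpower r (1 / (b - (p + 1)))). assert (HQ : 0 < Q) by apply exp_pos.
  assert (HQr : Rpower Q (b - (p + 1)) = r).
  { unfold Q. rewrite Rpower_mult. replace (1 / (b - (p + 1)) * (b - (p + 1))) with 1 by (field; lra). apply Rpower_1; auto. }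
  (* The level is chosen so that [B <= 4 K^2 M^2] becomes [Q^(2b) (4 F) <= (r K M)^2], the
     low-frequency hypothesis of [bd_alpha_lower_smooth]; [4 F] bounds [||u(T)||^2]. *)
  destruct (data_smoothness_dichotomy lam f K (p + 1) (16 * Rpower Q b ^ 2 * F / r ^ 2)) as (eps0 & He0 & HD); auto; try lra.
  exists eps0. split; auto.
  intros a w e eps alpha M N Heps HeF D HN.
  pose proof (bd_M_pos _ _ _ _ _ _ _ _ _ _ _ _ D) as HM.
  pose proof (bd_eps_le _ _ _ _ _ _ _ _ _ _ _ _ D) as HeM.
  pose proof (bd_eps D) as He. pose proof (bd_p D) as Hp. pose proof (bd_alpha D) as Ha.
  destruct (Rpower_interpolation_scale p eps M Hp He HM) as [HL1 HL2].
  set (L := Rpower (M / eps) (1 / (p + 1))) in *. assert (HL : 0 < L) by apply exp_pos.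
  rewrite <- HL2. set (X := L * eps) in *. assert (HX : 0 < X) by (apply Rmult_lt_0_compat; auto).
  assert (Hs : 0 < 1 / (p + 1)) by (apply Rdiv_lt_0_compat; lra).
  assert (Hsb : 0 < 1 / b) by (apply Rdiv_lt_0_compat; lra).
  assert (HMe : 0 < M / eps) by (apply Rdiv_lt_0_compat; auto).
  set (Z := Rpower eps ((b - 1) / b) * Rpower M (1 / b)).
  assert (HZ : 0 < Z) by (apply Rmult_lt_0_compat; apply exp_pos).
  pose proof (pow2_ge_0 K) as HK2. pose proof (pow2_ge_0 tau) as Ht2. pose proof (pow2_ge_0 K5) as HK52.
  assert (HA1 : 0 <= 2 * K ^ 2 * (K ^ 2 * (2 * tau ^ 2 + 2) + 1)).
  { apply Rmult_le_pos; [lra|]. apply Rplus_le_le_0_compat; [apply Rmult_le_pos; lra | lra]. }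
  assert (HA2 : 0 <= (1 / l0 + 1) ^ 2 * (1 + 2 * K ^ 2 + 2 * (8 * K ^ 2))).
  { apply Rmult_le_pos; [apply pow2_ge_0 | lra]. }
  assert (HA3 : 0 <= 2 * K ^ 2 * (2 * K5 ^ 2)) by (apply Rmult_le_pos; lra).
  assert (HA4 : 0 <= 2 * K ^ 2 * ((1 / l0 + 1) ^ 2 * (1 + 2 * K ^ 2 + 2 * (8 * K ^ 2)))) by (apply Rmult_le_pos; lra).
  assert (HX2 : 0 <= X ^ 2) by apply pow2_ge_0.
  assert (HA : 0 <= A) by (unfold A; lra).
  apply norm_le_of_sq; try lra.
  pose proof (bd_damped_initial _ _ _ _ _ _ _ _ _ _ _ _ D L HL HL1) as HI. fold X in HI.
  destruct (HD eps M w (conj He Heps) (bd_noise D) (bd_terminal_smooth _ _ _ _ _ _ _ _ _ _ _ _ D)) as [Hsm|HB].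
  - pose proof (bd_noise_smooth _ _ _ _ _ _ _ _ _ _ _ _ D L (8 * K ^ 2) HL HL1 ltac:(lra) Hsm) as HNs.
    fold X in HNs. rewrite Hlam0 in HNs.
    pose proof (bd_err_split _ _ _ _ _ _ _ _ _ _ _ _ D _ _ HI HNs) as HE.
    apply (series_le_l2 _ _ _ HN) in HE. eapply Rle_trans; [exact HE|].
    apply Rle_trans with (A * X ^ 2); [| pose proof (pow2_ge_0 Z); lra].
    apply (Rmult_le_compat_r (X ^ 2)) in HA3; auto. unfold A. lra.
  - assert (Hw : l2_le w (4 * F)).
    { apply (l2_le_weaken _ (2 * F + 2 * eps ^ 2)); [lra|].
      apply (l2_le_comb _ f (fun n => w n - f n)); try lra; [| apply l2_le_of_series; auto | apply D].
      intros n. replace (w n) with (f n + (w n - f n)) at 1 by ring. apply sq_add_le. }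
    assert (HQF : Rpower Q b ^ 2 * (4 * F) <= (Rpower Q (b - (p + 1)) * (K * M)) ^ 2).
    { rewrite HQr. assert (Hr2 : 0 < r ^ 2) by (apply pow_lt; auto).
      apply (Rmult_le_compat_r (r ^ 2)) in HB; [| lra].
      replace (16 * Rpower Q b ^ 2 * F / r ^ 2 * r ^ 2) with (16 * Rpower Q b ^ 2 * F) in HB by (field; lra).
      rewrite !Rpow_mult_distr. lra. }
    pose proof (bd_alpha_lower_smooth _ _ _ _ _ _ _ _ _ _ _ _ D Q (4 * F) ltac:(lra) HQ Hw HQF) as HAl.
    rewrite HQr in HAl.
    set (nu := Rpower alpha (- (1 / b))). assert (Hnu0 : 0 < nu) by apply exp_pos.
    assert (HZ2 : 2 * K * (nu * eps) <= Z).
    { assert (Hc : 0 < / Rpower (2 * K) b) by (apply Rinv_0_lt_compat; auto).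
      assert (Hn : nu <= Rpower (/ Rpower (2 * K) b) (1 / b) * Rpower (M / eps) (1 / b)).
      { unfold nu. replace (1 / b) with (1 * (1 / b)) at 1 by ring.
        apply alpha_root_bound; auto; try lra. rewrite Rpower_1 by auto.
        apply Rmult_le_reg_l with ((tau - 1) * eps). apply Rmult_lt_0_compat; lra.
        rewrite Rmult_1_r. eapply Rle_trans; [exact HAl|]. right. unfold r. field. lra. }
      rewrite Rpower_inv_base, Rpower_Ropp, Rpower_mult in Hn by auto.
      replace (b * (1 / b)) with 1 in Hn by (field; lra). rewrite Rpower_1 in Hn by lra.
      (* With [b - 1] in the role of [p], [(M / eps)^(1/b) eps] is the last term of (ii). *)
      destruct (Rpower_interpolation_scale (b - 1) eps M ltac:(lra) He HM) as [_ HZe].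
      replace (b - 1 + 1) with b in HZe by ring. unfold Z. rewrite <- HZe.
      apply Rle_trans with (2 * K * (/ (2 * K) * Rpower (M / eps) (1 / b) * eps)).
      - apply Rmult_le_compat_l; [lra|]. apply Rmult_le_compat_r; lra.
      - right. field. lra. }
    assert (H5 : eps <= K5 * X).
    { apply eps_scale_bound; auto; try lra.
      - apply Rdiv_lt_0_compat; auto. apply Rmult_lt_0_compat; [lra | apply exp_pos].
      - rewrite <- Hlam0. exact HeM. }
    pose proof (bd_err_split _ _ _ _ _ _ _ _ _ _ _ _ D _ _ HI
      (bd_noise_bound _ _ _ _ _ _ _ _ _ _ _ _ D nu
        (fun n => reg_eig_le b alpha (lam n) Hb Ha (bd_lam_pos _ _ _ _ _ _ _ _ _ _ _ _ D n)))) as HE.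
    apply (series_le_l2 _ _ _ HN) in HE. eapply Rle_trans; [exact HE|].
    replace (2 * K ^ 2 * ((2 + 2 * nu ^ 2) * eps ^ 2)) with (2 * K ^ 2 * (2 * eps ^ 2) + (2 * K * (nu * eps)) ^ 2) by ring.
    assert (HK5 : eps ^ 2 <= (K5 * X) ^ 2) by (apply pow_incr; lra).
    rewrite Rpow_mult_distr in HK5.
    assert (HZ3 : (2 * K * (nu * eps)) ^ 2 <= Z ^ 2).
    { apply pow_incr. split; auto. apply Rmult_le_pos; [lra|]. apply Rmult_le_pos; lra. }
    apply (Rmult_le_compat_l (2 * K ^ 2 * 2)) in HK5; [| lra].
    apply (Rmult_le_compat_r (X ^ 2)) in HA4; auto. unfold A. lra.
Qed.

(** * The backward problem *)

(** Existence is the intermediate value property. Uniqueness is strict monotonicity, which requires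
    a nonzero coordinate of [f]; Parseval provides one as [norm f > 0]. All damping factors being
    less than [1], the residual stays below [norm f], whence the strict bound on [d]. *)
Lemma discrepancy_principle {H : CompleteNormedModule R_AbsRing} (inner : H -> H -> R) (A : operator H)
    (lam : nat -> R) (phi : nat -> H) (b d : R) (f : H) :
  is_inner inner -> eigenbasis inner A lam phi -> 0 <= b -> 0 < d < norm f ->
  exists! alpha : R, 0 < alpha /\ norm (minus (B_op inner lam phi b alpha f) f) = d.
Proof.
  intros HI HE Hb Hd.
  pose proof (parseval inner A lam phi f HI HE) as HP.
  assert (Hdf : 0 < d ^ 2 < norm f ^ 2) by nra.
  set (c := fun n => inner f (phi n)) in *.
  destruct (discrepancy_exists b (norm f ^ 2) (d ^ 2) lam c Hb (eb_pos _ _ _ _ HE) (eb_incr _ _ _ _ HE) HP Hdf)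
    as (alpha & Ha & HS).
  exists alpha. split.
  - split; auto. pose proof (B_residual inner A lam phi b alpha f HI HE Ha) as HB.
    apply is_series_unique in HB. fold c in HB.
    change (Series (fun n => (damp b alpha (lam n) * c n) ^ 2) = norm (minus (B_op inner lam phi b alpha f) f) ^ 2) in HB.
    rewrite HS in HB.
    pose proof (norm_ge_0 (minus (B_op inner lam phi b alpha f) f)) as Hn.
    apply Rle_antisym; apply sq_le_reg; lra.
  - intros beta [Hb0 HN].
    pose proof (B_residual inner A lam phi b beta f HI HE Hb0) as HB.
    apply is_series_unique in HB. rewrite HN in HB.
    change (Series (fun n => (damp b beta (lam n) * c n) ^ 2) = d ^ 2) in HB.
    assert (Hk : exists k, c k <> 0).
    { apply NNPP. intros Hk. assert (norm f ^ 2 <= 0); [| lra].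
      apply (series_le_l2 c _ _ HP). intros N.
      apply Rle_trans with (sum_n (fun n => 0 * 0 + 0 * 0) N).
      - apply sum_n_le. intros n _. right. replace (c n) with 0. ring.
        symmetry. apply NNPP. intros Hn. apply Hk. exists n. exact Hn.
      - rewrite (sum_n_lincomb (fun _ => 0) (fun _ => 0)). lra. }
    destruct Hk as [k Hk].
    assert (Hex : ex_series (fun n => c n ^ 2)) by (exists (norm f ^ 2); exact HP).
    destruct (Rtotal_order alpha beta) as [Hlt|[Heq|Hgt]]; auto; exfalso.
    + pose proof (damped_series_incr b alpha beta lam c k (conj Ha Hlt) Hex Hk). lra.
    + pose proof (damped_series_incr b beta alpha lam c k (conj Hb0 Hgt) Hex Hk). lra.
Qed.

(** [K] is chosen before [f], [eps], [alpha] and the solutions, which makes the final constants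
    uniform. It adds up [K1] for [bd_upper], [K2] for [bd_lower] and [C] for [bd_err]. *)
Lemma backward_data_of_solutions {H : CompleteNormedModule R_AbsRing} (inner : H -> H -> R)
    (A : operator H) (lam : nat -> R) (phi : nat -> H) (gamma T b p tau : R) :
  is_inner inner -> self_adjoint inner A -> eigenbasis inner A lam phi ->
  0 < gamma < 1 -> 0 < T -> 1 < b -> 1 < tau -> 0 < p ->
  exists K, 0 < K /\ forall (f : H) (eps alpha : R) (u v : R -> H),
    0 < eps -> 0 < alpha ->
    norm (minus (B_op inner lam phi b alpha f) f) = tau * eps ->
    is_solution gamma T A u -> norm (minus (u T) f) <= eps ->
    in_DAp inner lam phi p (u 0) ->
    is_solution gamma T (A_op inner lam phi b alpha) v -> v T = f ->
    backward_data lam (fun n => inner f (phi n)) (fun n => inner (u 0) (phi n))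
      (fun n => inner (u T) (phi n)) (fun n => inner (minus (u 0) (v 0)) (phi n))
      b p tau K eps alpha (norm_p inner lam phi p (u 0)).
Proof.
  intros HI Hsa HE Hg HT Hb Htau Hp.
  pose proof (eb_pos _ _ _ _ HE) as H0.
  pose proof (Gamma_pos (1 - gamma) ltac:(lra)) as HG. set (G := Gamma (1 - gamma)) in *.
  assert (HW : 0 < Rpower T gamma) by apply exp_pos. set (W := Rpower T gamma) in *.
  destruct (relaxation_backward_stability gamma T G (lam 0%nat) Hg HT HG H0) as (C & HC & HS).
  assert (HGW : 0 < G * (1 - gamma) * W) by (apply Rmult_lt_0_compat; [apply Rmult_lt_0_compat|]; lra).
  assert (HGW2 : 0 < G * W) by (apply Rmult_lt_0_compat; lra).
  set (K1 := 1 / (G * (1 - gamma) * W)). set (K2 := 1 / lam 0%nat + G * W).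
  assert (HK1 : 0 < K1) by (apply Rdiv_lt_0_compat; lra).
  assert (H1l : 0 < 1 / lam 0%nat) by (apply Rdiv_lt_0_compat; lra).
  assert (HK2 : 0 < K2) by (unfold K2; lra).
  exists (K1 + K2 + C). split; [lra|].
  intros f eps alpha u v He Ha HB Hu HuT HuD Hv HvT.
  assert (Hlam : forall n, lam 0%nat <= lam n) by (intros; apply (eigenvalue_ge inner A lam phi); auto).
  assert (HY : forall n, relaxation gamma (lam n * G) T (fun t => inner (u (clamp T t)) (phi n))).
  { intros n. apply (solution_coordinate inner gamma T A); auto.
    intros x Hx. apply (eigen_coord inner A lam); auto. }
  assert (HZ : forall n, relaxation gamma (lam n / (1 + alpha * Rpower (lam n) b) * G) T (fun t => inner (v (clamp T t)) (phi n))).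
  { intros n. apply (solution_coordinate inner gamma T (A_op inner lam phi b alpha)); auto.
    intros x Hx. apply (diag_op_coord inner A lam); auto. }
  assert (Hc0 : clamp T 0 = 0) by (apply clamp_id; lra).
  assert (HcT : clamp T T = T) by (apply clamp_id; lra).
  constructor; auto; try lra.
  - apply sqrt_pos.
  - intros n. pose proof (Hlam n) as Hln.
    assert (HlG : 0 <= lam n * G) by (apply Rmult_le_pos; lra).
    pose proof (relaxation_upper_abs gamma (lam n * G) T _ Hg HlG HT (HY n)) as E.
    cbv beta in E. rewrite Hc0, HcT in E. fold W in E.
    pose proof (Rabs_pos (inner (u T) (phi n))). pose proof (Rabs_pos (inner (u 0) (phi n))).
    apply Rle_trans with (K1 * Rabs (inner (u 0) (phi n))); [| apply Rmult_le_compat_r; lra].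
    apply Rmult_le_reg_l with (G * (1 - gamma) * W); auto.
    replace (G * (1 - gamma) * W * (K1 * Rabs (inner (u 0) (phi n)))) with (Rabs (inner (u 0) (phi n)))
      by (unfold K1; field; lra).
    lra.
  - intros n. pose proof (Hlam n) as Hln.
    assert (HlG : 0 <= lam n * G) by (apply Rmult_le_pos; lra).
    pose proof (relaxation_lower_abs gamma (lam n * G) T _ (proj1 Hg) HlG HT (HY n)) as E.
    cbv beta in E. rewrite Hc0, HcT in E. fold W in E.
    pose proof (Rabs_pos (inner (u T) (phi n))) as Hw.
    assert (Hlw : 0 <= lam n * Rabs (inner (u T) (phi n))) by (apply Rmult_le_pos; lra).
    apply Rle_trans with (K2 * (lam n * Rabs (inner (u T) (phi n)))); [| apply Rmult_le_compat_r; lra].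
    eapply Rle_trans; [exact E|]. rewrite <- Rmult_assoc. apply Rmult_le_compat_r; auto.
    unfold K2. assert (1 <= 1 / lam 0%nat * lam n).
    { apply Rmult_le_reg_l with (lam 0%nat); auto.
      replace (lam 0%nat * (1 / lam 0%nat * lam n)) with (lam n) by (field; lra). lra. }
    lra.
  - intros n. pose proof (Hlam n) as Hln.
    assert (Hx : 0 < alpha * Rpower (lam n) b) by (apply Rmult_lt_0_compat; [auto | apply exp_pos]).
    pose proof (HS (lam n) (alpha * Rpower (lam n) b) _ _ Hln Hx (HY n) (HZ n)) as E.
    cbv beta in E. rewrite Hc0, HcT, HvT in E.
    replace (inner (minus (u 0) (v 0)) (phi n)) with (inner (u 0) (phi n) - inner (v 0) (phi n))
      by (symmetry; exact (inner_minus_l inner (u 0) (v 0) (phi n) HI)).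
    eapply Rle_trans; [exact E|]. apply Rmult_le_compat_r; [| lra].
    pose proof (damp_bounds b alpha (lam n) Ha). pose proof (reg_eig_pos b alpha (lam n) Ha ltac:(lra)).
    unfold damp, reg_eig in *. apply Rplus_le_le_0_compat; apply Rmult_le_pos; try apply Rabs_pos; lra.
  - apply (l2_le_weaken _ (norm (minus (u T) f) ^ 2)).
    + apply pow_incr. split; [apply norm_ge_0 | exact HuT].
    + apply l2_le_of_series. eapply is_series_ext; [| exact (parseval inner A lam phi (minus (u T) f) HI HE)].
      intros n. cbv beta. f_equal. exact (inner_minus_l inner (u T) f (phi n) HI).
  - rewrite <- HB. exact (B_residual inner A lam phi b alpha f HI HE Ha).
  - unfold norm_p. rewrite pow2_sqrt.
    + apply l2_le_of_series. eapply is_series_ext; [| apply Series_correct; exact HuD].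
      intros n. cbv beta. rewrite Rpow_mult_distr. change (@eq R (Rpower (lam n) (2 * p) * inner (u 0) (phi n) ^ 2) (Rpower (lam n) p ^ 2 * inner (u 0) (phi n) ^ 2)). f_equal.
      replace (2 * p) with (p + p) by ring. rewrite Rpower_plus. ring.
    + assert (Ht : forall n, 0 <= Rpower (lam n) (2 * p) * inner (u 0) (phi n) ^ 2).
      { intros n. apply Rmult_le_pos; [left; apply exp_pos | apply pow2_ge_0]. }
      eapply Rle_trans; [apply (Ht 0%nat)|].
      pose proof (sum_n_le_series _ _ 0 Ht (Series_correct _ HuD)) as E. rewrite sum_O in E. exact E.
Qed.

Theorem theorem3
  (H : CompleteNormedModule R_AbsRing) (inner : H -> H -> R)
  (Hinner : is_inner inner)
  (A : operator H) (lam : nat -> R) (phi : nat -> H)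
  (HA : standing_assumptions inner A lam phi)
  (gamma T b tau : R)
  (Hgamma : 0 < gamma < 1) (HT : 0 < T) (Hb : 1 < b) (Htau : 1 < tau) :
  (forall (f : H) (eps : R),
     0 < eps < norm f -> 0 < tau * eps < norm f ->
     exists! alpha : R,
       0 < alpha /\
       norm (minus (B_op inner lam phi b alpha f) f) = tau * eps)
  /\
  (forall p : R, 0 < p ->
   exists C3 C4 : R,
   forall f : H,
   exists eps0 : R, 0 < eps0 /\
   forall (eps alpha : R) (u v : R -> H),
     0 < eps < eps0 ->
     eps < norm f -> 0 < tau * eps <= norm f ->
     0 < alpha ->
     norm (minus (B_op inner lam phi b alpha f) f) = tau * eps ->
     is_solution gamma T A u ->
     norm (minus (u T) f) <= eps ->
     in_DAp inner lam phi p (u 0) ->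
     is_solution gamma T (A_op inner lam phi b alpha) v ->
     v T = f ->
     (p < b - 1 ->
        norm (minus (u 0) (v 0)) <=
          C3 * rpow eps (p / (p + 1))
             * rpow (norm_p inner lam phi p (u 0)) (1 / (p + 1)))
     /\
     (b - 1 <= p ->
        norm (minus (u 0) (v 0)) <=
          C4 * rpow eps (p / (p + 1))
             * rpow (norm_p inner lam phi p (u 0)) (1 / (p + 1))
          + rpow eps ((b - 1) / b)
             * rpow (norm_p inner lam phi p (u 0)) (1 / b))).
Proof.
  destruct HA as (Hsa & _ & _ & HE).
  assert (Hrp : forall x y, 0 < x -> rpow x y = Rpower x y).
  { intros x y Hx. unfold rpow. destruct (Req_EM_T x 0); [lra | reflexivity]. }
  split.
  - intros f eps _ Hf. apply (discrepancy_principle inner A); auto. lra.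
  - intros p Hp.
    destruct (backward_data_of_solutions inner A lam phi gamma T b p tau Hinner Hsa HE Hgamma HT Hb Htau Hp)
      as (K & HK & HD).
    (* For [p + 1 <= b] the rough estimate gives (i) and also (ii) at [p = b - 1], where the last
       term is merely added as a positive quantity. *)
    destruct (Rle_lt_dec (p + 1) b) as [Hpb|Hpb].
    + destruct (backward_estimate_rough b p tau K (lam 0%nat) HK Htau Hpb) as (C & HC & HEst).
      exists C, C. intros f. exists 1. split; [lra|].
      intros eps alpha u v He Hef _ Ha HB Hu HuT HuD Hv HvT.
      specialize (HD f eps alpha u v (proj1 He) Ha HB Hu HuT HuD Hv HvT).
      rewrite !Hrp by (try lra; exact (bd_M_pos _ _ _ _ _ _ _ _ _ _ _ _ HD)).
      assert (HN := HEst _ _ _ _ _ _ _ _ _ eq_refl HD (parseval inner A lam phi (minus (u 0) (v 0)) Hinner HE)).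
      rewrite <- Rmult_assoc in HN. split; intros _; [exact HN|].
      eapply Rle_trans; [exact HN|].
      assert (0 < Rpower eps ((b - 1) / b) * Rpower (norm_p inner lam phi p (u 0)) (1 / b))
        by (apply Rmult_lt_0_compat; apply exp_pos).
      lra.
    + destruct (backward_estimate_smooth b p tau K (lam 0%nat) HK Htau Hb (eb_pos _ _ _ _ HE) Hpb) as (C & HC & HEst).
      (* [C3 = 0] will do, as (i) is void for [p > b - 1]. *)
      exists 0, C. intros f.
      destruct (HEst lam (fun n => inner f (phi n)) (norm f ^ 2) eq_refl (eb_incr _ _ _ _ HE)
        (parseval inner A lam phi f Hinner HE)) as (eps0 & He0 & HEst').
      exists eps0. split; auto.
      intros eps alpha u v He Hef _ Ha HB Hu HuT HuD Hv HvT.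
      specialize (HD f eps alpha u v (proj1 He) Ha HB Hu HuT HuD Hv HvT).
      split; intros Hpb'; [lra|].
      rewrite !Hrp by (try lra; exact (bd_M_pos _ _ _ _ _ _ _ _ _ _ _ _ HD)).
      assert (HN := HEst' _ _ _ _ _ _ _ (proj2 He) (pow_incr _ _ 2 (conj (Rlt_le _ _ (proj1 He)) (Rlt_le _ _ Hef))) HD
        (parseval inner A lam phi (minus (u 0) (v 0)) Hinner HE)).
      rewrite <- Rmult_assoc in HN. exact HN.
Qed.
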